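(* Let $\mathcal{B}(\Omega)$ be an $\ell^2$-valued Bergman-type space, and let $\kappa\in[0,2)$ be the constant from property (A.6). There are constants $c,C>0$, depending only on the space, such that the following holds. Let $T:\mathcal{B}(\Omega)\to\mathcal{B}(\Omega)$ be a bounded linear operator with adjoint $T^*$. Suppose that for some $p$ with $\frac{4-\kappa}{2-\kappa}<p<\infty$ $$\sup_{i\in\mathbb{N}}\sup_{z\in\Omega}\left(\int_{\Omega}\left(\sum_{k=1}^{\infty}\left|\left\langle U_zT^*(k_ze_i)(u),e_k\right\rangle_{\ell^2}\right|\right)^{p}d\sigma(u)\right)^{1/p}<\infty$$ and $$\sup_{k\in\mathbb{N}}\sup_{z\in\Omega}\left(\int_{\Omega}\left(\sum_{i=1}^{\infty}\left|\left\langle U_zT(k_ze_k)(u),e_i\right\rangle_{\ell^2}\right|\right)^{p}d\sigma(u)\right)^{1/p}<\infty,$$ and that $$\limsup_{d\to\infty}\left\|TM_{I_{(d)}}\right\|_{\mathcal{L}(\mathcal{B}(\Omega),L^2(\Omega,\ell^2;d\sigma))}=0.$$ Then: (a) $\displaystyle c\,\|T\|_e\le\sup_{\|f\|_{\mathcal{B}(\Omega)}\le1}\ \limsup_{\mathfrak{d}(z,0)\to\infty}\|T^zf\|_{\mathcal{B}(\Omega)}\le C\,\|T\|_e.$ (b) If $\displaystyle\sup_{e}\ \lim_{\mathfrak{d}(z,0)\to\infty}\|T(k_ze)\|_{\mathcal{B}(\Omega)}=0$, where the supremum is over all finite $e\in\ell^2$ with $\|e\|_{\ell^2}=1$, then $T$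 is compact.
   Context: Notation: $\{e_k\}_{k\ge1}$ is the standard orthonormal basis of $\ell^2$; a vector $e\in\ell^2$ is finite if only finitely many coordinates are nonzero. A function $f:\Omega\to\ell^2$ is measurable (analytic) if every $\langle f(\cdot),e_k\rangle_{\ell^2}$ is. $L^2(\Omega,\ell^2;d\sigma)$ has inner product $\int_\Omega\langle f,g\rangle_{\ell^2}d\sigma$. $A\lesssim B$ means $A\le CB$ for a constant $C$; $A\simeq B$ means $A\lesssim B$ and $B\lesssim A$. $\mathcal{L}(X,Y)$ is the space of bounded linear operators with the operator norm. An $\ell^2$-valued Bergman-type space $\mathcal{B}(\Omega)$ is given by the following data and assumptions. (A.1) $\Omega\subset\mathbb{C}^n$ is a connected open set containing $0$; for each $z\in\Omega$ there is an involution $\varphi_z\in\mathrm{Aut}(\Omega)$ (biholomorphic, $\varphi_z\circ\varphi_z=\mathrm{id}$) with $\varphi_z(0)=z$. (A.2) $\mathfrak{d}$ is a metric on $\Omega$ with $\mathfrak{d}(u,v)\simeq\mathfrak{d}(\varphi_z(u),\varphi_z(v))$, constants independent of $z,u,v$; $(\Omega,\mathfrak{d})$ is separable and its closed balls are compact. $D(z,r)$ is the $\mathfrak{d}$-ball of center $z$ and radius $r$. (A.3) $\sigma$ is a finite Borel measure on $\Omega$. $\mathcal{B}(\Omega)$ is the space of analytic $f:\Omega\to\ell^2$ in $L^2(\Omega,\ell^2;d\sigma)$, and $\mathcal{B}(\Omega,\mathbb{C})$ the space of scalar analytic functions in $L^2(\Omega,\mathbb{C};d\sigma)$, with the inherited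 norms and inner products. They are reproducing kernel Hilbert spaces: there are $K_z\in\mathcal{B}(\Omega,\mathbb{C})$ with $f(z)=\int_\Omega\overline{K_z(w)}f(w)\,d\sigma(w)$ for all $z\in\Omega$ and all $f$ in $\mathcal{B}(\Omega,\mathbb{C})$ or in $\mathcal{B}(\Omega)$ (coordinatewise integral). $k_z:=K_z/\|K_z\|_{\mathcal{B}(\Omega,\mathbb{C})}$, and $z\mapsto\|K_z\|_{\mathcal{B}(\Omega,\mathbb{C})}$ is continuous on $(\Omega,\mathfrak{d})$. (A.4) $d\lambda(z):=\|K_z\|^2_{\mathcal{B}(\Omega,\mathbb{C})}d\sigma(z)$ satisfies $\lambda(E)\simeq\lambda(\varphi_z(E))$ for Borel $E$, constants independent of $z$ (and $E$), and is doubling: $\lambda(D(z,2r))\le C\lambda(D(z,r))$ for all $z\in\Omega$, $r>0$, for some $C>1$. (A.5) $|\langle k_z,k_w\rangle_{\mathcal{B}(\Omega,\mathbb{C})}|\simeq 1/\|K_{\varphi_z(w)}\|_{\mathcal{B}(\Omega,\mathbb{C})}$, constants independent of $z,w$. (A.6) Either there is $0<\kappa<2$ such that $$\int_\Omega\frac{|\langle K_z,K_w\rangle|^{(r+s)/2}}{\|K_z\|^s\|K_w\|^r}\,d\lambda(w)\le C(r,s)<\infty\quad\text{for all }z\in\Omega$$ (norms and inner products in $\mathcal{B}(\Omega,\mathbb{C})$) for all $r>\kappa>s>0$; or this holds for all $r=s>0$, in which case one sets $\kappa=0$. (A.7) $\|K_z\|_{\mathcal{B}(\Omega,\mathbb{C})}\to\infty$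 as $\mathfrak{d}(z,0)\to\infty$. For $e\in\ell^2$, $k_ze$ denotes the function $w\mapsto k_z(w)e$. The translation operator $U_z$ on $\mathcal{B}(\Omega)$ is $U_zf(w)=f(\varphi_z(w))k_z(w)$, and $T^z:=U_zTU_z^*$. $I_{(d)}=I-I^{(d)}$, where $I^{(d)}$ is the orthogonal projection of $\ell^2$ onto $\mathrm{span}\{e_1,\dots,e_d\}$, and $(M_{I_{(d)}}f)(z)=I_{(d)}f(z)$. The essential norm is $\|T\|_e=\inf\{\|T-A\|_{\mathcal{L}(\mathcal{B}(\Omega))}:A\text{ compact on }\mathcal{B}(\Omega)\}$. *)

(* Defs.v *)
(* Everything is over an arbitrary R : realType, with R[i] as the complex numbers.

   Encodings used throughout.
   - C^n is 'rV[R[i]]_n with its normed module structure.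
   - A function on Omega is a total function on C^n, and the elements of the function spaces below are required to vanish outside
     Omega; restriction to Omega is thus injective on these spaces, and equality
     in them is Leibniz equality.
   - A vector a of l^2 is the sequence of its coordinates, a k standing for
     <a, e_(k+1)>: indices start at 0.
   - An operator on B(Omega) is a total map on functions, of which only the
     restriction to B(Omega) matters. *)
From HB Require Import structures.
From mathcomp Require Import all_boot all_order all_algebra.
From mathcomp Require Import all_classical all_reals all_analysis.
From mathcomp Require Export complex.

Set Implicit Arguments.
Unset Strict Implicit.
Unset Printing Implicit Defensive.

Import Order.TTheory GRing.Theory Num.Theory.
Import numFieldNormedType.Exports.

Local Open Scope classical_set_scope.
Local Open Scope ring_scope.
Local Open Scope complex_scope.

Definition cmod {R : realType} (a : R[i]) : R := ComplexField.Normc.normc a.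

Definition cspace (R : realType) (n : nat) : normedModType R[i] := 'rV[R[i]]_n.

Notation borel_cspace R n := (g_sigma_algebraType (@open (cspace R n))).

Section ell2.
Variable R : realType.
Implicit Types a b : nat -> R[i].

Definition l2sqnorm a : \bar R := (\sum_(0 <= k <oo) (cmod (a k) ^+ 2)%:E)%E.

Definition l2norm a : R := Num.sqrt (fine (l2sqnorm a)).

Definition l2dot a b : R[i] :=
  limn (fun m : nat => \sum_(0 <= k < m) complex.Re (a k * (b k)^*)) +i*
  limn (fun m : nat => \sum_(0 <= k < m) complex.Im (a k * (b k)^*)).

Definition l2basis (i : nat) : nat -> R[i] := fun k => (k == i)%:R.

Definition l2finite a : Prop := exists N : nat, forall k, (N <= k)%N -> a k = 0.

End ell2.

(* sigma is a finite Borel measure on C^n of which only the restriction to Omega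
   is ever used: every finite Borel measure on the open set Omega arises so. *)
Record bergman_data (R : realType) (n : nat) := BergmanData {
  Omega : set (cspace R n);
  phi : cspace R n -> cspace R n -> cspace R n;
  dist : cspace R n -> cspace R n -> R;
  sigma : {finite_measure set (borel_cspace R n) -> \bar R};
  kernel : cspace R n -> cspace R n -> R[i];
  kappa : R }.

Section bergman.
Variables (R : realType) (n : nat) (S : bergman_data R n).

Local Notation X := (cspace R n).
Local Notation scfun := (X -> R[i]).
Local Notation vfun := (X -> nat -> R[i]).
Local Notation Om := (Omega S).
Local Notation mu := (sigma S).
Local Notation "'d'" := (dist S).

Definition analytic (f : scfun) : Prop :=
  forall z, Om z -> differentiable (f : X -> R[i]^o) z.

Definition cmeasurable (f : scfun) : Prop :=
  measurable_fun (Om : set (borel_cspace R n)) (fun w => complex.Re (f w)) /\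
  measurable_fun (Om : set (borel_cspace R n)) (fun w => complex.Im (f w)).

Definition cintegral (f : scfun) : R[i] :=
  Rintegral mu Om (fun w => complex.Re (f w)) +i*
  Rintegral mu Om (fun w => complex.Im (f w)).

Definition sc_sqnorm (f : scfun) : \bar R :=
  (\int[mu]_(w in Om) (cmod (f w) ^+ 2)%:E)%E.

Definition sc_norm (f : scfun) : R := Num.sqrt (fine (sc_sqnorm f)).

Definition sc_dot (f g : scfun) : R[i] := cintegral (fun w => f w * (g w)^*).

Definition sc_L2 (f : scfun) : Prop := cmeasurable f /\ (sc_sqnorm f < +oo)%E.

Definition sc_bergman : set scfun :=
  [set f | [/\ forall z, ~ Om z -> f z = 0, analytic f & sc_L2 f]].

Definition v_sqnorm (f : vfun) : \bar R := (\int[mu]_(w in Om) l2sqnorm (f w))%E.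

Definition v_norm (f : vfun) : R := Num.sqrt (fine (v_sqnorm f)).

Definition v_dot (f g : vfun) : R[i] := cintegral (fun w => l2dot (f w) (g w)).

Definition v_L2 (f : vfun) : Prop :=
  [/\ forall w, Om w -> (l2sqnorm (f w) < +oo)%E,
      forall k, cmeasurable (fun w => f w k) & (v_sqnorm f < +oo)%E].

Definition v_bergman : set vfun :=
  [set f | [/\ forall z, ~ Om z -> f z = 0,
               forall k, analytic (fun w => f w k) & v_L2 f]].

Definition complete_for (V : zmodType) (B : set V) (nrm : V -> R) : Prop :=
  forall u : nat -> V, (forall m, B (u m)) ->
    (forall e : R, 0 < e ->
       exists N : nat, forall i j, (N <= i)%N -> (N <= j)%N -> nrm (u i - u j) < e) ->
    exists2 f, B f & nrm (u m - f) @[m --> \oo] --> (0 : R).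

Definition is_metric : Prop :=
  [/\ forall u v, Om u -> Om v -> 0 <= d u v,
      forall u v, Om u -> Om v -> (d u v = 0 <-> u = v),
      forall u v, Om u -> Om v -> d u v = d v u
    & forall u v w, Om u -> Om v -> Om w -> d u w <= d u v + d v w].

Definition dball (z : X) (r : R) : set X := [set w | Om w /\ d z w < r].

Definition dclosed_ball (z : X) (r : R) : set X := [set w | Om w /\ d z w <= r].

Definition dopen (A : set X) : Prop :=
  A `<=` Om /\ forall z, A z -> exists2 r : R, 0 < r & dball z r `<=` A.

Definition dcompact (A : set X) : Prop :=
  forall (I : choiceType) (D : set I) (F : I -> set X),
    (forall i, D i -> dopen (F i)) -> A `<=` cover D F -> finite_subset_cover D F A.

Definition dseparable : Prop :=
  exists A : set X, [/\ countable A, A `<=` Om &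
    forall z (r : R), Om z -> 0 < r -> exists2 a, A a & d z a < r].

Definition dcontinuous (g : X -> R) : Prop :=
  forall z, Om z -> forall e : R, 0 < e -> exists2 r : R, 0 < r &
    forall w, dball z r w -> `|g w - g z| < e.

(* the filter of "z in Omega, d(z, 0) --> +oo" *)
Definition at_dinfty : set_system X :=
  [set P | exists M : R, forall z, Om z -> M < d z 0 -> P z].

(* The supremum of an empty set of norms is 0, whereas ereal_sup set0 = -oo;
   the maximum only matters if d(., 0) is bounded on Omega. *)
Definition limsup_dinfty (g : X -> R) : \bar R :=
  maxe 0%E (limf_esup (fun z => (g z)%:E) at_dinfty).

Local Notation K := (kernel S).

Definition normK (z : X) : R := sc_norm (K z).

Definition nkernel (z : X) : scfun := fun w => K z w / (normK z)%:C.

Definition lambda (E : set X) : \bar R :=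
  (\int[mu]_(z in (E : set (borel_cspace R n))) (normK z ^+ 2)%:E)%E.

Definition lambda_integral (g : X -> R) : \bar R :=
  (\int[mu]_(w in Om) (g w * normK w ^+ 2)%:E)%E.

Definition rudin_forelli (r s : R) : Prop :=
  let g z w := cmod (sc_dot (K z) (K w)) `^ ((r + s) / 2) /
               (normK z `^ s * normK w `^ r) in
  exists C : R, forall z, Om z -> (lambda_integral (g z) <= C%:E)%E.

Record bergman_type : Prop := BergmanType {
  Omega_open : open Om;
  Omega_connected : connected Om;
  Omega0 : Om 0;
  phi_Omega : forall z w, Om z -> Om w -> Om (phi S z w);
  phi_holomorphic : forall z w, Om z -> Om w -> differentiable (phi S z) w;
  phi_involution : forall z w, Om z -> Om w -> phi S z (phi S z w) = w;
  phi0 : forall z, Om z -> phi S z 0 = z;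

  dist_metric : is_metric;
  dist_invariant : exists2 C : R, 0 < C & forall z u v, Om z -> Om u -> Om v ->
    d u v <= C * d (phi S z u) (phi S z v) /\
    d (phi S z u) (phi S z v) <= C * d u v;
  dist_separable : dseparable;
  dist_proper : forall z (r : R), Om z -> dcompact (dclosed_ball z r);
  (* needed for lambda (dball z r) to make sense *)
  dball_borel : forall z (r : R), Om z ->
    measurable (dball z r : set (borel_cspace R n));

  sc_bergman_complete : complete_for sc_bergman sc_norm;
  v_bergman_complete : complete_for v_bergman v_norm;
  kernel_bergman : forall z, Om z -> sc_bergman (K z);
  sc_reproducing : forall z f, Om z -> sc_bergman f ->
    f z = cintegral (fun w => (K z w)^* * f w);
  v_reproducing : forall z f k, Om z -> v_bergman f ->
    f z k = cintegral (fun w => (K z w)^* * f w k);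
  normK_continuous : dcontinuous normK;

  lambda_invariant : exists2 C : R, 0 < C &
    forall z (E : set (borel_cspace R n)), Om z -> measurable E -> E `<=` Om ->
      (lambda E <= C%:E * lambda (phi S z @` E))%E /\
      (lambda (phi S z @` E) <= C%:E * lambda E)%E;
  lambda_doubling : exists2 C : R, 1 < C & forall z (r : R), Om z -> 0 < r ->
    (lambda (dball z (2 * r)) <= C%:E * lambda (dball z r))%E;

  nkernel_dot : exists2 C : R, 0 < C & forall z w, Om z -> Om w ->
    cmod (sc_dot (nkernel z) (nkernel w)) <= C * (normK (phi S z w))^-1 /\
    (normK (phi S z w))^-1 <= C * cmod (sc_dot (nkernel z) (nkernel w));

  kappa_rudin_forelli :
    (0 < kappa S < 2 /\
     forall r s : R, kappa S < r -> 0 < s < kappa S -> rudin_forelli r s) \/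
    (kappa S = 0 /\ forall r : R, 0 < r -> rudin_forelli r r);

  normK_infty : normK z @[z --> at_dinfty] --> +oo }.

Definition bounded_operator (T : vfun -> vfun) : Prop :=
  [/\ forall f, v_bergman f -> v_bergman (T f),
      forall (a : R[i]) f g, v_bergman f -> v_bergman g ->
        T (fun w k => a * f w k + g w k) = (fun w k => a * T f w k + T g w k)
    & exists M : R, forall f, v_bergman f -> v_norm (T f) <= M * v_norm f].

Definition compact_operator (T : vfun -> vfun) : Prop :=
  bounded_operator T /\
  forall (u : nat -> vfun) (M : R),
    (forall m, v_bergman (u m) /\ v_norm (u m) <= M) ->
    exists (s : nat -> nat) (f : vfun),
      [/\ forall m, (s m < s m.+1)%N, v_bergman f
        & v_norm (T (u (s m)) - f) @[m --> \oo] --> (0 : R)].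

(* As T maps B(Omega) to B(Omega), a closed subspace of L^2(Omega, l^2), this is
   the norm both in L(B(Omega)) and in L(B(Omega), L^2(Omega, l^2)). *)
Definition opnorm (T : vfun -> vfun) : \bar R :=
  ereal_sup [set (v_norm (T f))%:E | f in [set f | v_bergman f /\ v_norm f <= 1]].

Definition essnorm (T : vfun -> vfun) : \bar R :=
  ereal_inf [set opnorm (fun f => T f - A f) | A in [set A | compact_operator A]].

(* On the Hilbert space B(Omega), the h below exists and is unique when T is
   bounded. *)
Definition adjoint (T : vfun -> vfun) : vfun -> vfun := fun g =>
  xget 0 [set h | v_bergman h /\ forall f, v_bergman f -> v_dot (T f) g = v_dot f h].

Definition kvec (z : X) (e : nat -> R[i]) : vfun := fun w k => nkernel z w * e k.

Definition translation (z : X) (f : vfun) : vfun :=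
  fun w k => f (phi S z w) k * nkernel z w.

Definition conj_translation (T : vfun -> vfun) (z : X) (f : vfun) : vfun :=
  translation z (T (adjoint (translation z) f)).

Definition mult_tail (m : nat) (f : vfun) : vfun :=
  fun w k => if (k < m)%N then 0 else f w k.

Definition kernel_condition (T : vfun -> vfun) (p : R) : Prop :=
  (ereal_sup [set y | exists (i : nat) (z : X), Om z /\
     y = (\int[mu]_(u in Om)
            (\sum_(0 <= k <oo)
               (cmod (translation z (T (kvec z (l2basis R i))) u k))%:E) `^ p) `^ p^-1]
   < +oo)%E.

End bergman.

(* Main.v *)
(* Let U_z be the translations and P the projection onto B(Omega).

   Lower bound. Young's inequality turns the two kernel conditions and (A.6) into
   the hypotheses of Schur's test with weight |K_z|^(1+a), the part of the kernel of T
   at distance at least rho from the diagonal having arbitrarily small norm as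
   rho grows. Cover Omega by balls of radius rho whose doubles have overlap bounded
   independently of rho. It is then enough to bound T P on functions F with finitely
   many nonzero coordinates and supported in a ball D(z, 2 rho), for z close to
   infinity. Write P F = U_z^* h with h = (U_z^-1)^* P F: the h's so obtained are
   dominated by one square integrable function, hence form a relatively compact
   family, on which |T U_z^* h|, comparable to |T^z h|, is controlled by the
   Berezin-type limit. What is left over, T P 1_D(0,R) I^(d), is compact, again
   by domination.

   Upper bound. U_z^* f tends weakly to 0 as z tends to infinity, so a compact A
   satisfies |A U_z^* f| -> 0, and |T^z f| is comparable to |T U_z^* f|.

   (b) U_z^* K_w e is a multiple of K_v e, v = phi_z w, so the hypothesis gives
   T^z f -> 0 for f = K_w e_i, then for all f, as these functions are total; the lower bound
   yields |T|_e = 0. *)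

(* The data are invariant under phi_z only up to constants, so U_z need not be unitary nor its own
   inverse: it is bounded with bounded inverse, uniformly in z, and the inverse is written out as a
   weighted composition. Its locality (the mass of U_z^-1 f on A comes from the mass of f on
   phi_z(A)) is what lets one dominating function serve for every z.

   The range of p is exactly kappa/2 < (p-2)/(p-1). This leaves room for an exponent strictly in
   between, and the gap becomes a negative power of |K| at phi_w(z), small far from the diagonal by
   (A.7). In Schur's test only the column sums of T are made small; the row sums, read off the
   adjoint, just stay bounded.

   The test is run for each input coordinate separately, and adding m of them costs a factor
   depending on m. The order of choices makes this affordable: m from the tail hypothesis, then rho
   from the far part of the kernel, then r from the localization at scale rho. The final constant
   sees none of them. *)
Require Import Defs.
From HB Require Import structures.
From mathcomp Require Import all_boot all_order all_algebra.
From mathcomp Require Import all_classical all_reals all_analysis.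
From mathcomp Require Import measurable_realfun ring lra.
Set Implicit Arguments.
Unset Strict Implicit.
Unset Printing Implicit Defensive.
Import Order.TTheory GRing.Theory Num.Theory.
Import numFieldNormedType.Exports.
Local Open Scope classical_set_scope.
Local Open Scope ring_scope.
Local Open Scope complex_scope.

(** * Hilbert spaces with a real inner product *)

(** Compactness of the segment gives a cluster point, and an ultrafilter converges to each of its
    cluster points. *)
Lemma ultra_bounded_cvg (R : realType) (T : Type) (U : set_system T) (x : T -> R) (M : R) :
  UltraFilter U -> (forall t, `|x t| <= M) -> cvg (x t @[t --> U]).
Proof.
move=> UU xM; have PU : ProperFilter U := @ultra_proper _ _ UU.
have xU : (x t @[t --> U]) `[- M, M]%classic.
  by rewrite nbhs_simpl /=; apply: filterE => t /=; rewrite in_itv /= -ler_norml.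
have [p [_ clp]] := @segment_compact _ _ _ _ _ xU.
apply/cvg_ex; exists p.
apply/cvgrPdist_lt => e e0.
have [//|UC] := in_ultra_setVsetC [set t | `|p - x t| < e] UU.
have [|y /= [ny py]] := clp [set y | ~ `|p - y| < e] (ball p e) _ (nbhsx_ballx p e e0).
  exact: UC.
by case: ny; exact: py.
Qed.

Lemma extract_subseq (P : nat -> nat -> Prop) :
  (forall m N, exists2 k, (N <= k)%N & P m k) ->
  exists s : nat -> nat, (forall m, (s m < s m.+1)%N) /\ forall m, P m (s m).
Proof.
move=> h; have /choice[g gP] : forall mN : nat * nat, exists k, (mN.2 <= k)%N /\ P mN.1 k.
  by move=> [m N]; have [k Nk Pk] := h m N; exists k.
pose s := fix s m := if m is m'.+1 then g (m'.+1, (s m').+1) else g (0%N, 0%N).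
exists s; split=> [m|[|m]] /=.
- by have [] := gP (m.+1, (s m).+1).
- by have [] := gP (0%N, 0%N).
- by have [] := gP (m.+1, (s m).+1).
Qed.

Lemma subseq_ge (s : nat -> nat) : (forall m, (s m < s m.+1)%N) -> forall m, (m <= s m)%N.
Proof. by move=> sS; elim=> // m IH; exact: leq_ltn_trans (sS m). Qed.

Lemma cvg_subseq (T : topologicalType) (u : nat -> T) (l : T) (s : nat -> nat) :
  (forall m, (s m < s m.+1)%N) -> u m @[m --> \oo] --> l -> u (s m) @[m --> \oo] --> l.
Proof.
move=> sS ul; apply: (cvg_comp s u) ul => A [N _ NA]; exists N => // m /= Nm.
by apply: NA => /=; exact: leq_trans (subseq_ge sS m).
Qed.

Lemma cvg_subsubseq (R : realType) (u : nat -> R) :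
  (forall s : nat -> nat, (forall m, (s m < s m.+1)%N) ->
     exists2 s' : nat -> nat, (forall m, (s' m < s' m.+1)%N) &
       u (s (s' m)) @[m --> \oo] --> (0 : R)) ->
  u m @[m --> \oo] --> (0 : R).
Proof.
move=> h; apply: contrapT => nu.
have [e e0 he] : exists2 e : R, 0 < e & forall N, exists2 k, (N <= k)%N & e <= `|u k|.
  apply: contrapT => hn; apply: nu; apply/cvgr0Pnorm_lt => e e0.
  apply: contrapT => hne; apply: hn; exists e => // N; apply: contrapT => hN.
  apply: hne; exists N => // k /= Nk; rewrite ltNge; apply/negP => ek; apply: hN.
  by exists k.
have [s [sS se]] := extract_subseq (fun _ : nat => he).
have [s' s'S us] := h s sS.
have [N _ /(_ N (leqnn N))/=] := (cvgr0Pnorm_lt _).1 us e e0.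
by rewrite ltNge se.
Qed.

(** At t = - b / (a + 1) the quadratic is a negative multiple of b^2; the denominator a + 1 covers
    the case a = 0. This is the first variation step of the Riesz theorem and of [rdot_definite]. *)
Lemma linear_coef_eq0 (R : realFieldType) (a b : R) : 0 <= a ->
  (forall t, 0 <= t ^+ 2 * a + 2 * t * b) -> b = 0.
Proof.
move=> a0 h; apply: contrapT => /eqP b0; have := h (- b / (a + 1)).
have -> : (- b / (a + 1)) ^+ 2 * a + 2 * (- b / (a + 1)) * b =
   - (b ^+ 2 * (a + 2)) / (a + 1) ^+ 2.
  by field; rewrite gt_eqF //; lra.
apply/negP; rewrite -ltNge pmulr_llt0 ?invr_gt0 ?exprn_gt0 //; last by lra.
by rewrite oppr_lt0 mulr_gt0 //; [rewrite exprn_even_gt0 | lra].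
Qed.

Section real_hilbert.
Variables (R : realType) (V : lmodType R[i]).

(* [dot] is the real part of a sesquilinear form on [L], and [B] is a complex
   subspace of [L] on which it is complete. *)
Record hilbert_in (L B : set V) (dot : V -> V -> R) (nrm : V -> R) := HilbertIn {
  hilD : forall f g, L f -> L g -> L (f + g);
  hilZ : forall a f, L f -> L (a *: f);
  dotDl : forall f g h, L f -> L g -> L h -> dot (f + g) h = dot f h + dot g h;
  dotZl : forall (a : R) f g, L f -> L g -> dot (a%:C *: f) g = a * dot f g;
  dotC : forall f g, L f -> L g -> dot f g = dot g f;
  dot_ge0 : forall f, L f -> 0 <= dot f f;
  nrmE : forall f, L f -> nrm f = Num.sqrt (dot f f);
  subBL : B `<=` L;
  subB0 : B 0;
  subBD : forall f g, B f -> B g -> B (f + g);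
  subBZ : forall (a : R) f, B f -> B (a%:C *: f);
  hil_complete : complete_for B nrm;
  dot_definite : forall f, B f -> dot f f = 0 -> f = 0 }.

Variables (L B : set V) (dot : V -> V -> R) (nrm : V -> R).
Variable H : hilbert_in L B dot nrm.

Lemma scaleN1c (f : V) : (-1)%:C *: f = - f.
Proof. by rewrite rmorphN1 scaleN1r. Qed.

Lemma hilN f : L f -> L (- f).
Proof. by move=> Lf; rewrite -scaleN1r; exact: hilZ H _ _ Lf. Qed.

Lemma hilB f g : L f -> L g -> L (f - g).
Proof. by move=> Lf Lg; apply: (hilD H) => //; exact: hilN. Qed.

Lemma subBN f : B f -> B (- f).
Proof. by move=> Bf; rewrite -scaleN1c; exact: subBZ H _ _ Bf. Qed.

Lemma subBB f g : B f -> B g -> B (f - g).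
Proof. by move=> Bf Bg; apply: (subBD H) => //; exact: subBN. Qed.

Let BL f : B f -> L f := fun h => subBL H h.

Lemma dotDr f g h : L f -> L g -> L h -> dot h (f + g) = dot h f + dot h g.
Proof.
move=> Lf Lg Lh; rewrite (dotC H) ?(dotDl H) //; last exact: hilD H _ _ Lf Lg.
by rewrite (dotC H Lf)// (dotC H Lg).
Qed.

Lemma dotZr (a : R) f g : L f -> L g -> dot f (a%:C *: g) = a * dot f g.
Proof.
by move=> Lf Lg; rewrite (dotC H) // ?(dotZl H) // 1?(dotC H) //; exact: hilZ H _ _ Lg.
Qed.

Lemma dotNl f g : L f -> L g -> dot (- f) g = - dot f g.
Proof. by move=> Lf Lg; rewrite -scaleN1c (dotZl H) // mulN1r. Qed.

Lemma dotNr f g : L f -> L g -> dot f (- g) = - dot f g.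
Proof. by move=> Lf Lg; rewrite -scaleN1c dotZr // mulN1r. Qed.

Lemma dotBl f g h : L f -> L g -> L h -> dot (f - g) h = dot f h - dot g h.
Proof. by move=> Lf Lg Lh; rewrite (dotDl H) ?dotNl //; exact: hilN. Qed.

Lemma dotBr f g h : L f -> L g -> L h -> dot h (f - g) = dot h f - dot h g.
Proof. by move=> Lf Lg Lh; rewrite dotDr ?dotNr //; exact: hilN. Qed.

Lemma nrm_ge0 f : L f -> 0 <= nrm f.
Proof. by move=> Lf; rewrite (nrmE H Lf) sqrtr_ge0. Qed.

Lemma nrm_sqr f : L f -> nrm f ^+ 2 = dot f f.
Proof. by move=> Lf; rewrite (nrmE H Lf) sqr_sqrtr // (dot_ge0 H). Qed.

Lemma dotDD f g : L f -> L g -> dot (f + g) (f + g) = dot f f + 2 * dot f g + dot g g.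
Proof.
move=> Lf Lg; have Lfg := hilD H Lf Lg.
by rewrite (dotDl H) // !dotDr // (dotC H Lg Lf); ring.
Qed.

Lemma dotBB f g : L f -> L g -> dot (f - g) (f - g) = dot f f - 2 * dot f g + dot g g.
Proof.
move=> Lf Lg; rewrite dotDD ?dotNl ?dotNr ?opprK //; try exact: hilN.
by ring.
Qed.

Lemma cauchy_schwarz f g : L f -> L g -> `|dot f g| <= nrm f * nrm g.
Proof.
move=> Lf Lg.
have key t : 0 <= dot f f + 2 * t * dot f g + t ^+ 2 * dot g g.
  have Ltg : L (t%:C *: g) by exact: hilZ H _ _ Lg.
  have := dot_ge0 H (hilD H Lf Ltg); rewrite dotDD // dotZr // (dotZl H) // dotZr //.
  by move=> h; rewrite (le_trans h)// le_eqVlt; apply/orP; left; apply/eqP; ring.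
rewrite -(@ler_pXn2r _ 2) ?nnegrE ?mulr_ge0 ?nrm_ge0 //.
rewrite exprMn !nrm_sqr // real_normK ?num_real //.
have ff := dot_ge0 H Lf; have gg := dot_ge0 H Lg.
have [g0|gn0] := eqVneq (dot g g) 0.
  have [-> |fg] := eqVneq (dot f g) 0; first by rewrite expr0n /= mulr_ge0.
  (* On [L] the form is only semidefinite, so g may be a nonzero null vector. The expression is then
     affine in t, and this t gives it the value -1. *)
  have := key (- (dot f f + 1) / (2 * dot f g)); rewrite g0 mulr0 addr0.
  suff -> : 2 * (- (dot f f + 1) / (2 * dot f g)) * dot f g = - (dot f f + 1) by lra.
  by field; rewrite fg.
have gp : 0 < dot g g by rewrite lt_neqAle eq_sym gn0.
have := key (- dot f g / dot g g).
have -> : dot f f + 2 * (- dot f g / dot g g) * dot f g + (- dot f g / dot g g) ^+ 2 * dot g g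
  = (dot f f * dot g g - dot f g ^+ 2) / dot g g by field.
by rewrite pmulr_lge0 ?invr_gt0 // subr_ge0.
Qed.

Lemma dot_le f g : L f -> L g -> dot f g <= nrm f * nrm g.
Proof. by move=> Lf Lg; exact: le_trans (ler_norm _) (cauchy_schwarz Lf Lg). Qed.

Lemma nrmD f g : L f -> L g -> nrm (f + g) <= nrm f + nrm g.
Proof.
move=> Lf Lg; have Lfg := hilD H Lf Lg.
rewrite -(@ler_pXn2r _ 2) ?nnegrE ?addr_ge0 ?nrm_ge0 //.
rewrite nrm_sqr // dotDD // -!nrm_sqr //; have := dot_le Lf Lg.
by move=> h; rewrite sqrrD -[(_ * _) *+ 2]mulr_natl; lra.
Qed.

Lemma nrmZ (a : R) f : L f -> nrm (a%:C *: f) = `|a| * nrm f.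
Proof.
move=> Lf; have Laf : L (a%:C *: f) by exact: hilZ H _ _ Lf.
rewrite (nrmE H Laf) (dotZl H) // dotZr // mulrA -expr2 sqrtrM ?sqr_ge0 //.
by rewrite sqrtr_sqr -(nrmE H).
Qed.

Lemma nrmN f : L f -> nrm (- f) = nrm f.
Proof. by move=> Lf; rewrite -scaleN1c nrmZ // normrN1 mul1r. Qed.

Lemma nrmB f g : L f -> L g -> nrm (f - g) <= nrm f + nrm g.
Proof. by move=> Lf Lg; rewrite -(nrmN Lg); apply: nrmD => //; exact: hilN. Qed.

Lemma nrm_distC f g : L f -> L g -> nrm (f - g) = nrm (g - f).
Proof. by move=> Lf Lg; rewrite -nrmN ?opprB //; exact: hilB. Qed.

Lemma nrm0 : nrm 0 = 0.
Proof.
have L0 : L 0 by apply: BL; exact: subB0 H.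
by have := nrmZ 0 L0; rewrite rmorph0 scale0r normr0 mul0r.
Qed.

Lemma parallelogram f g : L f -> L g ->
  dot (f - g) (f - g) = 2 * dot f f + 2 * dot g g - 4 * dot ((2^-1)%:C *: (f + g)) ((2^-1)%:C *: (f + g)).
Proof.
move=> Lf Lg; have Lfg := hilD H Lf Lg.
have Lh : L ((2^-1)%:C *: (f + g)) by exact: hilZ H _ _ Lfg.
by rewrite dotBB // (dotZl H) // dotZr // dotDD //; field.
Qed.

Lemma cvg_dot_l (u : nat -> V) f g : (forall m, L (u m)) -> L f -> L g ->
  nrm (u m - f) @[m --> \oo] --> (0 : R) -> dot (u m) g @[m --> \oo] --> dot f g.
Proof.
move=> Lu Lf Lg uf; apply/subr_cvg0/norm_cvg0P => /=.
apply: (@squeeze_cvgr _ _ _ _ (fun=> 0) (fun m => nrm (u m - f) * nrm g)).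
- near=> m; rewrite normr_ge0 /= -dotBl //; apply: cauchy_schwarz => //; exact: hilB.
- exact: cvg_cst.
- by rewrite -(mul0r (nrm g)); apply: cvgMl.
Unshelve. all: by end_near. Qed.

(* Minimize J f = |f|^2 - 2 phi f: by the parallelogram identity a minimizing
   sequence is Cauchy, and the first variation of J at its limit vanishes. *)
Lemma riesz_on (B' : set V) (phi : V -> R) (M : R) :
  B' `<=` B -> B' 0 ->
  (forall f g, B' f -> B' g -> B' (f + g)) ->
  (forall (a : R) f, B' f -> B' (a%:C *: f)) ->
  complete_for B' nrm ->
  (forall f g, B' f -> B' g -> phi (f + g) = phi f + phi g) ->
  (forall (a : R) f, B' f -> phi (a%:C *: f) = a * phi f) ->
  (forall f, B' f -> `|phi f| <= M * nrm f) ->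
  exists2 h, B' h & forall f, B' f -> phi f = dot f h.
Proof.
move=> sB B0 BD BZ Bc phiD phiZ phiM.
have LB f : B' f -> L f by move=> /sB/BL.
pose J f := dot f f - 2 * phi f.
(* J f >= (|f| - M)^2 - M^2. *)
have Jlb f : B' f -> - M ^+ 2 <= J f.
  move=> Bf; have := phiM _ Bf; have := ler_norm (phi f).
  rewrite /J -(nrm_sqr (LB _ Bf)) => h1 h2.
  by have := sqr_ge0 (nrm f - M); rewrite sqrrB -[(_ * _) *+ 2]mulr_natl; nra.
pose E := [set J f | f in B'].
have Einf : has_inf E.
  split; first by exists (J 0); exists 0.
  by exists (- M ^+ 2) => _ [f Bf <-]; exact: Jlb.
pose m := inf E.
have Jm f : B' f -> m <= J f by move=> Bf; apply: (ge_inf Einf.2); exists f.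
have /choice[u uP] : forall k : nat, exists f, B' f /\ J f < m + k.+1%:R^-1.
  move=> k; have k0 : (0 : R) < k.+1%:R^-1 by rewrite invr_gt0.
  by have [_ [f Bf <-] Jf] := inf_adherent k0 Einf; exists f.
have Bu k : B' (u k) by have [] := uP k.
have BB f g : B' f -> B' g -> B' (f - g).
  by move=> Bf Bg; rewrite -scaleN1c; apply: BD => //; exact: BZ.
have small (e : R) : 0 < e -> exists N : nat, forall k, (N <= k)%N -> (k.+1%:R^-1 : R) < e.
  move=> e0; exists (Num.trunc e^-1) => k Nk.
  rewrite invf_plt ?posrE // (lt_le_trans (truncnS_gt _)) // ler_nat ltnS //.
(* The terms in phi cancel in the parallelogram identity, and J is at least m at the midpoint: the
   left side is at most 2 (J u_k - m) + 2 (J u_l - m). *)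
have cau k l : nrm (u k - u l) ^+ 2 <= 2 * k.+1%:R^-1 + 2 * l.+1%:R^-1.
  rewrite nrm_sqr ?parallelogram; try exact: LB.
  2: by apply: LB; exact: BB.
  have Bh : B' ((2^-1)%:C *: (u k + u l)) by apply: BZ; exact: BD.
  have [_] := uP k; have [_] := uP l; have := Jm _ Bh; rewrite /J phiZ; last exact: BD.
  rewrite phiD //; move: (dot (_ *: _) _) (k.+1%:R^-1) (l.+1%:R^-1) => a b c; lra.
have [h Bh uh] : exists2 h, B' h & nrm (u m - h) @[m --> \oo] --> (0 : R).
  apply: Bc => // e e0; have e2 : 0 < e ^+ 2 / 4 by rewrite divr_gt0 // exprn_gt0.
  have [N NP] := small _ e2; exists N => i j Ni Nj.
  rewrite -(@ltr_pXn2r _ 2) ?nnegrE ?nrm_ge0 ?(ltW e0) //; last by apply: LB; exact: BB.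
  apply: le_lt_trans (cau i j) _; have := NP i Ni; have := NP j Nj.
  by move: (i.+1%:R^-1) (j.+1%:R^-1) => a b; lra.
exists h => // f Bf.
(* From m <= J (u_k + t f) and J u_k < m + 1/(k+1), the inequality holds with u_k for h up to
   1/(k+1). *)
have var t : 0 <= t ^+ 2 * dot f f + 2 * t * (dot h f - phi f).
  have cu : t ^+ 2 * dot f f + 2 * t * (dot (u k) f - phi f) + k.+1%:R^-1 @[k --> \oo] -->
      t ^+ 2 * dot f f + 2 * t * (dot h f - phi f) + 0.
    apply: cvgD.
      apply: cvgD; first exact: cvg_cst.
      apply: cvgMr; apply: cvgB; last exact: cvg_cst.
      by apply: cvg_dot_l => //; [move=> k|..]; exact: LB.
    apply/cvgr0Pnorm_lt => e e0; have [N NP] := small _ e0; exists N => // k /= Nk.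
    by rewrite ger0_norm ?invr_ge0 //; exact: NP.
  rewrite addr0 in cu.
  apply: (cvgr_to_ge cu); near=> k.
  have Btf : B' (t%:C *: f) by exact: BZ.
  have := Jm _ (BD _ _ (Bu k) Btf); have [_] := uP k.
  rewrite /J phiD // phiZ // dotDD ?(dotZl H) ?dotZr; try exact: LB.
  rewrite expr2; move: (k.+1%:R^-1) (dot (u k) f) => a b h1 h2; lra.
rewrite (dotC H) ?[RHS]/=; try exact: LB.
apply/eqP; rewrite eq_sym -subr_eq0; apply/eqP; apply: linear_coef_eq0 var.
exact: (dot_ge0 H (LB _ Bf)).
Unshelve. all: by end_near. Qed.

Lemma riesz (phi : V -> R) (M : R) :
  (forall f g, B f -> B g -> phi (f + g) = phi f + phi g) ->
  (forall (a : R) f, B f -> phi (a%:C *: f) = a * phi f) ->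
  (forall f, B f -> `|phi f| <= M * nrm f) ->
  exists2 h, B h & forall f, B f -> phi f = dot f h.
Proof.
apply: riesz_on => //; [exact: subB0 H|exact: subBD H|exact: subBZ H|exact: hil_complete H].
Qed.

Lemma dot_inj f g : B f -> B g -> (forall x, B x -> dot x f = dot x g) -> f = g.
Proof.
move=> Bf Bg fg; apply/eqP; rewrite -subr_eq0; apply/eqP.
have Bfg := subBB Bf Bg.
by apply: (dot_definite H) => //; rewrite dotBr ?fg ?subrr //; exact: BL.
Qed.

Definition total_in (E : set V) :=
  E `<=` B /\ forall g, B g -> (forall x, E x -> dot x g = 0) -> g = 0.

(* The projection of f on the closed subspace P, furnished by the Riesz
   theorem in P, differs from f by a vector orthogonal to E. *)
Lemma total_ind (E P : set V) : total_in E -> E `<=` P ->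
  P 0 -> (forall f g, B f -> B g -> P f -> P g -> P (f + g)) ->
  (forall (a : R) f, B f -> P f -> P (a%:C *: f)) ->
  (forall f, B f -> (forall e : R, 0 < e -> exists g, [/\ B g, P g & nrm (f - g) < e]) -> P f) ->
  B `<=` P.
Proof.
move=> [EB Etot] EP P0 PD PZ Pcl f Bf.
pose Q := B `&` P.
have [||||||||h [Bh Ph] hP] := @riesz_on Q (fun x => dot x f) (nrm f).
- by move=> x [].
- by split => //; exact: subB0 H.
- by move=> x y [Bx Px] [By Py]; split; [exact: subBD H _ _ Bx By|exact: PD].
- by move=> a x [Bx Px]; split; [exact: subBZ H _ _ Bx|exact: PZ].
- move=> u Qu cu; have [h Bh uh] := hil_complete H (fun m => (Qu m).1) cu.
  exists h => //; split => //; apply: Pcl => // e e0.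
  have [N _ /(_ N (leqnn N))/= uN] := (cvgr0Pnorm_lt _).1 uh e e0.
  have [BN PN] := Qu N.
  exists (u N); split => //; rewrite nrm_distC; try exact: BL.
  exact: le_lt_trans (ler_norm _) uN.
- by move=> x y [Bx _] [By _]; rewrite (dotDl H) //; exact: BL.
- by move=> a x [Bx _]; rewrite (dotZl H) //; exact: BL.
- by move=> x [Bx _]; rewrite mulrC; apply: cauchy_schwarz; exact: BL.
suff -> : f = h by [].
apply/eqP; rewrite -subr_eq0; apply/eqP; apply: Etot; first exact: subBB.
move=> x Ex; rewrite dotBr; [|exact: BL..|by apply: BL; exact: EB].
by rewrite hP ?subrr //; split; [exact: EB|exact: EP].
Qed.

Definition weakly_null (x : nat -> V) :=
  forall y, B y -> dot (x m) y @[m --> \oo] --> (0 : R).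

(** As x is bounded, the y with dot (x m) y -> 0 form a closed subspace, to which [total_ind]
    applies. *)
Lemma weakly_null_total (E : set V) (x : nat -> V) (M : R) : total_in E ->
  (forall m, B (x m) /\ nrm (x m) <= M) ->
  (forall y, E y -> dot (x m) y @[m --> \oo] --> (0 : R)) -> weakly_null x.
Proof.
move=> Etot xM Ex.
have Lx m : L (x m) by apply: BL; have [] := xM m.
apply: (total_ind Etot) => [//|||a f Bf|f Bf h].
- have L0 : L 0 by apply: BL; exact: subB0 H.
  rewrite /= (_ : (fun m => dot (x m) 0) = fun=> 0); first exact: cvg_cst.
  by apply/funext => m; have := dotZr 0 (Lx m) L0; rewrite rmorph0 scale0r mul0r.
- move=> f g Bf Bg cf cg /=; rewrite (_ : (fun m => _) = fun m => dot (x m) f + dot (x m) g).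
    by rewrite -[X in _ --> X](addr0 0); exact: cvgD.
  by apply/funext => m; rewrite dotDr //; exact: BL.
- move=> cf; rewrite /= (_ : (fun m => _) = fun m => a * dot (x m) f).
    by rewrite -[X in _ --> X](mulr0 a); exact: cvgMr.
  by apply/funext => m; rewrite dotZr //; exact: BL.
- have M0 : 0 <= M by have [B0 /(le_trans _)->//] := xM 0%N; exact: nrm_ge0.
  apply/cvgr0Pnorm_lt => e e0; have e20 : 0 < e / (2 * (M + 1)) by rewrite divr_gt0 //; lra.
  have [g [Bg cg fg]] := h _ e20.
  have e2 : 0 < e / 2 by rewrite divr_gt0.
  apply: filterS ((cvgr0Pnorm_lt _).1 cg _ e2) => m mg.
  have -> : dot (x m) f = dot (x m) g + dot (x m) (f - g).
    by rewrite dotBr //; [rewrite addrC subrK | exact: BL..].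
  have Lfg : L (f - g) by apply: BL; exact: subBB.
  apply: le_lt_trans (ler_normD _ _) _.
  rewrite [ltRHS](splitr e); apply: ltr_leD => //.
  apply: (le_trans (cauchy_schwarz (Lx m) Lfg)).
  apply: (@le_trans _ _ (M * (e / (2 * (M + 1))))).
    by apply: ler_pM => //; try exact: nrm_ge0; [exact: (xM m).2 | exact: ltW].
  rewrite mulrA ler_pdivrMr; last by lra.
  by rewrite mulrC [leRHS](_ : _ = e * (M + 1)); [apply: ler_wpM2l; lra | field].
Qed.

(** Along an ultrafilter every bounded scalar sequence converges, so the limits of the pairings with
    u define a bounded functional, represented by some f. Each set of the ultrafilter meets every
    tail, which yields an index where the first m + 1 test vectors e_j see f up to 1/(m+1).
    Countability of the total family turns this into a subsequence. *)
Lemma weak_compactness (e : nat -> V) (u : nat -> V) (M : R) : total_in (range e) ->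
  (forall m, B (u m) /\ nrm (u m) <= M) ->
  exists (s : nat -> nat) (f : V),
    [/\ forall m, (s m < s m.+1)%N, B f & weakly_null (fun m => u (s m) - f)].
Proof.
move=> Etot uM.
have Bu m : B (u m) by have [] := uM m.
have Lu m : L (u m) by exact: BL.
have [U [UU oU]] := ultraFilterLemma eventually_filter.
have PU : ProperFilter U := @ultra_proper _ _ UU.
have bd g : B g -> forall m, `|dot g (u m)| <= M * nrm g.
  move=> Bg m; apply: le_trans (cauchy_schwarz (BL Bg) (Lu m)) _.
  by rewrite mulrC; apply: ler_wpM2r; [apply: nrm_ge0; exact: BL | exact: (uM m).2].
have cU g : B g -> cvg (dot g (u m) @[m --> U]).
  by move=> Bg; apply: (@ultra_bounded_cvg _ _ _ _ (M * nrm g)) => // m; exact: bd.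
have [|||f Bf fP] := @riesz (fun g => lim (dot g (u m) @[m --> U])) M.
- move=> g h Bg Bh; rewrite -limD; [|exact: cU..].
  congr (lim (_ @ U)); apply/funext => m /=.
  by rewrite (dotDl H) //; exact: BL.
- move=> a g Bg; have := cvg_lim (@Rhausdorff R) (@cvgMr _ _ _ _ _ a _ (cU g Bg)).
  move=> <-; congr (lim (_ @ U)); apply/funext => m /=.
  by rewrite (dotZl H) //; exact: BL.
- move=> g Bg; have := cvg_lim (@Rhausdorff R) (cvg_norm (cU g Bg)) => <-.
  have c : cvg (`|dot g (u m)| @[m --> U]) by apply: is_cvg_norm; exact: cU.
  by apply: limr_le => //; near=> m; exact: bd.
have Uf g (r : R) : B g -> 0 < r -> U [set m | `|dot g (u m) - dot g f| < r].
  move=> Bg r0; have := cU g Bg; rewrite -fP // => c.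
  have /cvgrPdist_lt/(_ r r0) := c.
  by apply: filterS => m; rewrite distrC.
have Be j : B (e j) by apply: (Etot.1); exists j.
have ex m N : exists2 k, (N <= k)%N &
    forall j, (j <= m)%N -> `|dot (e j) (u k) - dot (e j) f| < m.+1%:R^-1.
  have m0 : 0 < m.+1%:R^-1 :> R by rewrite invr_gt0.
  have UN : U [set k | (N <= k)%N] by apply: oU; exists N.
  have Um : U [set k | forall j, (j <= m)%N -> `|dot (e j) (u k) - dot (e j) f| < m.+1%:R^-1].
    have : forall m', U [set k | forall j, (j <= m')%N ->
        `|dot (e j) (u k) - dot (e j) f| < m.+1%:R^-1].
      elim=> [|m' IH].
        by apply: filterS (Uf (e 0%N) _ (Be _) m0) => k h [|//] _; exact: h.
      apply: filterS2 (Uf (e m'.+1) _ (Be _) m0) IH => k h1 h2 j.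
      by rewrite leq_eqVlt => /predU1P[->//|]; rewrite ltnS; exact: h2.
    by move=> /(_ m).
  have [k [Nk kP]] := filter_ex (filterI UN Um).
  by exists k.
have [s [sS sP]] := extract_subseq ex.
exists s, f; split=> //.
apply: (@weakly_null_total _ _ (M + nrm f) Etot) => [m|_ [j _ <-]].
  split; first exact: subBB.
  apply: le_trans (nrmB (Lu _) (BL Bf)) _; by apply: lerD => //; exact: (uM _).2.
apply/cvgr0Pnorm_lt => r r0.
near=> m.
rewrite (dotC H); [|exact: hilB (Lu _) (BL Bf)|exact: BL].
rewrite dotBr; [|exact: Lu|exact: BL..].
apply: lt_trans (sP m j _) _; first by near: m; exact: nbhs_infty_ge.
have : m.+1%:R > r^-1.
  by near: m; exists (Num.trunc r^-1) => // m /= hm; rewrite (lt_le_trans (truncnS_gt _)) // ler_nat ltnS.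
by move=> h; rewrite invf_plt ?posrE.
Unshelve. all: by end_near. Qed.

End real_hilbert.

(** * Tonelli's theorem and Schur's test *)

Import HBNNSimple.

Lemma measurable_fun_gtP d (T : measurableType d) (R : realType) (D : set T) (f : T -> R) :
  (forall a : R, measurable (D `&` [set x | a < f x])) -> measurable_fun D f.
Proof.
move=> mf mD; apply: (measurability (@RGenOInfty.G R)) => //.
  exact: RGenOInfty.measurableE.
move=> _ [_ [a ->] <-]; rewrite (_ : _ @^-1` _ = [set x | a < f x]) //.
by apply/seteqP; split => x /=; rewrite in_itv /= andbT.
Qed.

(** The optimal value t = X / a turns the hypothesis into the conclusion; zero and infinite values
    are treated apart. *)
Lemma ereal_sqr_le (R : realType) (X Y : \bar R) (a : R) : 0 < a -> (0 <= X)%E -> (0 <= Y)%E ->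
  (forall t : R, 0 < t -> (2%:E * X <= t%:E * a%:E + (t^-1)%:E * Y)%E) -> (X * X <= a%:E * Y)%E.
Proof.
move=> a0; case: Y => [y||//] X0 Y0 h; last by rewrite gt0_muley ?leey // lte_fin.
case: X X0 h => [x||//] X0 h; last first.
  by have := h 1 ltr01; rewrite gt0_muley ?lte_fin // -!EFinM -EFinD leye_eq.
rewrite -!EFinM !lee_fin in X0 Y0 h *.
have [->|xn0] := eqVneq x 0; first by rewrite mul0r mulr_ge0 // ltW.
have x0 : 0 < x by rewrite lt_neqAle eq_sym xn0.
have xa : 0 < x / a by rewrite divr_gt0.
have := h _ xa; rewrite -EFinD lee_fin -mulrA mulVf ?gt_eqF // mulr1 invf_div.
rewrite (_ : 2 * x = x + x); last by ring.
rewrite lerD2l => /(ler_wpM2l X0) /le_trans -> //.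
by rewrite le_eqVlt; apply/orP; left; apply/eqP; field.
Qed.

Lemma measurable_fun_inv d (T : measurableType d) (R : realType) (D : set T) (f : T -> R) :
  (forall x, D x -> 0 < f x) -> measurable_fun D f -> measurable_fun D (fun x => (f x)^-1).
Proof.
move=> f0 mf; apply: (eq_measurable_fun (fun x => f x `^ (-1))).
  by move=> x /set_mem Dx; rewrite powR_inv1 // ltW // f0.
apply: (measurable_comp measurableT) (measurable_powR _) mf.
by [].
Qed.

Section tonelli.
Context d1 d2 (T1 : measurableType d1) (T2 : measurableType d2) (R : realType).
Variables (m1 : {finite_measure set T1 -> \bar R}) (m2 : {finite_measure set T2 -> \bar R}).
Variables (D1 : set T1) (D2 : set T2) (mD1 : measurable D1) (mD2 : measurable D2).
Variable f : T1 -> T2 -> \bar R.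
Hypothesis f0 : forall x y, D1 x -> D2 y -> (0 <= f x y)%E.
Hypothesis mf : measurable_fun (D1 `*` D2) (fun p => f p.1 p.2).

(** Extension by zero reduces the integrals over D1 and D2 to integrals over the whole spaces, where
    [fubini_tonelli] applies. *)
Let F := (fun p => f p.1 p.2) \_ (D1 `*` D2).

Let mF : measurable_fun setT F.
Proof. by apply/(measurable_restrictT _ _).1 => //; exact: measurableX. Qed.

Let F0 p : (0 <= F p)%E.
Proof.
rewrite /F patchE; case: ifPn => // /set_mem [/= ? ?]; exact: f0.
Qed.

Let inner1 (x : T1) : ((fun x : T1 => \int[m2]_(y in D2) f x y)%E \_ D1) x = (\int[m2]_y F (x, y))%E.
Proof.
rewrite patchE; case: ifPn => [/set_mem Dx|/negP Dx].
  rewrite integral_mkcond; apply: eq_integral => y _; rewrite /F !patchE.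
  by rewrite in_setX /= (mem_set Dx).
rewrite integral0_eq // => y _; rewrite /F patchE in_setX /=.
by case: ifPn => // /andP[/Dx].
Qed.

Let inner2 (y : T2) : ((fun y : T2 => \int[m1]_(x in D1) f x y)%E \_ D2) y = (\int[m1]_x F (x, y))%E.
Proof.
rewrite patchE; case: ifPn => [/set_mem Dx|/negP Dx].
  rewrite integral_mkcond; apply: eq_integral => x _; rewrite /F !patchE.
  by rewrite in_setX /= (mem_set Dx) andbT.
rewrite integral0_eq // => x _; rewrite /F patchE in_setX /=.
by case: ifPn => // /andP[_ /Dx].
Qed.

Lemma tonelli_measurable : measurable_fun D1 (fun x => \int[m2]_(y in D2) f x y)%E.
Proof.
apply/(measurable_restrictT _ _).2 => //.
rewrite (_ : _ \_ _ = fubini_F m2 F); first exact: measurable_fun_fubini_tonelli_F.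
by apply/funext => x; rewrite inner1.
Qed.

Lemma tonelli_on : (\int[m1]_(x in D1) \int[m2]_(y in D2) f x y =
  \int[m2]_(y in D2) \int[m1]_(x in D1) f x y)%E.
Proof.
rewrite integral_mkcond [RHS]integral_mkcond.
under eq_integral do rewrite inner1.
under [RHS]eq_integral do rewrite inner2.
exact: fubini_tonelli.
Qed.

End tonelli.

Lemma measurable_fun_pairl d1 d2 d3 (T1 : measurableType d1) (T2 : measurableType d2)
    (T3 : measurableType d3) (D1 : set T1) (D2 : set T2) (f : T1 -> T2 -> T3) x :
  D1 x -> measurable D1 -> measurable D2 ->
  measurable_fun (D1 `*` D2) (fun p => f p.1 p.2) -> measurable_fun D2 (f x).
Proof.
move=> Dx mD1 mD2 mf.
apply: (@measurable_comp _ _ _ _ _ _ (D1 `*` D2) (fun p => f p.1 p.2) D2 (fun y => (x, y))) => //.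
- exact: measurableX.
- by move=> _ [y Dy <-].
- by apply: (measurable_funS measurableT) => //; exact: pair1_measurable.
Qed.

Lemma measurable_fun_pairr d1 d2 d3 (T1 : measurableType d1) (T2 : measurableType d2)
    (T3 : measurableType d3) (D1 : set T1) (D2 : set T2) (f : T1 -> T2 -> T3) y :
  D2 y -> measurable D1 -> measurable D2 ->
  measurable_fun (D1 `*` D2) (fun p => f p.1 p.2) -> measurable_fun D1 (f ^~ y).
Proof.
move=> Dy mD1 mD2 mf.
apply: (@measurable_comp _ _ _ _ _ _ (D1 `*` D2) (fun p => f p.1 p.2) D1 (fun x => (x, y))) => //.
- exact: measurableX.
- by move=> _ [x Dx <-].
- by apply: (measurable_funS measurableT) => //; exact: pair2_measurable.
Qed.

Lemma measurable_fun_fstX d1 d2 d3 (T1 : measurableType d1) (T2 : measurableType d2)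
    (T3 : measurableType d3) (D1 : set T1) (D2 : set T2) (f : T1 -> T3) :
  measurable D1 -> measurable D2 -> measurable_fun D1 f ->
  measurable_fun (D1 `*` D2) (fun p => f p.1).
Proof.
move=> mD1 mD2 mf; apply: (@measurable_comp _ _ _ _ _ _ D1 f) => //.
- by move=> _ [p [? ?] <-].
- by apply: (measurable_funS measurableT) => //; exact: measurable_fst.
Qed.

Lemma measurable_fun_sndX d1 d2 d3 (T1 : measurableType d1) (T2 : measurableType d2)
    (T3 : measurableType d3) (D1 : set T1) (D2 : set T2) (f : T2 -> T3) :
  measurable D1 -> measurable D2 -> measurable_fun D2 f ->
  measurable_fun (D1 `*` D2) (fun p => f p.2).
Proof.
move=> mD1 mD2 mf; apply: (@measurable_comp _ _ _ _ _ _ D2 f) => //.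
- by move=> _ [p [? ?] <-].
- by apply: (measurable_funS measurableT) => //; exact: measurable_snd.
Qed.

(* Schur's test; the Cauchy-Schwarz inequality is used in the form
   2 N F <= t N H + t^-1 N F^2 / H for all t > 0. *)
Lemma schur_test d (T : measurableType d) (R : realType) (mu : {finite_measure set T -> \bar R})
    (D : set T) (N : nat -> T -> T -> R) (H F : T -> R) (C1 C2 : R) :
  measurable D -> 0 < C1 -> 0 <= C2 ->
  (forall k z w, D z -> D w -> 0 <= N k z w) ->
  (forall k, measurable_fun (D `*` D) (fun p => N k p.1 p.2)) ->
  (forall z, D z -> 0 < H z) -> measurable_fun D H ->
  (forall z, D z -> 0 <= F z) -> measurable_fun D F ->
  (forall k z, D z -> (\int[mu]_(w in D) (N k z w * H w)%:E <= (C1 * H z)%:E)%E) ->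
  (forall w, D w ->
    (\int[mu]_(z in D) (\sum_(0 <= k <oo) (N k z w * H z)%:E) <= (C2 * H w)%:E)%E) ->
  (\int[mu]_(z in D) (\sum_(0 <= k <oo)
     (\int[mu]_(w in D) (N k z w * F w)%:E) * (\int[mu]_(w in D) (N k z w * F w)%:E))
   <= (C1 * C2)%:E * \int[mu]_(w in D) (F w ^+ 2)%:E)%E.
Proof.
move=> mD C10 C20 N0 mN H0 mH F0 mF h1 h2.
have mNz k z : D z -> measurable_fun D (N k z) by move=> Dz; exact: measurable_fun_pairl Dz _ _ _.
pose G k z := (\int[mu]_(w in D) (N k z w * F w)%:E)%E.
(* Integrating F^2 / H against N k z: the first Schur condition and Cauchy-Schwarz bound (G k z)^2
   by C1 H z W k z. *)
pose W k z := (\int[mu]_(w in D) (N k z w * (F w ^+ 2 / H w))%:E)%E.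
have mFH : measurable_fun D (fun w => F w ^+ 2 / H w).
  apply: measurable_funM; first exact: measurable_funX.
  exact: measurable_fun_inv.
have FH0 w : D w -> 0 <= F w ^+ 2 / H w by move=> Dw; rewrite divr_ge0 ?sqr_ge0 // ltW // H0.
have G0 k z : D z -> (0 <= G k z)%E.
  by move=> Dz; apply: integral_ge0 => w Dw; rewrite lee_fin mulr_ge0 ?N0 ?F0.
have W0 k z : D z -> (0 <= W k z)%E.
  by move=> Dz; apply: integral_ge0 => w Dw; rewrite lee_fin mulr_ge0 ?N0 ?FH0.
have step k z : D z -> (G k z * G k z <= (C1 * H z)%:E * W k z)%E.
  move=> Dz; apply: ereal_sqr_le; rewrite ?G0 ?W0 ?mulr_gt0 ?H0 // => t t0.
  apply: (@le_trans _ _ (t%:E * \int[mu]_(w in D) (N k z w * H w)%:E + (t^-1)%:E * W k z)%E); last first.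
    by apply: leeD => //; apply: lee_wpmul2l; [rewrite lee_fin ltW|exact: h1].
  rewrite /G /W -!ge0_integralZl_EFin ?invr_ge0 ?(ltW t0) //.
  - rewrite -ge0_integralD //.
    + apply: ge0_le_integral => //.
      * by move=> w Dw; rewrite -EFinM lee_fin !mulr_ge0 ?N0 ?F0.
      * by apply: measurable_funeM; apply/measurable_EFinP; apply: measurable_funM => //; exact: mNz.
      * by apply: emeasurable_funD; apply: measurable_funeM; apply/measurable_EFinP; apply: measurable_funM => //; exact: mNz.
      * move=> w Dw; rewrite -!EFinM -EFinD lee_fin.
        have h := N0 k z w Dz Dw; have hH := H0 w Dw.
        rewrite (_ : t * _ + _ = N k z w * (t * H w + t^-1 * (F w ^+ 2 / H w))); last by ring.
        rewrite mulrCA; apply: ler_wpM2l => //.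
        rewrite -subr_ge0 (_ : _ - _ = (t * H w - F w) ^+ 2 / (t * H w)).
          by rewrite divr_ge0 ?sqr_ge0 // mulr_ge0 // ltW.
        by field; rewrite !gt_eqF.
    + by move=> w Dw; rewrite -EFinM lee_fin !mulr_ge0 ?N0 ?(ltW t0) // ltW // H0.
    + by apply: measurable_funeM; apply/measurable_EFinP; apply: measurable_funM => //; exact: mNz.
    + move=> w Dw; rewrite mule_ge0 ?lee_fin ?invr_ge0 ?(ltW t0) //.
      by rewrite mulr_ge0 ?N0 ?FH0.
    + by apply: measurable_funeM; apply/measurable_EFinP; apply: measurable_funM => //; exact: mNz.
  - by move=> w Dw; rewrite lee_fin mulr_ge0 ?N0 ?FH0.
  - by apply/measurable_EFinP; apply: measurable_funM => //; exact: mNz.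
  - by move=> w Dw; rewrite lee_fin mulr_ge0 ?N0 // ltW // H0.
  - by apply/measurable_EFinP; apply: measurable_funM => //; exact: mNz.
  - by move=> w Dw; rewrite lee_fin mulr_ge0 ?N0 ?F0.
  - by apply/measurable_EFinP; apply: measurable_funM => //; exact: mNz.
have mNX k (h : T -> R) : measurable_fun D h ->
    measurable_fun (D `*` D) (fun p => (N k p.1 p.2 * h p.2)%:E).
  move=> mh; apply/measurable_EFinP; apply: measurable_funM => //.
  exact: (measurable_fun_sndX (f := h)).
have mG k : measurable_fun D (G k).
  apply: (@tonelli_measurable _ _ _ _ _ mu D D mD mD (fun z w => (N k z w * F w)%:E)).
    by move=> z w Dz Dw; rewrite lee_fin mulr_ge0 ?N0 ?F0.
  exact: mNX.
have mW k : measurable_fun D (W k).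
  apply: (@tonelli_measurable _ _ _ _ _ mu D D mD mD (fun z w => (N k z w * (F w ^+ 2 / H w))%:E)).
    by move=> z w Dz Dw; rewrite lee_fin mulr_ge0 ?N0 ?FH0.
  exact: (mNX k (fun w => F w ^+ 2 / H w) mFH).
have mHW k : measurable_fun D (fun z => (H z)%:E * W k z)%E.
  by apply: emeasurable_funM => //; exact/measurable_EFinP.
have HW0 k z : D z -> (0 <= (H z)%:E * W k z)%E.
  by move=> Dz; rewrite mule_ge0 ?W0 // lee_fin ltW // H0.
apply: (@le_trans _ _ (\int[mu]_(z in D) (C1%:E * \sum_(0 <= k <oo) ((H z)%:E * W k z)))%E).
  apply: ge0_le_integral => //.
  - by move=> z Dz; apply: nneseries_ge0 => k _ _; rewrite mule_ge0 ?G0.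
  - apply: ge0_emeasurable_sum => [k z Dz _|k _]; first by rewrite mule_ge0 ?G0.
    by apply: emeasurable_funM; exact: mG.
  - apply: measurable_funeM; apply: ge0_emeasurable_sum => [k z Dz _|k _]; first exact: HW0.
    exact: mHW.
  - move=> z Dz; rewrite -nneseriesZl; last by move=> k _; exact: HW0.
    apply: lee_nneseries => k; first by move=> _ _; rewrite mule_ge0 ?G0.
    by move=> _; rewrite muleA -EFinM; exact: step.
rewrite ge0_integralZl_EFin ?(ltW C10) //; last 2 first.
- by move=> z Dz; apply: nneseries_ge0 => k _ _; exact: HW0.
- by apply: ge0_emeasurable_sum => [k z Dz _|k _]; [exact: HW0|exact: mHW].
rewrite EFinM -muleA; apply: lee_pmul => //; first by rewrite lee_fin ltW.
  by apply: integral_ge0 => z Dz; apply: nneseries_ge0 => k _ _; exact: HW0.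
rewrite integral_nneseries //.
have NH0 k z w : D z -> D w -> (0 <= (N k z w * H z)%:E)%E.
  by move=> Dz Dw; rewrite lee_fin mulr_ge0 ?N0 // ltW // H0.
have mNH k : measurable_fun (D `*` D) (fun p => (N k p.1 p.2 * H p.1)%:E).
  apply/measurable_EFinP; apply: measurable_funM => //.
  exact: (measurable_fun_fstX (f := H)).
have mNHw k w : D w -> measurable_fun D (fun z => (N k z w * H z)%:E).
  by move=> Dw; exact: (measurable_fun_pairr (f := fun z w => (N k z w * H z)%:E) Dw mD mD).
(* Exchanging z and w produces the integral of N H in z; summed over k, it is the quantity bounded
   by the second Schur condition. *)
have key k : (\int[mu]_(z in D) ((H z)%:E * W k z) =
    \int[mu]_(w in D) ((F w ^+ 2 / H w)%:E * \int[mu]_(z in D) (N k z w * H z)%:E))%E.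
  rewrite -[RHS](_ : \int[mu]_(w in D) \int[mu]_(z in D) (N k z w * H z * (F w ^+ 2 / H w))%:E = _)%E; last first.
    apply: eq_integral => w /set_mem Dw; rewrite -ge0_integralZl_EFin ?FH0 //.
    - by apply: eq_integral => z _; rewrite -EFinM mulrC.
    - by move=> z Dz; exact: NH0.
    - exact: mNHw.
  rewrite -tonelli_on //; last 2 first.
  - move=> z w Dz Dw; rewrite EFinM mule_ge0 ?lee_fin ?FH0 //.
    by rewrite mulr_ge0 ?N0 // ltW // H0.
  - apply/measurable_EFinP; apply: measurable_funM.
      by apply: measurable_funM => //; exact: (measurable_fun_fstX (f := H)).
    exact: (measurable_fun_sndX (f := fun w => F w ^+ 2 / H w)).
  apply: eq_integral => z /set_mem Dz; rewrite -ge0_integralZl_EFin ?(ltW (H0 _ Dz)) //.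
  - by apply: eq_integral => w _; rewrite -EFinM; congr (_%:E); ring.
  - by move=> w Dw; rewrite lee_fin mulr_ge0 ?N0 ?FH0.
  - by apply/measurable_EFinP; apply: measurable_funM => //; exact: mNz.
have mI k : measurable_fun D (fun w => \int[mu]_(z in D) (N k z w * H z)%:E)%E.
  apply: (@tonelli_measurable _ _ _ _ _ mu D D mD mD (fun w z => (N k z w * H z)%:E)).
    by move=> w z Dw Dz; exact: NH0.
  apply: (@measurable_comp _ _ _ _ _ _ (D `*` D) (fun p => (N k p.1 p.2 * H p.1)%:E) _ (fun p => (p.2, p.1))) => //.
  - exact: measurableX.
  - by move=> _ [p [? ?] <-].
  - apply: (measurable_funS measurableT) => //; exact: measurable_swap.
have mFHe : measurable_fun D (fun w => (F w ^+ 2 / H w)%:E) by exact/measurable_EFinP.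
rewrite (eq_eseriesr (fun k _ => key k)) -integral_nneseries //; last 2 first.
- by move=> k; exact: emeasurable_funM.
- by move=> k w Dw; rewrite mule_ge0 ?lee_fin ?FH0 //; apply: integral_ge0 => z Dz; exact: NH0.
have mF2 : measurable_fun D (fun w => (F w ^+ 2)%:E) by apply/measurable_EFinP; exact: measurable_funX.
rewrite -ge0_integralZl_EFin //; last by move=> w Dw; rewrite lee_fin sqr_ge0.
apply: ge0_le_integral => //.
- move=> w Dw; apply: nneseries_ge0 => k _ _; rewrite mule_ge0 ?lee_fin ?FH0 //.
  by apply: integral_ge0 => z Dz; exact: NH0.
- apply: ge0_emeasurable_sum => [k w Dw _|k _]; last exact: emeasurable_funM.
  by rewrite mule_ge0 ?lee_fin ?FH0 //; apply: integral_ge0 => z Dz; exact: NH0.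
- exact: measurable_funeM.
move=> w Dw; rewrite nneseriesZl; last by move=> k _; apply: integral_ge0 => z Dz; exact: NH0.
rewrite -integral_nneseries //; last 2 first.
- by move=> k; exact: mNHw.
- by move=> k z Dz; exact: NH0.
apply: (@le_trans _ _ ((F w ^+ 2 / H w)%:E * (C2 * H w)%:E)%E).
  apply: lee_pmul => //; rewrite ?lee_fin ?FH0 //; last exact: h2.
  by apply: integral_ge0 => z Dz; apply: nneseries_ge0 => k _ _; exact: NH0.
rewrite -!EFinM lee_fin (_ : F w ^+ 2 / H w * _ = C2 * F w ^+ 2) //.
by field; rewrite gt_eqF ?H0.
Qed.

(** The hypothesis is the case of indicator functions. It passes to the simple functions
    approximating g by additivity, and to g by monotone convergence. [ind] and [cv] are stated for a
    map psi, so that psi = phi and psi = id treat the two sides at once. *)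
Lemma integral_comp_le d (T : measurableType d) (R : realType) (mu : {measure set T -> \bar R})
    (D : set T) (w : T -> R) (phi : T -> T) (C : R) (g : T -> \bar R) :
  measurable D -> measurable_fun D w -> (forall x, D x -> 0 <= w x) -> 0 <= C ->
  (forall x, D x -> D (phi x)) -> measurable_fun D phi ->
  (forall A, measurable A -> A `<=` D ->
    (\int[mu]_(x in D `&` phi @^-1` A) (w x)%:E <= C%:E * \int[mu]_(x in A) (w x)%:E)%E) ->
  measurable_fun D g -> (forall x, D x -> (0 <= g x)%E) ->
  (\int[mu]_(x in D) (g (phi x) * (w x)%:E) <= C%:E * \int[mu]_(x in D) (g x * (w x)%:E))%E.
Proof.
move=> mD mw w0 C0 phiD mphi hA mg g0.
have mwe : measurable_fun D (fun x => (w x)%:E) by exact/measurable_EFinP.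
have we0 x : D x -> (0 <= (w x)%:E)%E by move=> Dx; rewrite lee_fin w0.
pose h := nnsfun_approx mD mg.
have simple n : (\int[mu]_(x in D) ((h n (phi x))%:E * (w x)%:E) <=
    C%:E * \int[mu]_(x in D) ((h n x)%:E * (w x)%:E))%E.
  pose hy y := (h n) @^-1` [set y].
  have mhy y : measurable (hy y) by exact: measurable_funPTI.
  have fin : finite_set (range (h n)) by exact: fimfunP.
  have ind (psi : T -> T) : (forall x, D x -> D (psi x)) -> measurable_fun D psi ->
      (\int[mu]_(x in D) ((h n (psi x))%:E * (w x)%:E) =
      \sum_(y \in range (h n)) (y%:E * \int[mu]_(x in D `&` psi @^-1` (D `&` hy y)) (w x)%:E))%E.
    move=> psiD mpsi.
    have e x : ((h n (psi x))%:E * (w x)%:E = \sum_(y \in range (h n)) ((y * \1_(hy y) (psi x))%:E * (w x)%:E))%E.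
      rewrite -ge0_mule_fsuml; first by rewrite {1}(fimfunE (h n)) fsumEFin.
      by move=> y; have := nnfun_muleindic_ge0 (h n) y (psi x); rewrite -EFinM.
    under eq_integral do rewrite e.
    have mpre y : measurable (D `&` psi @^-1` hy y) by exact: mpsi.
    have mind y : measurable_fun D (fun x => (\1_(hy y) (psi x) : R)).
      by apply: (measurable_comp measurableT) mpsi => //; exact: measurable_indic.
    have nn y x : (0 <= (y * \1_(hy y) (psi x))%:E)%E.
      have := nnfun_muleindic_ge0 (h n) y (psi x); rewrite -EFinM lee_fin.
      exact.
    rewrite ge0_integral_fsum //; last 2 first.
    - move=> y; apply: emeasurable_funM => //; apply/measurable_EFinP.
      by apply: measurable_funM => //; exact: measurable_cst.
    - by move=> y x Dx; rewrite mule_ge0 ?we0.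
    apply: eq_fsbigr => y /set_mem [t _ yt].
    have y0 : 0 <= y by rewrite -yt.
    rewrite [X in (_ * X)%E](_ : _ = \int[mu]_(x in D) ((\1_(hy y) (psi x))%:E * (w x)%:E))%E; last first.
      rewrite [LHS]integral_mkcond [RHS]integral_mkcond; apply: eq_integral => x _.
      rewrite !patchE !in_setI; case: (boolP (x \in D)) => //= xD.
      rewrite -[X in X && _]/(psi x \in D) -[X in _ && X]/(psi x \in hy y).
      rewrite (mem_set (psiD _ (set_mem xD))) indicE /=.
      by case: (psi x \in hy y); rewrite ?mul1e ?mul0e.
    rewrite -ge0_integralZl_EFin //.
    - by apply: eq_integral => x _; rewrite EFinM muleA.
    - by move=> x Dx; rewrite mule_ge0 ?we0 // lee_fin.
    - by apply: emeasurable_funM => //; exact/measurable_EFinP.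
  rewrite ind //; rewrite (ind id (fun _ => id) (@measurable_id _ _ _)).
  have y0 y : (0 <= y%:E * \int[mu]_(x in D `&` id @^-1` (D `&` hy y)) (w x)%:E)%E.
    have [yge|ylt] := leP 0 y.
      by rewrite mule_ge0 ?lee_fin //; apply: integral_ge0 => x [? _]; exact: we0.
    by rewrite /hy preimage_nnfun0 // setI0 preimage_set0 setI0 integral_set0 mule0.
  rewrite ge0_mule_fsumr //; apply: lee_fsum => // _ [t _ <-].
  rewrite muleCA; apply: lee_wpmul2l; first by rewrite lee_fin.
  rewrite preimage_id setIA setIid; apply: hA => //; first exact: measurableI.
have cv (psi : T -> T) : (forall x, D x -> D (psi x)) -> measurable_fun D psi ->
   (\int[mu]_(x in D) ((h n (psi x))%:E * (w x)%:E) @[n --> \oo] -->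
      \int[mu]_(x in D) (g (psi x) * (w x)%:E))%E.
  move=> psiD mpsi.
  rewrite [X in _ --> X](_ : _ = \int[mu]_(x in D) limn (fun n => (h n (psi x))%:E * (w x)%:E))%E; last first.
    apply: eq_integral => x /set_mem Dx; apply/esym/cvg_lim => //.
    apply: cvgeZr => //; apply: (cvg_nnsfun_approx mD mg g0); exact: psiD.
  apply: cvg_monotone_convergence => //.
  - move=> n; apply: emeasurable_funM => //; apply/measurable_EFinP.
    by apply: (measurable_comp measurableT) mpsi.
  - by move=> n x Dx; rewrite mule_ge0 ?we0 ?lee_fin.
  - move=> x Dx n m nm; apply: lee_wpmul2r; first exact: we0.
    by rewrite lee_fin; have /lefP := nd_nnsfun_approx mD mg nm.
apply: lee_cvg_to (cv phi phiD mphi) _ _.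
  by apply: cvgeZl (cv id _ (@measurable_id _ _ _)).
by near=> n; exact: simple.
Unshelve. all: by end_near. Qed.

(** * Analytic functions and measurability *)

Section complex_modulus.
Variable R : realType.
Implicit Types a b : R[i].

Lemma normc_cmod a : `|a| = (cmod a)%:C. Proof. by []. Qed.

Lemma cmod_ge0 a : 0 <= cmod a.
Proof. by case: a => x y; rewrite /cmod /= sqrtr_ge0. Qed.

Lemma cmodM a b : cmod (a * b) = cmod a * cmod b.
Proof. exact: ComplexField.Normc.normcM. Qed.

Lemma cmodV a : cmod a^-1 = (cmod a)^-1.
Proof. exact: ComplexField.Normc.normcV. Qed.

Lemma cmodN a : cmod (- a) = cmod a.
Proof. by apply: complexI; rewrite -!normc_cmod normrN. Qed.

Lemma cmodJ a : cmod a^* = cmod a.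
Proof. by case: a => x y; rewrite /cmod /= sqrrN. Qed.

Lemma cmodR (x : R) : cmod x%:C = `|x|.
Proof. by rewrite /cmod /= expr0n /= addr0 sqrtr_sqr. Qed.

Lemma cmod0 : cmod (0 : R[i]) = 0.
Proof. by rewrite (cmodR 0) normr0. Qed.

Lemma cmod1 : cmod (1 : R[i]) = 1.
Proof. by rewrite (cmodR 1) normr1. Qed.

Lemma cmod_i : cmod ('i : R[i]) = 1.
Proof. by rewrite /cmod /= expr0n /= add0r expr1n sqrtr1. Qed.

Lemma cmod_sqr a : cmod a ^+ 2 = complex.Re a ^+ 2 + complex.Im a ^+ 2.
Proof. by case: a => x y; rewrite /cmod /= sqr_sqrtr // addr_ge0 ?sqr_ge0. Qed.

Lemma cmodD a b : cmod (a + b) <= cmod a + cmod b.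
Proof. exact: le_normcD. Qed.

Lemma cmod_distD a b : `|cmod a - cmod b| <= cmod (a - b).
Proof.
rewrite ler_norml lerBlDr lerNl opprB lerBlDr; apply/andP; split.
  by rewrite -(cmodN (a - b)) opprB -[X in cmod X <= _](subrK a b); exact: cmodD.
by rewrite -[X in cmod X <= _](subrK b a); exact: cmodD.
Qed.

Lemma Re_le_cmod a : `|complex.Re a| <= cmod a.
Proof.
by rewrite -sqrtr_sqr -[leRHS](@ger0_norm _ (cmod a)) ?cmod_ge0 // -sqrtr_sqr ler_wsqrtr // cmod_sqr lerDl sqr_ge0.
Qed.

Lemma Im_le_cmod a : `|complex.Im a| <= cmod a.
Proof.
by rewrite -sqrtr_sqr -[leRHS](@ger0_norm _ (cmod a)) ?cmod_ge0 // -sqrtr_sqr ler_wsqrtr // cmod_sqr lerDr sqr_ge0.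
Qed.

Lemma cmod_eq0 a : cmod a = 0 -> a = 0.
Proof. exact: ComplexField.Normc.eq0_normc. Qed.

Lemma cmod_gt0 a : a != 0 -> 0 < cmod a.
Proof.
move=> a0; rewrite lt_neqAle cmod_ge0 andbT eq_sym; apply/eqP => /cmod_eq0 a00.
by rewrite a00 eqxx in a0.
Qed.

Lemma cmod_parallelogram a b :
  cmod (a + b) ^+ 2 + cmod (a - b) ^+ 2 = 2 * cmod a ^+ 2 + 2 * cmod b ^+ 2.
Proof. by rewrite !cmod_sqr; case: a b => x y [x' y'] /=; ring. Qed.

Lemma cmod_polarization a b :
  complex.Re (a * b^*) = (cmod (a + b) ^+ 2 - cmod (a - b) ^+ 2) / 4.
Proof. by rewrite !cmod_sqr; case: a b => x y [x' y'] /=; field. Qed.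

Lemma unimodular_Re a : exists2 c : R[i], cmod c = 1 & complex.Re (c * a) = cmod a.
Proof.
have [->|a0] := eqVneq a 0; first by exists 1; rewrite ?cmod1 // mulr0 cmod0.
have ca := cmod_gt0 a0.
exists ((cmod a)^-1%:C * a^*).
  by rewrite cmodM cmodJ cmodR ger0_norm ?invr_ge0 ?cmod_ge0 // mulVf // gt_eqF.
have -> : (cmod a)^-1%:C * a^* * a = ((cmod a)^-1 * cmod a ^+ 2)%:C.
  rewrite cmod_sqr; case: a a0 ca => x y _ _ /=; simpc => /=; congr (_ +i* _); ring.
by rewrite /= expr2 mulrA mulVf ?gt_eqF // mul1r.
Qed.

End complex_modulus.

(** * Borel measurability on C^n and Caratheodory functions *)

Section cspace_topology.
Variables (R : realType) (n : nat).
Local Notation X := (cspace R n).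
Local Notation BX := (borel_cspace R n).

Lemma open_borel (U : set X) : open U -> measurable (U : set BX).
Proof. exact: sub_sigma_algebra. Qed.

Lemma dense_sequence : exists q : nat -> X, forall U : set X, open U -> U !=set0 -> exists j, U (q j).
Proof.
pose toX (v : 'rV[rat * rat]_n) : X :=
  (\row_j (Complex (ratr (v 0 j).1) (ratr (v 0 j).2)) : 'rV[R[i]]_n).
exists (fun j => if unpickle j is Some v then toX v else 0).
move=> U oU [z Uz].
have /nbhs_ballP[e /= e0 eU] : nbhs z U by exact: open_nbhs_nbhs.
(* Radii of balls are elements of [R[i]]. Positivity makes e real, and r bounds the errors on the
   real and on the imaginary part of each coordinate. *)
pose r := complex.Re e / 2.
have r0 : 0 < r by rewrite divr_gt0 //; move: e0; rewrite ltcE => /andP[].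
have ratnear (x : R) : exists s : rat, `|x - ratr s| < r.
  have [|y [Bs [s _ sE]]] := @dense_rat R (ball x r) _ (ball_open x r).
    by exists x; exact: ballxx.
  by exists s; rewrite sE; exact: Bs.
have /choice[v vP] : forall j : 'I_n, exists p : rat * rat,
    `|complex.Re ((z : 'rV_n) 0 j) - ratr p.1| < r /\ `|complex.Im ((z : 'rV_n) 0 j) - ratr p.2| < r.
  move=> j; have [s1 h1] := ratnear (complex.Re ((z : 'rV_n) 0 j)).
  by have [s2 h2] := ratnear (complex.Im ((z : 'rV_n) 0 j)); exists (s1, s2).
exists (pickle (\row_j v j)); rewrite pickleK; apply: eU.
split => // i j; rewrite !mxE ord1.
have [h1 h2] := vP j.
rewrite /ball /=; apply: (@le_lt_trans _ _ (`|complex.Re ((z : 'rV_n) 0 j) - ratr (v j).1| + `|complex.Im ((z : 'rV_n) 0 j) - ratr (v j).2|)%:C).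
  case: ((z : 'rV_n) 0 j) => x y; rewrite normc_cmod lecR /=.
  set a := x - _; set b := y - _.
  rewrite -[leLHS]/(cmod (a +i* b)).
  have -> : a +i* b = a%:C + 'i%C * b%:C by simpc.
  by apply: le_trans (cmodD _ _) _; rewrite cmodM cmod_i mul1r !cmodR.
have -> : e = (r + r)%:C.
  move: e0; rewrite ltcE => /andP[/eqP e0 _]; rewrite /r -splitr.
  by rewrite [LHS]complexE e0 /= mulr0 addr0.
by rewrite ltcR ltrD.
Qed.

Lemma continuous_borel_measurable (D : set X) (f : X -> R) : open D ->
  (forall z, D z -> f x @[x --> z] --> f z) -> measurable_fun (D : set BX) f.
Proof.
move=> oD cf; apply: measurable_fun_gtP => a; apply: open_borel.
rewrite openE => z [Dz az]; apply: filterI; first exact: open_nbhs_nbhs.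
exact: (cvgr_gt (f z) (cf z Dz) _ az).
Qed.

(* Caratheodory functions: for z in the open set D, [a < f z w] iff z has a basic
   neighbourhood on whose points of a fixed dense sequence f(., w) exceeds a + 1/m. *)
Lemma caratheodory_measurable d (T : measurableType d) (D : set X) (E : set T) (f : X -> T -> R) :
  open D -> measurable E ->
  (forall z w, D z -> E w -> f x w @[x --> z] --> f z w) ->
  (forall z, D z -> measurable_fun E (f z)) ->
  measurable_fun ((D : set BX) `*` E) (fun p => f p.1 p.2).
Proof.
move=> oD mE cf mf; have [q qP] := dense_sequence.
have mD := open_borel oD.
apply: measurable_fun_gtP => a.
pose eps (m : nat) : R := m.+1%:R^-1.
have eps0 m : 0 < eps m by rewrite invr_gt0.
pose B (j l : nat) : set X := ball (q j) (eps l)%:C.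
have oB j l : open (B j l) by exact: ball_open.
(* When q i lies outside the ball or outside D it imposes no condition, and W is all of E. *)
pose W (j l m i : nat) : set T :=
  if `[< B j l (q i) /\ D (q i) >] then E `&` [set w | a + eps m <= f (q i) w] else E.
have mW j l m i : measurable (W j l m i).
  rewrite /W; case: asboolP => // -[_ Dq].
  rewrite (_ : E `&` _ = E `&` f (q i) @^-1` `[a + eps m, +oo[%classic).
    by apply: (mf _ Dq) => //; exact: measurable_itv.
  by apply/seteqP; split => x /=; rewrite in_itv /= andbT.
rewrite (_ : _ `&` _ = \bigcup_j \bigcup_l \bigcup_m ((B j l `&` D) `*` \bigcap_i W j l m i)).
  apply: bigcupT_measurable => j; apply: bigcupT_measurable => l; apply: bigcupT_measurable => m.
  apply: measurableX; first by apply: open_borel; exact: openI.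
  exact: bigcapT_measurable.
apply/seteqP; split => [[z w] [/= [Dz Ew] az]|[z w] /= [j _ [l _ [m _ [/= [Bz Dz] Ww]]]]].
  have [m am] : exists m, a + eps m < f z w.
    have : 0 < f z w - a by rewrite subr_gt0.
    move=> /[dup] h; rewrite -invr_gt0 => h'.
    exists (Num.trunc (f z w - a)^-1); rewrite addrC -ltrBrDr.
    by rewrite /eps invf_plt ?posrE // truncnS_gt.
  have : nbhs z (D `&` [set x | a + eps m < f x w]).
    apply: filterI; first exact: open_nbhs_nbhs.
    exact: (cvgr_gt (f z w) (cf z w Dz Ew) _ am).
  move=> /nbhs_ballP[e /= e0 eU].
  have re0 : 0 < complex.Re e / 2.
    by rewrite divr_gt0 //; move: e0; rewrite ltcE => /andP[].
  pose l := Num.trunc (complex.Re e / 2)^-1.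
  have le : eps l < complex.Re e / 2 by rewrite /eps invf_plt ?posrE // truncnS_gt.
  have el0 : 0 < (eps l)%:C :> R[i] by rewrite ltcR.
  have [j jP] := qP (ball z (eps l)%:C) (ball_open z _) (ex_intro _ z (ballxx z el0)).
  have Bz : B j l z by exact: ball_sym.
  have sub : B j l `<=` ball z e.
    move=> x Bx; have := ball_triangle jP Bx; apply: le_ball.
    rewrite -rmorphD /= lecE /=; move: e0; rewrite ltcE => /andP[/eqP -> _] /=.
    by rewrite eqxx /= [leRHS]splitr lerD // ltW.
  exists j => //; exists l => //; exists m => //; split; first by split.
  move=> i _; rewrite /W; case: asboolP => // -[Bq Dq]; split => //=.
  by apply: ltW; have [] := eU _ (sub _ Bq).
have Ew : E w.
  by have := Ww 0%N I; rewrite /W; case: asboolP => // _ [].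
split; first by split.
apply: contrapT => /negP; rewrite -leNgt => fa.
have lt : f z w < a + eps m by rewrite (le_lt_trans fa) // ltrDl.
have : nbhs z ((B j l `&` D) `&` [set x | f x w < a + eps m]).
  apply: filterI; first by apply: open_nbhs_nbhs; split => //; exact: openI.
  exact: (cvgr_lt (f z w) (cf z w Dz Ew) _ lt).
rewrite nbhsE => -[U [oU Uz] sU].
have [i Ui] := qP U oU (ex_intro _ z Uz).
have [[Bq Dq] /=] := sU _ Ui.
have := Ww i I; rewrite /W; case: asboolP => [_ [_ /=]|[]//].
by rewrite leNgt => /negP.
Qed.

End cspace_topology.

Section analytic_functions.
Variables (R : realType) (n : nat) (S : bergman_data R n).
Local Notation X := (cspace R n).
Local Notation BX := (borel_cspace R n).
Local Notation Om := (Omega S).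

Lemma complex_cvg_part (T : Type) (F : set_system T) (f : T -> R[i]) (l : R[i]) (p : R[i] -> R) :
  Filter F -> (forall a b, `|p a - p b| <= cmod (a - b)) ->
  (f x @[x --> F] --> (l : R[i]^o)) -> p (f x) @[x --> F] --> p l.
Proof.
move=> FF pL cf; apply/cvgrPdist_lt => e e0.
have e0c : 0 < e%:C :> R[i] by rewrite ltcR.
apply: filterS ((@cvgrPdist_lt _ (R[i]^o) _ F FF f l).1 cf _ e0c) => x; rewrite normc_cmod ltcR; exact: le_lt_trans.
Qed.

Lemma Re_distD (a b : R[i]) : `|complex.Re a - complex.Re b| <= cmod (a - b).
Proof. by rewrite -raddfB; exact: Re_le_cmod. Qed.

Lemma Im_distD (a b : R[i]) : `|complex.Im a - complex.Im b| <= cmod (a - b).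
Proof. by rewrite -raddfB; exact: Im_le_cmod. Qed.

Lemma analytic_cvg (f : X -> R[i]) z : analytic S f -> Om z ->
  f x @[x --> z] --> (f z : R[i]^o).
Proof.
move=> af Oz; have := @differentiable_continuous _ _ _ z (f : X -> R[i]^o) (af z Oz).
exact.
Qed.

Lemma analytic_cmod_cvg (f : X -> R[i]) z : analytic S f -> Om z ->
  cmod (f x) @[x --> z] --> cmod (f z).
Proof.
by move=> af Oz; apply: (complex_cvg_part _ _ (analytic_cvg af Oz)) => a b; exact: cmod_distD.
Qed.

Lemma analytic_cmeasurable (f : X -> R[i]) : open Om -> analytic S f -> cmeasurable S f.
Proof.
move=> oOm af; split; apply: continuous_borel_measurable => // z Oz;
  apply: (complex_cvg_part _ _ (analytic_cvg af Oz)) => a b.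
- exact: Re_distD.
- exact: Im_distD.
Qed.

Lemma cmeasurable_cmod2 (f : X -> R[i]) : cmeasurable S f ->
  measurable_fun (Om : set BX) (fun w => cmod (f w) ^+ 2).
Proof.
move=> [mr mi]; rewrite (_ : (fun w => _) = (fun w => complex.Re (f w) ^+ 2 + complex.Im (f w) ^+ 2)).
  by apply: measurable_funD; exact: measurable_funX.
by apply/funext => w; rewrite cmod_sqr.
Qed.

Lemma cmeasurable_cmod (f : X -> R[i]) : cmeasurable S f ->
  measurable_fun (Om : set BX) (fun w => cmod (f w)).
Proof.
move=> mf; have := cmeasurable_cmod2 mf => m2.
apply: (@eq_measurable_fun _ _ BX _ _ (fun w => (cmod (f w) ^+ 2) `^ 2^-1)).
  by move=> w _; rewrite powR12_sqrt ?sqr_ge0 // sqrtr_sqr ger0_norm ?cmod_ge0.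
by apply: (measurable_comp measurableT) (measurable_powR _) m2.
Qed.

End analytic_functions.

(** * Square integrable functions with values in l^2 *)

Section l2_sequences.
Variable R : realType.
Implicit Types a b c : nat -> R[i].

Lemma l2sqnorm_ge0 a : (0 <= l2sqnorm a)%E.
Proof. by apply: nneseries_ge0 => k _ _; rewrite lee_fin sqr_ge0. Qed.

Lemma l2sqnormZ (x : R[i]) a : l2sqnorm (x *: a) = ((cmod x ^+ 2)%:E * l2sqnorm a)%E.
Proof.
rewrite /l2sqnorm -nneseriesZl; last by move=> k _; rewrite lee_fin sqr_ge0.
by apply: eq_eseriesr => k _; rewrite -EFinM -exprMn -cmodM.
Qed.

Lemma l2sqnorm_parallelogram a b :
  (l2sqnorm (a + b)%R + l2sqnorm (a - b)%R = 2%:E * l2sqnorm a + 2%:E * l2sqnorm b)%E.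
Proof.
rewrite /l2sqnorm -!nneseriesZl; try by move=> k _; rewrite lee_fin sqr_ge0.
rewrite -!nneseriesD; try by move=> k _ _; rewrite ?mule_ge0 // lee_fin sqr_ge0.
by apply: eq_eseriesr => k _; rewrite -!EFinM -!EFinD cmod_parallelogram.
Qed.

Lemma l2sqnormD_lty a b : (l2sqnorm a < +oo)%E -> (l2sqnorm b < +oo)%E ->
  (l2sqnorm (a + b)%R < +oo)%E.
Proof.
move=> fa fb; apply: (@le_lt_trans _ _ (2%:E * l2sqnorm a + 2%:E * l2sqnorm b)%E).
  by rewrite -l2sqnorm_parallelogram leeDl // l2sqnorm_ge0.
by rewrite lte_add_pinfty // lte_mul_pinfty.
Qed.

Lemma l2sqnormN a : l2sqnorm (- a) = l2sqnorm a.
Proof. by apply: eq_eseriesr => k _; rewrite /= cmodN. Qed.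

Lemma l2sqnormB_lty a b : (l2sqnorm a < +oo)%E -> (l2sqnorm b < +oo)%E ->
  (l2sqnorm (a - b)%R < +oo)%E.
Proof. by move=> fa fb; apply: l2sqnormD_lty => //; rewrite l2sqnormN. Qed.

Lemma l2sqnorm_fin a : (l2sqnorm a < +oo)%E -> l2sqnorm a \is a fin_num.
Proof. by move=> fa; rewrite ge0_fin_numE // l2sqnorm_ge0. Qed.

Lemma l2sqnorm_cvg a : (l2sqnorm a < +oo)%E ->
  \sum_(0 <= k < m) cmod (a k) ^+ 2 @[m --> \oo] --> fine (l2sqnorm a).
Proof.
move=> fa; rewrite (_ : (fun m => _) = fine \o (fun m => \sum_(0 <= k < m) (cmod (a k) ^+ 2)%:E)%E).
  apply: fine_cvg; rewrite fineK ?l2sqnorm_fin //.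
  by apply: is_cvg_nneseries => k _ _; rewrite lee_fin sqr_ge0.
by apply/funext => m /=; rewrite sumEFin.
Qed.

(** Polarization writes each partial sum as a difference of partial sums of two convergent series of
    squares; this gives both the convergence and the limit. *)
Lemma Re_l2dot_cvg a b : (l2sqnorm a < +oo)%E -> (l2sqnorm b < +oo)%E ->
  \sum_(0 <= k < m) complex.Re (a k * (b k)^*) @[m --> \oo] -->
  (fine (l2sqnorm (a + b)) - fine (l2sqnorm (a - b))) / 4.
Proof.
move=> fa fb.
rewrite (_ : (fun m => _) = fun m => (\sum_(0 <= k < m) cmod ((a + b) k) ^+ 2 -
    \sum_(0 <= k < m) cmod ((a - b) k) ^+ 2) / 4).
  apply: cvgMl; apply: cvgB; apply: l2sqnorm_cvg.
    exact: l2sqnormD_lty.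
  exact: l2sqnormB_lty.
apply/funext => m; rewrite -sumrB mulr_suml; apply: eq_bigr => k _.
exact: cmod_polarization.
Qed.

Lemma Re_l2dotE a b : (l2sqnorm a < +oo)%E -> (l2sqnorm b < +oo)%E ->
  complex.Re (l2dot a b) = (fine (l2sqnorm (a + b)) - fine (l2sqnorm (a - b))) / 4.
Proof. by move=> fa fb; apply/cvg_lim => //; exact: Re_l2dot_cvg. Qed.

Lemma Re_l2dotDl a b c : (l2sqnorm a < +oo)%E -> (l2sqnorm b < +oo)%E -> (l2sqnorm c < +oo)%E ->
  complex.Re (l2dot (a + b) c) = complex.Re (l2dot a c) + complex.Re (l2dot b c).
Proof.
move=> fa fb fc; apply/cvg_lim => //.
rewrite (_ : (fun m => _) = fun m => \sum_(0 <= k < m) complex.Re (a k * (c k)^*) +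
    \sum_(0 <= k < m) complex.Re (b k * (c k)^*)).
  by rewrite !Re_l2dotE //; apply: cvgD; exact: Re_l2dot_cvg.
by apply/funext => m; rewrite -big_split /=; apply: eq_bigr => k _; rewrite mulrDl raddfD.
Qed.

Lemma Re_l2dotZl (x : R) a c : (l2sqnorm a < +oo)%E -> (l2sqnorm c < +oo)%E ->
  complex.Re (l2dot (x%:C *: a) c) = x * complex.Re (l2dot a c).
Proof.
move=> fa fc; apply/cvg_lim => //.
rewrite (_ : (fun m => _) = fun m => x * \sum_(0 <= k < m) complex.Re (a k * (c k)^*)).
  by rewrite !Re_l2dotE //; apply: cvgMr; exact: Re_l2dot_cvg.
apply/funext => m; rewrite mulr_sumr; apply: eq_bigr => k _ /=.
rewrite -[(x%:C *: a) k]/(x%:C * a k) -mulrA; case: (a k * _) => u v /=; rewrite mul0r subr0 //.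
Qed.

(** This identity and the next three hold term by term: both sides are the limit of one and the same
    sequence, convergent or not. *)
Lemma Re_l2dotC a b : complex.Re (l2dot a b) = complex.Re (l2dot b a).
Proof.
apply: (congr1 (fun u : nat -> R => limn u)); apply/funext => m; apply: eq_bigr => k _.
by case: (a k) (b k) => u v [u' v'] /=; ring.
Qed.

Lemma Re_l2dotii a b : complex.Re (l2dot ('i *: a) ('i *: b)) = complex.Re (l2dot a b).
Proof.
apply: (congr1 (fun u : nat -> R => limn u)); apply/funext => m; apply: eq_bigr => k _.
rewrite -[('i *: a) k]/('i * a k) -[('i *: b) k]/('i * b k).
by case: (a k) (b k) => u v [u' v'] /=; ring.
Qed.

Lemma Re_l2dot_conj (c : R[i]) a b :
  complex.Re (l2dot (c *: a) b) = complex.Re (l2dot a ((c^*)%R *: b)).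
Proof.
apply: (congr1 (fun u : nat -> R => limn u)); apply/funext => m; apply: eq_bigr => k _.
rewrite -[(c *: a) k]/(c * a k) -[((c^*)%R *: b) k]/((c^*)%R * b k).
by case: c (a k) (b k) => s t [u v] [u' v'] /=; ring.
Qed.

Lemma Im_l2dotE a b : complex.Im (l2dot a b) = complex.Re (l2dot ((- 'i) *: a) b).
Proof.
apply: (congr1 (fun u : nat -> R => limn u)); apply/funext => m; apply: eq_bigr => k _.
rewrite -[(- 'i *: a) k]/(- 'i * a k).
by case: (a k) (b k) => u v [u' v'] /=; ring.
Qed.

Lemma Re_l2dot_diag a : (l2sqnorm a < +oo)%E -> complex.Re (l2dot a a) = fine (l2sqnorm a).
Proof.
move=> fa; apply/cvg_lim => //; rewrite (_ : (fun m => _) = fun m => \sum_(0 <= k < m) cmod (a k) ^+ 2).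
  exact: l2sqnorm_cvg.
apply/funext => m; apply: eq_bigr => k _; rewrite cmod_sqr.
by case: (a k) => u v /=; ring.
Qed.

Lemma l2dot_basis a (x : R[i]) (j : nat) :
  l2dot a (fun k => x * l2basis R j k) = a j * x^*.
Proof.
have key (p : {additive R[i] -> R}) :
    limn (fun m : nat => \sum_(0 <= k < m) p (a k * (x * l2basis R j k)^*)) = p (a j * x^*).
  apply/cvg_lim => //; apply: (@cvg_near_cst _ _ _ _ _ _) => //.
  near=> m; have jm : (j < m)%N by near: m; exact: nbhs_infty_gt.
  rewrite (bigD1_seq j) ?iota_uniq ?mem_index_iota //= big1 ?addr0.
    by rewrite /l2basis eqxx mulr1.
  by move=> k kj; rewrite /l2basis (negbTE kj) mulr0 rmorph0 mulr0 raddf0.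
by rewrite /l2dot (key (@complex.Re R)) (key (@complex.Im R)); case: (a j * _).
Unshelve. all: by end_near. Qed.

Lemma Re_l2dot_le a b : (l2sqnorm a < +oo)%E -> (l2sqnorm b < +oo)%E ->
  (`|complex.Re (l2dot a b)|%:E <= \sum_(0 <= k <oo) (cmod (a k) * cmod (b k))%:E)%E.
Proof.
move=> fa fb; rewrite Re_l2dotE //.
have c : `|\sum_(0 <= k < m) complex.Re (a k * (b k)^*)|%:E @[m --> \oo] -->
    `|(fine (l2sqnorm (a + b)) - fine (l2sqnorm (a - b))) / 4|%:E.
  by apply: cvg_EFin; [exact: nearW|exact: (cvg_norm (Re_l2dot_cvg fa fb))].
apply: (cvge_to_le c).
near=> m; apply: (@le_trans _ _ (\sum_(0 <= k < m) (cmod (a k) * cmod (b k))%:E)%E).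
  rewrite sumEFin lee_fin; apply: le_trans (ler_norm_sum _ _ _) _.
  by apply: ler_sum => k _; apply: le_trans (Re_le_cmod _) _; rewrite cmodM cmodJ.
by apply: nneseries_lim_ge => k _ _; rewrite lee_fin mulr_ge0 ?cmod_ge0.
Unshelve. all: by end_near. Qed.

End l2_sequences.

(** This and the next three are locked copies of notions of the statement: locking keeps unification
    from unfolding them into integrals and series. The real part alone is kept of the inner product,
    since the Hilbert space arguments are real. *)
HB.lock Definition rdot (R : realType) (n : nat) (S : bergman_data R n)
  (f g : cspace R n -> nat -> R[i]) : R := complex.Re (v_dot S f g).

HB.lock Definition vnorm (R : realType) (n : nat) (S : bergman_data R n)
  (f : cspace R n -> nat -> R[i]) : R := v_norm S f.

HB.lock Definition vL2 (R : realType) (n : nat) (S : bergman_data R n)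
  (f : cspace R n -> nat -> R[i]) : Prop := v_L2 S f.

HB.lock Definition vbergman (R : realType) (n : nat) (S : bergman_data R n) :
  set (cspace R n -> nat -> R[i]) := v_bergman S.

Section accessors.
Variables (R : realType) (n : nat) (S : bergman_data R n).
Implicit Types f : cspace R n -> nat -> R[i].

Lemma vnormE : vnorm S = v_norm S.
Proof. by rewrite vnorm.unlock. Qed.

Lemma vbergmanE : vbergman S = v_bergman S.
Proof. by rewrite vbergman.unlock. Qed.

Lemma vL2P f : vL2 S f <-> [/\ forall w, Omega S w -> (l2sqnorm (f w) < +oo)%E,
  forall k, cmeasurable S (fun w => f w k) & (v_sqnorm S f < +oo)%E].
Proof. by rewrite vL2.unlock. Qed.

Lemma vbergmanP f : vbergman S f <-> [/\ forall z, ~ Omega S z -> f z = 0,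
  forall k, analytic S (fun w => f w k) & vL2 S f].
Proof. by rewrite vbergman.unlock vL2.unlock. Qed.

Lemma v_L2_fin f w : vL2 S f -> Omega S w -> (l2sqnorm (f w) < +oo)%E.
Proof. by move=> /vL2P[h _ _] /h. Qed.

Lemma v_L2_cmeasurable f k : vL2 S f -> cmeasurable S (fun w => f w k).
Proof. by move=> /vL2P[]. Qed.

Lemma v_L2_lty f : vL2 S f -> (v_sqnorm S f < +oo)%E.
Proof. by move=> /vL2P[]. Qed.

Lemma v_bergman_out f z : vbergman S f -> ~ Omega S z -> f z = 0.
Proof. by move=> /vbergmanP[h _ _] /h. Qed.

Lemma v_bergman_analytic f k : vbergman S f -> analytic S (fun w => f w k).
Proof. by move=> /vbergmanP[]. Qed.

Lemma v_bergman_L2 f : vbergman S f -> vL2 S f.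
Proof. by move=> /vbergmanP[]. Qed.

End accessors.

Section v_inner_product.
Variables (R : realType) (n : nat) (S : bergman_data R n).
Local Notation X := (cspace R n).
Local Notation BX := (borel_cspace R n).
Local Notation Om := (Omega S).
Local Notation mu := (sigma S).
Local Notation vfun := (X -> nat -> R[i]).
Implicit Types f g h : vfun.
Hypothesis Omo : open Om.

Let mOm : measurable (Om : set BX) := open_borel Omo.

Local Notation rdot := (@rdot R n S).
Local Notation nrm := (vnorm S).

Lemma rdot_Re f g : rdot f g = complex.Re (v_dot S f g).
Proof. by rewrite rdot.unlock. Qed.

Lemma rdotE f g : rdot f g = Rintegral mu (Om : set BX) (fun w => complex.Re (l2dot (f w) (g w))).
Proof. by rewrite rdot_Re. Qed.

Lemma l2sqnorm_measurable f : (forall k, cmeasurable S (fun w => f w k)) ->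
  measurable_fun (Om : set BX) (fun w => l2sqnorm (f w)).
Proof.
move=> mf; apply: ge0_emeasurable_sum => [k w _ _|k _]; first by rewrite lee_fin sqr_ge0.
by apply/measurable_EFinP; exact: cmeasurable_cmod2.
Qed.

Lemma v_L2_measurable f : vL2 S f -> measurable_fun (Om : set BX) (fun w => l2sqnorm (f w)).
Proof. by move=> /vL2P[_ mf _]; exact: l2sqnorm_measurable. Qed.

Lemma v_sqnorm_ge0 f : (0 <= v_sqnorm S f)%E.
Proof. by apply: integral_ge0 => w _; exact: l2sqnorm_ge0. Qed.

Lemma v_sqnorm_fin f : vL2 S f -> v_sqnorm S f \is a fin_num.
Proof. by move=> /vL2P[_ _ h]; rewrite ge0_fin_numE // v_sqnorm_ge0. Qed.

Lemma v_norm_ge0 f : 0 <= nrm f.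
Proof. by rewrite vnorm.unlock sqrtr_ge0. Qed.

Lemma v_norm_sqr f : vL2 S f -> (nrm f ^+ 2)%:E = v_sqnorm S f.
Proof.
by move=> Lf; rewrite vnorm.unlock /v_norm sqr_sqrtr ?fine_ge0 ?v_sqnorm_ge0 // fineK // v_sqnorm_fin.
Qed.

Lemma v_norm_le f (M : R) : vL2 S f -> 0 <= M ->
  (nrm f <= M) <-> (v_sqnorm S f <= (M ^+ 2)%:E)%E.
Proof.
move=> Lf M0; rewrite -v_norm_sqr // lee_fin; split => h.
  by rewrite lerXn2r ?nnegrE // v_norm_ge0.
by rewrite -(@ler_pXn2r _ 2) ?nnegrE // v_norm_ge0.
Qed.

Lemma cmeasurableD (u v : X -> R[i]) : cmeasurable S u -> cmeasurable S v ->
  cmeasurable S (fun w => u w + v w).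
Proof.
move=> [ur ui] [vr vi]; split.
  rewrite (_ : (fun w => _) = (fun w => complex.Re (u w) + complex.Re (v w))).
    exact: measurable_funD.
  by apply/funext => w; rewrite raddfD.
rewrite (_ : (fun w => _) = (fun w => complex.Im (u w) + complex.Im (v w))).
  exact: measurable_funD.
by apply/funext => w; rewrite raddfD.
Qed.

Lemma cmeasurableM (u v : X -> R[i]) : cmeasurable S u -> cmeasurable S v ->
  cmeasurable S (fun w => u w * v w).
Proof.
move=> [ur ui] [vr vi]; split.
  rewrite (_ : (fun w => _) = (fun w => complex.Re (u w) * complex.Re (v w) - complex.Im (u w) * complex.Im (v w))).
    by apply: measurable_funB; exact: measurable_funM.
  by apply/funext => w; case: (u w) (v w) => a b [c d].
rewrite (_ : (fun w => _) = (fun w => complex.Re (u w) * complex.Im (v w) + complex.Im (u w) * complex.Re (v w))).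
  by apply: measurable_funD; exact: measurable_funM.
by apply/funext => w; case: (u w) (v w) => a b [c d].
Qed.

Lemma cmeasurable_cst (c : R[i]) : cmeasurable S (fun=> c).
Proof. by split; exact: measurable_cst. Qed.

Lemma cmeasurable_if (A : set BX) (u v : X -> R[i]) : measurable A ->
  cmeasurable S u -> cmeasurable S v ->
  cmeasurable S (fun w => if `[< A w >] then u w else v w).
Proof.
move=> mA [ur ui] [vr vi].
have mb : measurable_fun (Om : set BX) (fun w => `[< A w >]).
  apply: (measurable_fun_bool true).
  rewrite (_ : _ @^-1` _ = A); first exact: measurableI.
  by apply/seteqP; split => w /=; [move=> /asboolP|move=> ?; apply/asboolP].
split.
  rewrite (_ : (fun w => _) = (fun w => if `[< A w >] then complex.Re (u w) else complex.Re (v w))).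
    by apply: measurable_fun_if => //; apply: (measurable_funS mOm) => //; exact: subIsetl.
  by apply/funext => w; case: ifP.
rewrite (_ : (fun w => _) = (fun w => if `[< A w >] then complex.Im (u w) else complex.Im (v w))).
  by apply: measurable_fun_if => //; apply: (measurable_funS mOm) => //; exact: subIsetl.
by apply/funext => w; case: ifP.
Qed.

Lemma v_L2D f g : vL2 S f -> vL2 S g -> vL2 S (f + g).
Proof.
move=> Lf Lg; have [ff mf If] := (vL2P S _).1 Lf; have [fg mg Ig] := (vL2P S _).1 Lg; apply/vL2P; split.
- by move=> w Ow; apply: l2sqnormD_lty; [exact: ff|exact: fg].
- by move=> k; apply: cmeasurableD.
- apply: (@le_lt_trans _ _ (2%:E * v_sqnorm S f + 2%:E * v_sqnorm S g)%E); last first.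
    by rewrite lte_add_pinfty // lte_mul_pinfty.
  rewrite /v_sqnorm -!ge0_integralZl_EFin //; try by [move=> w _; exact: l2sqnorm_ge0|exact: v_L2_measurable].
  rewrite -ge0_integralD //; try by [move=> w _; rewrite mule_ge0 ?l2sqnorm_ge0|apply: measurable_funeM; exact: v_L2_measurable].
  apply: ge0_le_integral => //.
  + by move=> w _; exact: l2sqnorm_ge0.
  + by apply: l2sqnorm_measurable => k; exact: cmeasurableD.
  + by apply: emeasurable_funD; apply: measurable_funeM; exact: v_L2_measurable.
  + by move=> w _; rewrite -l2sqnorm_parallelogram leeDl // l2sqnorm_ge0.
Qed.

Lemma v_sqnormZ (a : R[i]) f : (forall k, cmeasurable S (fun w => f w k)) ->
  v_sqnorm S (a *: f) = ((cmod a ^+ 2)%:E * v_sqnorm S f)%E.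
Proof.
move=> mf; rewrite /v_sqnorm -ge0_integralZl_EFin ?sqr_ge0 //.
- by apply: eq_integral => w _; rewrite -l2sqnormZ.
- by move=> w _; exact: l2sqnorm_ge0.
- exact: l2sqnorm_measurable.
Qed.

Lemma v_L2Z (a : R[i]) f : vL2 S f -> vL2 S (a *: f).
Proof.
move=> /vL2P[ff mf If]; apply/vL2P; split.
- by move=> w Ow; rewrite -[(a *: f) w]/(a *: f w) l2sqnormZ lte_mul_pinfty // ?lee_fin ?sqr_ge0 ?ff.
- by move=> k; apply: (@cmeasurableM (fun=> a)) => //; exact: cmeasurable_cst.
- by rewrite v_sqnormZ // lte_mul_pinfty // lee_fin sqr_ge0.
Qed.

Lemma v_L2N f : vL2 S f -> vL2 S (- f).
Proof. by rewrite -scaleN1r; exact: v_L2Z. Qed.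

Lemma v_L2B f g : vL2 S f -> vL2 S g -> vL2 S (f - g).
Proof. by move=> Lf Lg; apply: v_L2D => //; exact: v_L2N. Qed.

Lemma v_normZ (a : R[i]) f : vL2 S f -> nrm (a *: f) = cmod a * nrm f.
Proof.
move=> Lf; have [_ mf _] := (vL2P S _).1 Lf; rewrite vnorm.unlock /v_norm v_sqnormZ // fineM // ?v_sqnorm_fin //=.
by rewrite sqrtrM ?sqr_ge0 // sqrtr_sqr ger0_norm // cmod_ge0.
Qed.

(** Polarization again, f + g and f - g being square integrable. *)
Lemma Re_l2dot_integrable f g : vL2 S f -> vL2 S g ->
  mu.-integrable (Om : set BX) (fun w => (complex.Re (l2dot (f w) (g w)))%:E).
Proof.
move=> Lf Lg; have [ff mf If] := (vL2P S _).1 Lf; have [fg mg Ig] := (vL2P S _).1 Lg.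
have int h : vL2 S h -> mu.-integrable (Om : set BX) (fun w => (fine (l2sqnorm (h w)))%:E).
  move=> Lh; have [fh mh Ih] := (vL2P S _).1 Lh.
  apply: (@eq_integrable _ _ _ mu (Om : set BX) mOm (fun w => l2sqnorm (h w))).
    by move=> w /set_mem Ow; rewrite fineK // l2sqnorm_fin // fh.
  apply/integrableP; split; first exact: v_L2_measurable.
  by under eq_integral do rewrite gee0_abs ?l2sqnorm_ge0 //.
apply: (@eq_integrable _ _ _ mu (Om : set BX) mOm (fun w => (4^-1)%:E * ((fine (l2sqnorm ((f + g) w)))%:E - (fine (l2sqnorm ((f - g) w)))%:E))%E).
  move=> w /set_mem Ow; rewrite Re_l2dotE ?ff ?fg // -EFinB -EFinM mulrC //.
apply: integrableZl => //; apply: integrableB => //; apply: int.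
  exact: v_L2D.
exact: v_L2B.
Qed.

Lemma rdotDl f g h : vL2 S f -> vL2 S g -> vL2 S h -> rdot (f + g) h = rdot f h + rdot g h.
Proof.
move=> Lf Lg Lh; rewrite !rdotE -RintegralD //; last 2 first.
- exact: Re_l2dot_integrable.
- exact: Re_l2dot_integrable.
apply: eq_Rintegral => w /set_mem Ow.
have [ff _ _] := (vL2P S _).1 Lf; have [fg _ _] := (vL2P S _).1 Lg; have [fh _ _] := (vL2P S _).1 Lh.
by rewrite -[(f + g) w]/(f w + g w) Re_l2dotDl ?ff ?fg ?fh.
Qed.

Lemma rdotZl (a : R) f g : vL2 S f -> vL2 S g -> rdot (a%:C *: f) g = a * rdot f g.
Proof.
move=> Lf Lg; rewrite !rdotE -RintegralZl //; last exact: Re_l2dot_integrable.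
apply: eq_Rintegral => w /set_mem Ow.
have [ff _ _] := (vL2P S _).1 Lf; have [fg _ _] := (vL2P S _).1 Lg.
by rewrite -[(a%:C *: f) w]/(a%:C *: f w) Re_l2dotZl ?ff ?fg.
Qed.

Lemma rdotC f g : rdot f g = rdot g f.
Proof. by rewrite !rdotE; apply: eq_Rintegral => w _; exact: Re_l2dotC. Qed.

Lemma rdotii f g : rdot ('i *: f) ('i *: g) = rdot f g.
Proof. by rewrite !rdotE; apply: eq_Rintegral => w _; exact: Re_l2dotii. Qed.

Lemma rdot_conj (c : R[i]) f g : rdot (c *: f) g = rdot f ((c^*)%R *: g).
Proof. by rewrite !rdotE; apply: eq_Rintegral => w _; exact: Re_l2dot_conj. Qed.

(** The imaginary part is the real form at - i f. An identity of real forms valid on a complex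
    subspace is therefore an identity of inner products. *)
Lemma v_dotE f g : v_dot S f g = rdot f g +i* rdot ((- 'i) *: f) g.
Proof.
rewrite !rdotE /v_dot /cintegral; congr (_ +i* _).
by apply: eq_Rintegral => w _; exact: Im_l2dotE.
Qed.

Lemma rdot_diag f : vL2 S f -> rdot f f = fine (v_sqnorm S f).
Proof.
move=> Lf; have [ff _ _] := (vL2P S _).1 Lf.
rewrite rdotE /Rintegral; congr fine; apply: eq_integral => w /set_mem Ow.
by rewrite Re_l2dot_diag ?ff // fineK // l2sqnorm_fin // ff.
Qed.

Lemma rdot_le f g : vL2 S f -> vL2 S g ->
  (`|rdot f g|%:E <= \int[mu]_(w in Om) \sum_(0 <= k <oo) (cmod (f w k) * cmod (g w k))%:E)%E.
Proof.
move=> Lf Lg; have [ff mf _] := (vL2P S _).1 Lf; have [fg mg _] := (vL2P S _).1 Lg.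
rewrite rdotE EFin_normr_Rintegral //; last exact: Re_l2dot_integrable.
apply: le_trans (le_abse_integral _ _ _) _ => //.
  by have /integrableP[] := Re_l2dot_integrable Lf Lg.
apply: ge0_le_integral => //.
- apply: measurableT_comp => //; by have /integrableP[] := Re_l2dot_integrable Lf Lg.
- apply: ge0_emeasurable_sum => [k w _ _|k _]; first by rewrite lee_fin mulr_ge0 ?cmod_ge0.
  by apply/measurable_EFinP; apply: measurable_funM; exact: cmeasurable_cmod.
- by move=> w Ow; rewrite /= Re_l2dot_le ?ff ?fg.
Qed.

Lemma v_bergmanD f g : vbergman S f -> vbergman S g -> vbergman S (f + g).
Proof.
move=> /vbergmanP[f0 af Lf] /vbergmanP[g0 ag Lg]; apply/vbergmanP; split; last exact: v_L2D.
- by move=> z nz; rewrite -[(f + g) z]/(f z + g z) f0 // g0 // addr0.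
- by move=> k z Oz; apply: (@differentiableD _ _ _ (fun w => f w k : R[i]^o) (fun w => g w k)); [exact: af|exact: ag].
Qed.

Lemma v_bergmanZ (a : R[i]) f : vbergman S f -> vbergman S (a *: f).
Proof.
move=> /vbergmanP[f0 af Lf]; apply/vbergmanP; split; last exact: v_L2Z.
- by move=> z nz; rewrite -[(a *: f) z]/(a *: f z) f0 // scaler0.
- by move=> k z Oz; apply: (@differentiableZ _ _ _ (fun w => f w k : R[i]^o) a); exact: af.
Qed.

Lemma v_bergmanB f g : vbergman S f -> vbergman S g -> vbergman S (f - g).
Proof.
move=> Bf Bg; have := v_bergmanD Bf (v_bergmanZ (- 1) Bg).
by rewrite scaleN1r.
Qed.

Lemma l2sqnorm0 : l2sqnorm (0 : nat -> R[i]) = 0%E.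
Proof. by apply: eseries0 => k _ _; rewrite (_ : (0 : nat -> R[i]) k = 0) // cmod0 expr0n. Qed.

Lemma v_L2_0 : vL2 S (0 : vfun).
Proof.
have z w : l2sqnorm ((0 : vfun) w) = 0%E by exact: l2sqnorm0.
apply/vL2P; split; first by move=> w _; rewrite z.
  by move=> k; exact: cmeasurable_cst.
by rewrite /v_sqnorm integral0_eq // => w _; exact: z.
Qed.

Lemma v_bergman0 : vbergman S (0 : vfun).
Proof.
apply/vbergmanP; split; [by [] | | exact: v_L2_0].
by move=> k z Oz; exact: (@differentiable_cst _ X (R[i]^o) 0 z).
Qed.

End v_inner_product.

(** * The Bergman space and its reproducing kernel *)

Section near_constant.
Context {K : numFieldType} {V W : normedModType K}.

(** Meant for the constant 1 of the Bergman space: being cut off outside Omega, it is constant only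
    near each point of Omega. *)
Lemma near_cst_differentiable (f : V -> W) (x : V) :
  (\forall y \near x, f y = f x) -> differentiable f x.
Proof.
move=> fx.
have fx0 : \forall y \near (0 : V), f (y + x) = f x.
  by move: fx; rewrite (near_shift 0) /= subr0.
have key : f \o shift x = cst (f x) + (\0 : V -> W) +o_ (0 : V) id.
  apply/eqaddoP => e e0; near=> y.
  rewrite !fctE /= addr0 (_ : f (y + x) = f x); last by near: y.
  by rewrite subrr normr0 mulr_ge0 // ltW.
have d0 : 'd f x = (\0 : V -> W) :> (V -> W).
  by apply: diff_unique => //; exact: cst_continuous.
apply/diff_locallyP; rewrite d0; split => //; exact: cst_continuous.
Unshelve. all: by end_near. Qed.

End near_constant.

Section bergman_space.
Variables (R : realType) (n : nat) (S : bergman_data R n) (HS : bergman_type S).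
Local Notation X := (cspace R n).
Local Notation BX := (borel_cspace R n).
Local Notation Om := (Omega S).
Local Notation vfun := (X -> nat -> R[i]).
Local Notation K := (Defs.kernel S).
Local Notation nK := (normK S).
Local Notation vB := (vbergman S).
Local Notation vL := (vL2 S).
Local Notation rdot := (@rdot R n S).
Local Notation nrm := (vnorm S).

Let Omo : open Om := Omega_open HS.
Let mOm : measurable (Om : set BX) := open_borel Omo.

Lemma l2sqnorm_single (x : R[i]) (j : nat) :
  l2sqnorm (fun k => x * l2basis R j k) = (cmod x ^+ 2)%:E.
Proof.
rewrite /l2sqnorm (nneseriesD1 (n := j)) //; last by move=> k _; rewrite lee_fin sqr_ge0.
rewrite eseries0 ?adde0 /l2basis ?eqxx ?mulr1 // => k _ kj.
by rewrite (negbTE kj) mulr0 cmod0 expr0n.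
Qed.

Definition single (u : X -> R[i]) (j : nat) : vfun := fun w k => u w * l2basis R j k.

Lemma single_L2 u j : cmeasurable S u -> (sc_sqnorm S u < +oo)%E -> vL (single u j).
Proof.
move=> mu_ iu; apply/vL2P; split.
- by move=> w _; rewrite l2sqnorm_single ltry.
- by move=> k; apply: cmeasurableM => //; exact: cmeasurable_cst.
- by rewrite /v_sqnorm; under eq_integral do rewrite l2sqnorm_single.
Qed.

Lemma single_bergman u j : sc_bergman S u -> vB (single u j).
Proof.
move=> [u0 au [mu_ iu]]; apply/vbergmanP; split; last exact: single_L2.
- by move=> z nz; apply/funext => k; rewrite /single u0 // mul0r.
- move=> k z Oz.
  have := @differentiableM _ X (u : X -> R[i]^o) (cst (l2basis R j k)) z (au z Oz)
    (differentiable_cst _ _).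
  exact.
Qed.

Lemma v_norm_single u j : nrm (single u j) = sc_norm S u.
Proof.
by rewrite vnorm.unlock /v_norm /sc_norm /v_sqnorm; under eq_integral do rewrite l2sqnorm_single.
Qed.

(** Pairing with this vector evaluates the coordinate j at z; pointwise values of elements of
    B(Omega) are reached through it. *)
Definition Kv (z : X) (j : nat) : vfun := single (K z) j.

Lemma KvE z j w k : Kv z j w k = K z w * l2basis R j k.
Proof. by []. Qed.

Lemma l2sqnorm_Kv z j w : l2sqnorm (Kv z j w) = (cmod (K z w) ^+ 2)%:E.
Proof. exact: l2sqnorm_single. Qed.

Lemma Kv_bergman z j : Om z -> vB (Kv z j).
Proof. by move=> Oz; apply: single_bergman; exact: (kernel_bergman HS Oz). Qed.

Lemma Kv_norm z j : nrm (Kv z j) = nK z.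
Proof. exact: v_norm_single. Qed.

Lemma v_dot_single F u j : v_dot S F (single u j) = cintegral S (fun w => F w j * (u w)^*).
Proof.
by rewrite /v_dot; congr (cintegral S _); apply/funext => w; rewrite -l2dot_basis.
Qed.

Lemma v_dot_Kv f z j : vB f -> Om z -> v_dot S f (Kv z j) = f z j.
Proof.
move=> Bf Oz; have Bf' := Bf; rewrite vbergman.unlock in Bf'.
rewrite v_dot_single (v_reproducing HS j Oz Bf').
by congr (cintegral S _); apply/funext => w; rewrite mulrC.
Qed.

Lemma rdot_Kv f z j : vB f -> Om z -> rdot f (Kv z j) = complex.Re (f z j).
Proof. by move=> Bf Oz; rewrite rdot_Re v_dot_Kv. Qed.

(** A null vector is orthogonal to the whole space, by first variation. Orthogonality to [Kv z k]
    and to its multiple by i kills the real and imaginary parts of f z k, so f vanishes at every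
    point and not only almost everywhere. *)
Lemma rdot_definite f : vB f -> rdot f f = 0 -> f = 0.
Proof.
move=> Bf f0; have Lf := v_bergman_L2 Bf.
have orth g : vB g -> rdot f g = 0.
  move=> Bg; have Lg := v_bergman_L2 Bg.
  have Lt t : vL (t%:C *: g) := v_L2Z Omo _ Lg.
  have Lft t : vL (f + t%:C *: g) := v_L2D Omo Lf (Lt t).
  have gg : 0 <= rdot g g by rewrite rdot_diag // fine_ge0 // v_sqnorm_ge0.
  apply: (linear_coef_eq0 gg) => t.
  have : 0 <= rdot (f + t%:C *: g) (f + t%:C *: g).
    by rewrite (rdot_diag (Lft t)) fine_ge0 ?v_sqnorm_ge0.
  rewrite (rdotDl Omo Lf (Lt t) (Lft t)) [rdot f (_ + _)]rdotC (rdotDl Omo Lf (Lt t) Lf).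
  rewrite [rdot (_ *: g) (_ + _)]rdotC (rdotDl Omo Lf (Lt t) (Lt t)).
  rewrite (rdotZl Omo t Lg (Lt t)) [rdot f (_ *: _)]rdotC [rdot g (_ *: _)]rdotC.
  rewrite (rdotZl Omo t Lg Lf) (rdotZl Omo t Lg Lg) [rdot g f]rdotC f0.
  move: (rdot f g) (rdot g g) => a b h; apply: le_trans h _.
  by rewrite le_eqVlt; apply/orP; left; apply/eqP; ring.
apply/funext => z; apply/funext => k; have [Oz|nz] := pselect (Om z); last first.
  by rewrite (v_bergman_out Bf nz).
have h1 := orth _ (Kv_bergman k Oz).
have iB : vB ('i *: Kv z k) := v_bergmanZ Omo 'i (Kv_bergman k Oz).
have h2 := orth _ iB.
rewrite rdot_Kv // in h1.
have h3 : rdot ('i *: f) (Kv z k) = 0.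
  rewrite -rdotii scalerA (_ : 'i * 'i = (- 1)%:C); last first.
    by rewrite -[LHS]expr2 sqr_i rmorphN1.
  rewrite rdotZl ?h2 ?mulr0 //; exact: v_bergman_L2.
rewrite (rdot_Kv k (v_bergmanZ Omo 'i Bf) Oz) in h3.
move: h1 h3; rewrite -[('i *: f) z k]/('i * f z k).
by case: (f z k) => x y /=; rewrite mul0r mul1r sub0r => -> /eqP; rewrite oppr_eq0 => /eqP ->.
Qed.

Lemma bergman_hilbert : hilbert_in vL vB rdot nrm.
Proof.
split.
- by move=> f g; exact: v_L2D.
- by move=> a f; exact: v_L2Z.
- by move=> f g h; exact: rdotDl.
- by move=> a f g; exact: rdotZl.
- by move=> f g _ _; exact: rdotC.
- by move=> f Lf; rewrite rdot_diag // fine_ge0 // v_sqnorm_ge0.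
- by move=> f Lf; rewrite vnorm.unlock /v_norm rdot_diag.
- by move=> f; exact: v_bergman_L2.
- exact: v_bergman0.
- by move=> f g; exact: v_bergmanD.
- by move=> a f; exact: v_bergmanZ.
- by rewrite vnorm.unlock vbergman.unlock; exact: (v_bergman_complete HS).
- exact: rdot_definite.
Qed.

Definition one_Om : X -> R[i] := fun w => if `[< Om w >] then 1 else 0.

Lemma one_bergman : sc_bergman S one_Om.
Proof.
have e w : Om w -> one_Om w = 1 by move=> Ow; rewrite /one_Om; case: asboolP.
have an : analytic S one_Om.
  move=> z Oz; apply: near_cst_differentiable; rewrite e //.
  apply: filterS (open_nbhs_nbhs (conj Omo Oz)) => y Oy; exact: e.
split => //; first by move=> z nz; rewrite /one_Om; case: asboolP.
split; first exact: analytic_cmeasurable.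
rewrite /sc_sqnorm (eq_integral (cst 1%E)); last first.
  by move=> w /set_mem Ow; rewrite e // cmod1 expr1n.
by rewrite integral_cst // mul1e ltey_eq fin_num_measure.
Qed.

(** Since sigma is finite, the constant 1 belongs to the space, and 1 = <1, K_z> is at most |1|
    |K_z|. *)
Lemma normK_lower : exists2 c : R, 0 < c & forall z, Om z -> c <= nK z.
Proof.
pose o := single one_Om 0.
have Bo : vB o by apply: single_bergman; exact: one_bergman.
have key z : Om z -> 1 <= nrm o * nK z.
  move=> Oz; have := rdot_Kv 0 Bo Oz.
  rewrite /o /single /one_Om; case: asboolP => // _; rewrite /l2basis eqxx mul1r /= => h.
  rewrite -h -(Kv_norm z 0).
  exact: (dot_le bergman_hilbert (v_bergman_L2 Bo) (v_bergman_L2 (Kv_bergman 0 Oz))).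
have o0 : 0 < nrm o.
  have := key 0 (Omega0 HS); have := v_norm_ge0 S o.
  by rewrite le_eqVlt => /predU1P[<-|//]; rewrite mul0r ler10.
exists (nrm o)^-1 => [|z Oz]; first by rewrite invr_gt0.
by rewrite -[leLHS]mul1r ler_pdivrMr // mulrC; exact: key.
Qed.

Lemma normK_gt0 z : Om z -> 0 < nK z.
Proof. by move=> Oz; have [c c0 h] := normK_lower; exact: lt_le_trans (h z Oz). Qed.

Lemma sc_bergmanZ (a : R[i]) u : sc_bergman S u -> sc_bergman S (fun w => a * u w).
Proof.
move=> [u0 au [mu_ iu]]; split.
- by move=> z nz; rewrite u0 // mulr0.
- by move=> z Oz; exact: (@differentiableZ _ _ _ (u : X -> R[i]^o) a z (au z Oz)).
split; first by apply: (@cmeasurableM _ _ _ (fun=> a)) => //; exact: cmeasurable_cst.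
rewrite /sc_sqnorm (@eq_integral _ BX _ _ _ (fun w : X => (cmod a ^+ 2)%:E * (cmod (u w) ^+ 2)%:E)%E); last first.
  by move=> w _; rewrite cmodM exprMn EFinM.
rewrite ge0_integralZl_EFin ?sqr_ge0 //.
- by rewrite lte_mul_pinfty // lee_fin sqr_ge0.
- by move=> w _; rewrite lee_fin sqr_ge0.
- by apply/measurable_EFinP; exact: cmeasurable_cmod2.
Qed.

Lemma sc_dot_K z w : Om z -> Om w -> sc_dot S (K z) (K w) = K z w.
Proof.
move=> Oz Ow; rewrite (sc_reproducing HS Ow (kernel_bergman HS Oz)).
by congr (cintegral S _); apply/funext => u; rewrite mulrC.
Qed.

Lemma sc_dot_nkernel z w : Om z -> Om w ->
  sc_dot S (nkernel S z) (nkernel S w) = K z w / (nK z * nK w)%:C.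
Proof.
move=> Oz Ow; pose a : R[i] := ((nK z * nK w)%:C)^-1.
rewrite [RHS]mulrC -/a.
rewrite (sc_reproducing HS Ow (sc_bergmanZ a (kernel_bergman HS Oz))).
have cj (x : R[i]) (r : R) : ((x / r%:C)^*)%R = x^* / r%:C.
  rewrite -[LHS]/(conjc _) -[(x^*)%R]/(conjc _) -[r%:C^-1](fmorphV (real_complex R)) /=.
  by case: x => x y; apply/eqP; rewrite eq_complex /=; apply/andP; split; apply/eqP; ring.
congr (cintegral S _); apply/funext => u; rewrite /nkernel cj /a rmorphM /= invfM; ring.
Qed.

(** The modulus of <k_z, k_w> is |k_z(w)| / |K_w|, so (A.5) is a two-sided bound on |k_z(w)|. In
    particular k_z has no zero in Omega. *)
Lemma nkernel_mod : exists2 C : R, 0 < C & forall z w, Om z -> Om w ->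
  cmod (nkernel S z w) <= C * (nK w / nK (phi S z w)) /\
  nK w / nK (phi S z w) <= C * cmod (nkernel S z w).
Proof.
have [C C0 h] := nkernel_dot HS; exists C => // z w Oz Ow.
have [h1 h2] := h z w Oz Ow.
have e : cmod (sc_dot S (nkernel S z) (nkernel S w)) = cmod (nkernel S z w) / nK w.
  rewrite sc_dot_nkernel // /nkernel !cmodM !cmodV !cmodR.
  by rewrite !gtr0_norm ?mulr_gt0 ?normK_gt0 // invfM; ring.
have nw := normK_gt0 Ow; rewrite e in h1 h2.
split; first by rewrite mulrCA -ler_pdivrMl // mulrC.
by move: h2; rewrite -(ler_pM2l nw) mulrCA [nK w * (_ / _)]mulrCA mulfV ?gt_eqF // mulr1.
Qed.

Lemma dense_dsequence : exists a : nat -> X, (forall j, Om (a j)) /\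
  forall z (r : R), Om z -> 0 < r -> exists j, dist S z (a j) < r.
Proof.
have [D [/countable_injP[f finj] DO Dd]] := dist_separable HS.
pose a j := xget (0 : X) [set x | D x /\ f x = j].
exists a; split => [j|z r Oz r0].
  by rewrite /a; case: xgetP => [x -> [Dx _]|_]; [exact: DO|exact: Omega0 HS].
have [x Dx zx] := Dd z r Oz r0; exists (f x).
suff -> : a (f x) = x by [].
rewrite /a; case: xgetP => [y -> [Dy yx]|/(_ x)]; last by case.
by apply: finj; rewrite ?inE.
Qed.

(** The metric and the topology of C^n are linked here only through Borel measurability of balls. By
    separability a d-open set is the union of the balls it contains among those with center in a
    dense sequence and radius 1/(k+1). *)
Lemma dball_open_borel (A : set X) : dopen S A -> measurable (A : set BX).
Proof.
move=> [AO Ao]; have [a [aO ad]] := dense_dsequence.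
have [_ _ dC dT] := dist_metric HS.
rewrite (_ : A = \bigcup_j \bigcup_(k : nat) (if `[< dball S (a j) k.+1%:R^-1 `<=` A >] then dball S (a j) k.+1%:R^-1 else set0)).
  apply: bigcupT_measurable => j; apply: bigcupT_measurable => k.
  by case: asboolP => // _; exact: (dball_borel HS).
apply/seteqP; split => [z Az|z [j _ [k _]]]; last by case: asboolP => // h; exact: h.
have [r r0 rA] := Ao z Az; have Oz := AO z Az.
pose k := Num.trunc (r / 2)^-1.
have kr : k.+1%:R^-1 < r / 2 :> R by rewrite invf_plt ?posrE ?divr_gt0 // truncnS_gt.
have k0 : 0 < k.+1%:R^-1 :> R by rewrite invr_gt0.
have [j zx] := ad z _ Oz k0; have Ox := aO j.
exists j => //; exists k => //; case: asboolP => [_|[]].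
  by split => //; rewrite dC.
move=> w [Ow xw]; apply: rA; split => //; apply: le_lt_trans (dT z (a j) w Oz Ox Ow) _.
by move: (k.+1%:R^-1) kr zx xw => e; lra.
Qed.

Lemma normK_measurable : measurable_fun (Om : set BX) nK.
Proof.
apply: measurable_fun_gtP => a; apply: dball_open_borel; split; first by move=> z [].
move=> z [Oz az]; have e0 : 0 < nK z - a by rewrite subr_gt0.
have [r r0 h] := normK_continuous HS Oz e0; exists r => // w Bw; split; first by case: Bw.
by have := h w Bw; rewrite ltr_norml => /andP[h1 _]; rewrite /=; lra.
Qed.

End bergman_space.

Global Opaque Kv single.

(** * Translations *)

Section translations.
Variables (R : realType) (n : nat) (S : bergman_data R n) (HS : bergman_type S).
Local Notation X := (cspace R n).
Local Notation BX := (borel_cspace R n).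
Local Notation Om := (Omega S).
Local Notation mu := (sigma S).
Local Notation vfun := (X -> nat -> R[i]).
Local Notation K := (Defs.kernel S).
Local Notation nK := (normK S).
Local Notation vB := (vbergman S).
Local Notation vL := (vL2 S).
Local Notation nrm := (vnorm S).
Local Notation phi := (phi S).

Let Omo : open Om := Omega_open HS.
Let mOm : measurable (Om : set BX) := open_borel Omo.

Lemma phi_cvg z w : Om z -> Om w -> phi z x @[x --> w] --> phi z w.
Proof. by move=> Oz Ow; exact: differentiable_continuous (phi_holomorphic HS Oz Ow). Qed.

Lemma phi_measurable z : Om z -> measurable_fun (Om : set BX) (phi z : BX -> BX).
Proof.
move=> Oz; apply: (@measurability _ _ BX BX Om (phi z) (@open X)) => // _ [U oU <-]; apply: open_borel.
rewrite openE => w [Ow Uw]; apply: filterI; first exact: open_nbhs_nbhs.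
by apply: (phi_cvg Oz Ow); exact: open_nbhs_nbhs.
Qed.

Lemma phi_image z (A : set X) : Om z -> A `<=` Om -> phi z @` A = Om `&` phi z @^-1` A.
Proof.
move=> Oz AO; apply/seteqP; split => [_ [w Aw <-]|w [Ow Aw]].
  by split; [exact: phi_Omega HS _ _ Oz (AO _ Aw)|rewrite /= (phi_involution HS) //; exact: AO].
by exists (phi z w) => //; rewrite (phi_involution HS).
Qed.

Lemma normK2_measurable : measurable_fun (Om : set BX) (fun w => nK w ^+ 2).
Proof. by apply: measurable_funX; exact: normK_measurable. Qed.

(** Quasi-invariance of lambda, extended from sets to functions; the image of A under the involution
    phi_z is its preimage in Omega. *)
Lemma change_of_variable : exists2 C : R, 0 < C & forall z (g : X -> \bar R), Om z ->
  measurable_fun (Om : set BX) g -> (forall w, Om w -> (0 <= g w)%E) ->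
  (\int[mu]_(w in Om) (g (phi z w) * (nK w ^+ 2)%:E) <=
   C%:E * \int[mu]_(w in Om) (g w * (nK w ^+ 2)%:E))%E.
Proof.
have [C C0 h] := lambda_invariant HS; exists C => // z g Oz mg g0.
apply: (@integral_comp_le _ BX R mu Om (fun w => nK w ^+ 2) (phi z)) => //.
- exact: normK2_measurable.
- by move=> w _; exact: sqr_ge0.
- exact: ltW.
- by move=> w; exact: (phi_Omega HS).
- exact: phi_measurable.
move=> A mA AO; have [_] := h z A Oz mA AO.
by rewrite /lambda phi_image.
Qed.

(** Quasi-invariance of the metric at the pair (w, z), because phi_z(z) = phi_z(phi_z(0)) = 0. *)
Lemma dist_phi : exists2 C : R, 0 < C & forall z w, Om z -> Om w ->
  dist S w z <= C * dist S (phi z w) 0 /\ dist S (phi z w) 0 <= C * dist S w z.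
Proof.
have [C C0 h] := dist_invariant HS; exists C => // z w Oz Ow.
have := h z w z Oz Ow Oz.
suff -> : phi z z = 0 by [].
by rewrite -{2}(phi0 HS Oz) (phi_involution HS) //; exact: Omega0 HS.
Qed.

Lemma nkernel_neq0 z w : Om z -> Om w -> nkernel S z w != 0.
Proof.
move=> Oz Ow; have [C C0 h] := nkernel_mod HS; have [_ h2] := h z w Oz Ow.
apply/eqP => k0; rewrite k0 cmod0 mulr0 in h2.
have : 0 < nK w / nK (phi z w).
  by rewrite divr_gt0 ?(normK_gt0 HS) //; exact: (phi_Omega HS).
by rewrite ltNge h2.
Qed.

Lemma nkernel_analytic z : Om z -> analytic S (nkernel S z).
Proof.
move=> Oz w Ow; have [_ aK _] := kernel_bergman HS Oz.
rewrite /nkernel.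
have := @differentiableM _ X (K z : X -> R[i]^o) (cst ((nK z)%:C^-1)) w (aK w Ow) (differentiable_cst _ _).
exact.
Qed.

Lemma comp_analytic u z : Om z -> analytic S u -> analytic S (fun w => u (phi z w)).
Proof.
move=> Oz au w Ow.
apply: (@differentiable_comp _ X X (R[i]^o) (phi z) u); first exact: (phi_holomorphic HS).
by apply: au; exact: (phi_Omega HS).
Qed.

Lemma mul_analytic u v : analytic S u -> analytic S v -> analytic S (fun w => u w * v w).
Proof. by move=> au av w Ow; exact: (@differentiableM _ X (u : X -> R[i]^o) v w (au w Ow) (av w Ow)). Qed.

(* U_z and its inverse are both of this form, with |m| comparable to |k_z| *)
Definition weighted_comp (z : X) (m : X -> R[i]) (f : vfun) : vfun :=
  fun w k => f (phi z w) k * m w.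

Lemma weighted_comp_analytic z m f k : Om z -> analytic S m ->
  (forall k, analytic S (fun w => f w k)) -> analytic S (fun w => weighted_comp z m f w k).
Proof. by move=> Oz am af; apply: mul_analytic => //; exact: comp_analytic (af k). Qed.

Lemma l2sqnorm_weighted_comp z m f w :
  l2sqnorm (weighted_comp z m f w) = ((cmod (m w) ^+ 2)%:E * l2sqnorm (f (phi z w)))%E.
Proof.
rewrite -l2sqnormZ; congr l2sqnorm; apply/funext => k.
by rewrite -[RHS]/(m w * _) mulrC.
Qed.

(** The bound on m says that |m|^2 dsigma is at most C0^2 |K_{phi_z(w)}|^-2 dlambda(w), and the
    substitution phi_z turns |K|^-2 dlambda back into dsigma. Keeping the set A records where the
    mass comes from, which the localization near infinity relies on. *)
Lemma weighted_comp_bound (C0 : R) : 0 < C0 -> exists2 C : R, 0 < C &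
  forall z (m : X -> R[i]) f (A : set X), Om z -> analytic S m ->
   (forall w, Om w -> cmod (m w) <= C0 * (nK w / nK (phi z w))) ->
   vL f -> (forall k, analytic S (fun w => f w k)) ->
   measurable (A : set BX) -> A `<=` Om ->
   (\int[mu]_(w in A) l2sqnorm (weighted_comp z m f w) <=
     (C ^+ 2)%:E * \int[mu]_(w in Om `&` phi z @^-1` A) l2sqnorm (f w))%E.
Proof.
move=> C00; have [C1 C10 h] := change_of_variable.
exists (C0 * Num.sqrt C1); first by rewrite mulr_gt0 // sqrtr_gt0.
move=> z m f A Oz am hm Lf af mA AO.
have mf := v_L2_measurable Lf.
have mn2 := normK2_measurable.
have mP : measurable (Om `&` phi z @^-1` A : set BX) by exact: phi_measurable.
(* The density of |f|^2 dsigma with respect to lambda; g restricts it to phi_z(A). *)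
pose g0 w := (l2sqnorm (f w) * ((nK w ^+ 2)^-1)%:E)%E.
pose g := g0 \_ (phi z @^-1` A).
have mg0 : measurable_fun (Om : set BX) g0.
  apply: emeasurable_funM => //; apply/measurable_EFinP; apply: measurable_fun_inv => //.
  by move=> w Ow; rewrite exprn_gt0 // (normK_gt0 HS).
have gE w : Om w -> g w = (g0 \_ (Om `&` phi z @^-1` A)) w.
  by move=> Ow; rewrite /g !patchE in_setI (mem_set Ow).
have mg : measurable_fun (Om : set BX) g.
  apply: (@eq_measurable_fun _ _ BX _ _ (g0 \_ (Om `&` phi z @^-1` A))).
    by move=> w /set_mem Ow; rewrite gE.
  apply: (iffLR (@measurable_restrict _ _ BX _ (Om `&` phi z @^-1` A) Om g0 mP mOm)).
  by apply: measurable_funS mg0 => // w [].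

have g0_ge0 w : (0 <= g0 w)%E.
  by rewrite mule_ge0 ?l2sqnorm_ge0 // lee_fin invr_ge0 sqr_ge0.
have g_ge0 w : (0 <= g w)%E by rewrite /g patchE; case: ifP.
have := h z g Oz mg (fun w _ => g_ge0 w).
rewrite [X in (_ <= _ * X)%E -> _](_ : _ = \int[mu]_(w in Om `&` phi z @^-1` A) l2sqnorm (f w))%E; last first.
  rewrite integral_mkcondr; apply: eq_integral => w /set_mem Ow.
  rewrite /g !patchE; case: ifP => _; last by rewrite mul0e.
  rewrite /g0 -muleA -EFinM mulVf ?mule1 //.
  by rewrite expf_neq0 // gt_eqF // (normK_gt0 HS).
move=> h1; rewrite exprMn sqr_sqrtr ?(ltW C10) // EFinM -muleA.
apply: (@le_trans _ _ ((C0 ^+ 2)%:E * \int[mu]_(w in Om) (g (phi z w) * (nK w ^+ 2)%:E))%E); last first.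
  by apply: lee_wpmul2l => //; rewrite lee_fin sqr_ge0.
have mgc : measurable_fun (Om : set BX) (fun w => g (phi z w) * (nK w ^+ 2)%:E)%E.
  apply: emeasurable_funM; last exact/measurable_EFinP.
  apply: (@measurable_comp _ _ _ BX BX _ Om g _ (phi z)) => //.
    by move=> _ [w Ow <-]; exact: (phi_Omega HS).
  exact: phi_measurable.
have gc0 w : (0 <= g (phi z w) * (nK w ^+ 2)%:E)%E.
  by rewrite mule_ge0 // lee_fin sqr_ge0.
apply: (@le_trans _ _ ((C0 ^+ 2)%:E * \int[mu]_(w in A) (g (phi z w) * (nK w ^+ 2)%:E))%E); last first.
  apply: lee_wpmul2l; first by rewrite lee_fin sqr_ge0.
  exact: ge0_subset_integral.
have mgcA := measurable_funS mOm AO mgc.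
rewrite -ge0_integralZl_EFin ?sqr_ge0 //.
apply: ge0_le_integral => //.
- by move=> w _; exact: l2sqnorm_ge0.
- apply: (measurable_funS mOm AO); apply: l2sqnorm_measurable => // k.
  by apply: analytic_cmeasurable => //; exact: weighted_comp_analytic.
- exact: measurable_funeM.
move=> w Aw; have Ow := AO w Aw; have Ophi := phi_Omega HS Oz Ow.
rewrite l2sqnorm_weighted_comp /g patchE.
rewrite -[X in if X then _ else _]/(phi z (phi z w) \in A) (phi_involution HS) // (mem_set Aw).
rewrite (_ : _ * (g0 _ * _) = l2sqnorm (f (phi z w)) *
  (C0 ^+ 2 * ((nK (phi z w) ^+ 2)^-1 * nK w ^+ 2))%:E)%E; last first.
  rewrite /g0; move: (C0 ^+ 2) ((nK (phi z w) ^+ 2)^-1) (nK w ^+ 2) (l2sqnorm _) => a b c L.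
  by rewrite !EFinM [RHS]muleCA muleA muleA [in RHS]muleA muleA.
rewrite muleC; apply: lee_wpmul2l; first exact: l2sqnorm_ge0.
rewrite lee_fin.
have h0 := hm w Ow.
rewrite (_ : _ * (_ * _) = (C0 * (nK w / nK (phi z w))) ^+ 2); last by rewrite !exprMn exprVn; ring.
by rewrite lerXn2r // nnegrE ?cmod_ge0 //; exact: le_trans (cmod_ge0 _) h0.
Qed.

Lemma phi_preOm z : Om z -> Om `&` phi z @^-1` Om = Om.
Proof.
move=> Oz; apply/seteqP; split => [w []//|w Ow]; split => //; exact: (phi_Omega HS).
Qed.

Lemma weighted_comp_bergman z m f : Om z -> analytic S m -> (forall w, ~ Om w -> m w = 0) ->
  vB f -> (v_sqnorm S (weighted_comp z m f) < +oo)%E -> vB (weighted_comp z m f).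
Proof.
move=> Oz am m0 Bf fin; have Lf := v_bergman_L2 Bf.
have af k : analytic S (fun w => weighted_comp z m f w k).
  by apply: weighted_comp_analytic => // j; exact: v_bergman_analytic.
apply/vbergmanP; split => //.
- by move=> w nw; apply/funext => k; rewrite /weighted_comp m0 // mulr0.
apply/vL2P; split => // [w Ow|k]; last exact: analytic_cmeasurable.
rewrite l2sqnorm_weighted_comp lte_mul_pinfty ?lee_fin ?sqr_ge0 //.
by apply: (v_L2_fin Lf); exact: (phi_Omega HS).
Qed.

Lemma weighted_comp_bounded (C0 : R) : 0 < C0 -> exists2 C : R, 0 < C &
  forall z (m : X -> R[i]) f, Om z -> analytic S m ->
   (forall w, Om w -> cmod (m w) <= C0 * (nK w / nK (phi z w))) ->
   (forall w, ~ Om w -> m w = 0) -> vB f ->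
  [/\ vB (weighted_comp z m f), nrm (weighted_comp z m f) <= C * nrm f &
   forall A : set X, measurable (A : set BX) -> A `<=` Om ->
   (\int[mu]_(w in A) l2sqnorm (weighted_comp z m f w) <=
     (C ^+ 2)%:E * \int[mu]_(w in Om `&` phi z @^-1` A) l2sqnorm (f w))%E].
Proof.
move=> C00; have [C C1 h] := weighted_comp_bound C00.
exists C => // z m f Oz am hm m0 Bf; have Lf := v_bergman_L2 Bf.
have af k : analytic S (fun w => f w k) := v_bergman_analytic k Bf.
have b : (v_sqnorm S (weighted_comp z m f) <= (C ^+ 2)%:E * v_sqnorm S f)%E.
  have := h z m f Om Oz am hm Lf af mOm (@subset_refl _ Om).
  by rewrite phi_preOm.
have BU : vB (weighted_comp z m f).
  apply: weighted_comp_bergman => //.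
  by apply: le_lt_trans b _; rewrite lte_mul_pinfty ?lee_fin ?sqr_ge0 // (v_L2_lty Lf).
split => //; last by move=> A mA AO; exact: h.
apply/(v_norm_le (v_bergman_L2 BU)); first by rewrite mulr_ge0 ?v_norm_ge0 ?ltW.
by rewrite exprMn EFinM v_norm_sqr.
Qed.

(** On Omega the weight is 1 / k_z(phi_z(w)); the factor k_z(w) above and below the bar cancels
    there and makes the weight vanish outside Omega. *)
Definition translation_inv (z : X) (f : vfun) : vfun :=
  weighted_comp z (fun w => nkernel S z w / (nkernel S z w * nkernel S z (phi z w))) f.

Lemma nkernel_out z w : Om z -> ~ Om w -> nkernel S z w = 0.
Proof. by move=> Oz nw; have [K0 _ _] := kernel_bergman HS Oz; rewrite /nkernel K0 // mul0r. Qed.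

Lemma translation_invE z f w k : translation_inv z f w k =
  f (phi z w) k * (nkernel S z w / (nkernel S z w * nkernel S z (phi z w))).
Proof. by []. Qed.

Lemma translation_bounded : exists2 C : R, 0 < C & forall z f, Om z -> vB f ->
  vB (translation S z f) /\ nrm (translation S z f) <= C * nrm f.
Proof.
have [C0 C00 hk] := nkernel_mod HS; have [C C1 h] := weighted_comp_bounded C00.
exists C => // z f Oz Bf.
have [//||||BU bU _] := h z (nkernel S z) f Oz; last by split.
- exact: nkernel_analytic.
- by move=> w Ow; exact: (hk z w Oz Ow).1.
- by move=> w; exact: nkernel_out.
- exact: Bf.
Qed.

Lemma inv_analytic u : analytic S u -> (forall w, Om w -> u w != 0) -> analytic S (fun w => (u w)^-1).
Proof. by move=> au u0 w Ow; exact: (@differentiableV _ X (u : X -> R[i]^o) w (au w Ow) (u0 w Ow)). Qed.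

(** The lower bound of [nkernel_mod] at phi_z(w) gives 1 / |k_z(phi_z(w))| <= C0 |K_w| /
    |K_{phi_z(w)}|, the same bound as for the weight k_z of U_z. *)
Lemma translation_inv_bounded : exists2 C : R, 0 < C & forall z f, Om z -> vB f ->
  [/\ vB (translation_inv z f), nrm (translation_inv z f) <= C * nrm f &
   forall A : set X, measurable (A : set BX) -> A `<=` Om ->
   (\int[mu]_(w in A) l2sqnorm (translation_inv z f w) <=
     (C ^+ 2)%:E * \int[mu]_(w in Om `&` phi z @^-1` A) l2sqnorm (f w))%E].
Proof.
have [C0 C00 hk] := nkernel_mod HS; have [C C1 h] := weighted_comp_bounded C00.
exists C => // z f Oz Bf; apply: (h z _ f Oz _ _ _ Bf).
- apply: mul_analytic; first exact: nkernel_analytic.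
  apply: inv_analytic => [|w Ow].
    apply: mul_analytic; first exact: nkernel_analytic.
    by apply: comp_analytic => //; exact: nkernel_analytic.
  by rewrite mulf_neq0 // nkernel_neq0 //; exact: (phi_Omega HS).
- move=> w Ow; have Op := phi_Omega HS Oz Ow.
  have h1 := nkernel_neq0 Oz Ow; have h2 := nkernel_neq0 Oz Op.
  rewrite (_ : _ / _ = (nkernel S z (phi z w))^-1); last first.
    by rewrite invfM mulrA mulfV // mul1r.
  rewrite cmodV; have [_] := hk z (phi z w) Oz Op; rewrite (phi_involution HS) // => h3.
  have n1 := normK_gt0 HS Ow; have n2 := normK_gt0 HS Op.
  rewrite -[leLHS]div1r ler_pdivrMr ?cmod_gt0 //.
  have := h3; rewrite -(ler_pM2l (divr_gt0 n1 n2)) => h4.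
  apply: le_trans (_ : nK w / nK (phi z w) * (nK (phi z w) / nK w) <= _).
    by rewrite mulrA mulfVK ?gt_eqF // mulfV // gt_eqF.
  by apply: le_trans h4 _; rewrite le_eqVlt; apply/orP; left; apply/eqP; ring.
- by move=> w nw; rewrite nkernel_out // mul0r.
Qed.

Lemma translation_invK z f : Om z -> vB f -> translation_inv z (translation S z f) = f.
Proof.
move=> Oz Bf; apply/funext => w; apply/funext => k.
rewrite /translation_inv /weighted_comp /translation.
have [Ow|nw] := pselect (Om w); last first.
  by rewrite (nkernel_out Oz nw) !mul0r mulr0 (v_bergman_out Bf nw).
rewrite (phi_involution HS) //.
have h1 := nkernel_neq0 Oz Ow; have h2 := nkernel_neq0 Oz (phi_Omega HS Oz Ow).
by field; rewrite h1 h2.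
Qed.

End translations.

Global Opaque translation_inv weighted_comp.

(** * Projection, bounded operators and adjoints *)

Section operators.
Variables (R : realType) (n : nat) (S : bergman_data R n) (HS : bergman_type S).
Local Notation X := (cspace R n).
Local Notation Om := (Omega S).
Local Notation mu := (sigma S).
Local Notation vfun := (X -> nat -> R[i]).
Local Notation nK := (normK S).
Local Notation vB := (vbergman S).
Local Notation vL := (vL2 S).
Local Notation rdot := (@rdot R n S).
Local Notation nrm := (vnorm S).
Local Notation phi := (phi S).
Local Notation Kv := (Kv S).
Implicit Types f g h : vfun.

Let Omo : open Om := Omega_open HS.
Let H := bergman_hilbert HS.
Let BL f : vB f -> vL f := @v_bergman_L2 R n S f.

Lemma v_dot_conj f g : vL f -> vL g -> v_dot S f g = ((v_dot S g f)^*)%R.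
Proof.
move=> Lf Lg; rewrite !v_dotE -[RHS]/(conjc _) /= [rdot g f]rdotC; congr (_ +i* _).
rewrite rdot_conj rdotC -[(- 'i)^*%R]/(conjc (- 'i)) /= oppr0 opprK scaleNr -scaleN1c.
by rewrite (rdotZl Omo _ (v_L2Z Omo _ Lg) Lf) mulN1r opprK.
Qed.

(** The phase of f z k is absorbed in c, so that moduli of values can be estimated through the real
    form alone. *)
Lemma eval_cmod f z k : vB f -> Om z ->
  exists2 c : R[i], cmod c = 1 & cmod (f z k) = rdot f (c *: Kv z k).
Proof.
move=> Bf Oz; have [c c1 ce] := unimodular_Re (f z k).
exists (c^*)%R; first by rewrite -[(c^*)%R]/(conjc c) cmodJ.
by rewrite -rdot_conj (rdot_Kv HS k (v_bergmanZ Omo c Bf) Oz).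
Qed.

Lemma kvecE z i : kvec S z (l2basis R i) = ((nK z)^-1)%:C *: Kv z i.
Proof.
apply/funext => w; apply/funext => k; rewrite /kvec /nkernel.
rewrite -[RHS]/(((nK z)^-1)%:C * (_ * _)) -[((nK z)%:C)^-1](fmorphV (real_complex R)) /=.
by rewrite mulrA [_ * Defs.kernel _ _ _]mulrC.
Qed.

(** The orthogonal projection of L^2 onto B(Omega), given by its pairings with B(Omega); the default
    value of [xget] never occurs when F is square integrable. *)
Definition proj F : vfun := xget 0 [set h | vB h /\ forall f, vB f -> rdot f h = rdot f F].

Lemma projP F : vL F -> vB (proj F) /\ forall f, vB f -> rdot f (proj F) = rdot f F.
Proof.
move=> LF; rewrite /proj; case: xgetP => [h -> //|] /=.
have [|||h Bh hP] := @riesz _ _ _ _ _ _ H (fun f => rdot f F) (nrm F).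
- by move=> f g /BL Lf /BL Lg; rewrite (dotDl H).
- by move=> a f /BL Lf; rewrite (dotZl H).
- by move=> f /BL Lf; rewrite mulrC; exact: cauchy_schwarz H _ _ Lf LF.
by move=> /(_ h) []; split => // f Bf; rewrite hP.
Qed.

Opaque proj.

Lemma proj_bergman F : vL F -> vB (proj F).
Proof. by move=> /projP[]. Qed.

Lemma proj_dot F f : vL F -> vB f -> rdot f (proj F) = rdot f F.
Proof. by move=> /projP[_]; exact. Qed.

Lemma proj_eq F h : vL F -> vB h -> (forall f, vB f -> rdot f h = rdot f F) -> proj F = h.
Proof.
move=> LF Bh hP; apply: (dot_inj H (proj_bergman LF) Bh) => f Bf.
by rewrite proj_dot // hP.
Qed.

Lemma proj_id f : vB f -> proj f = f.
Proof. by move=> Bf; apply: proj_eq => //; exact: BL. Qed.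

Lemma projD F G : vL F -> vL G -> proj (F + G) = proj F + proj G.
Proof.
move=> LF LG; have BF := proj_bergman LF; have BG := proj_bergman LG.
apply: (proj_eq (v_L2D Omo LF LG) (v_bergmanD Omo BF BG)) => f Bf.
rewrite (dotDr H (BL BF) (BL BG) (BL Bf)) (dotDr H LF LG (BL Bf)).
by rewrite (proj_dot LF Bf) (proj_dot LG Bf).
Qed.

Lemma projZ (a : R[i]) F : vL F -> proj (a *: F) = a *: proj F.
Proof.
move=> LF; have BF := proj_bergman LF.
apply: (proj_eq (v_L2Z Omo _ LF) (v_bergmanZ Omo _ BF)) => f Bf.
have e (y : vfun) : rdot f (a *: y) = rdot ((a^*)%R *: f) y by rewrite rdot_conj conjCK.
by rewrite !e (proj_dot LF (v_bergmanZ Omo _ Bf)).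
Qed.

Lemma projB F G : vL F -> vL G -> proj (F - G) = proj F - proj G.
Proof.
move=> LF LG; rewrite -(scaleN1r G) (projD LF (v_L2Z Omo _ LG)) (projZ _ LG).
by rewrite scaleN1r.
Qed.

Lemma nrm_proj F : vL F -> nrm (proj F) <= nrm F.
Proof.
move=> LF; have BF := proj_bergman LF.
have [->|n0] := eqVneq (nrm (proj F)) 0; first exact: v_norm_ge0.
have np : 0 < nrm (proj F) by rewrite lt_neqAle eq_sym n0 v_norm_ge0.
rewrite -(ler_pM2l np) -expr2 (nrm_sqr H (BL BF)) proj_dot //.
exact: dot_le H _ _ (BL BF) LF.
Qed.

Section bounded_operator.
Variables (T : vfun -> vfun) (bT : bounded_operator S T).

Lemma opB f : vB f -> vB (T f).
Proof. by have [h _ _] := bT; rewrite vbergmanE; exact: h. Qed.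

Lemma op_lin (a : R[i]) f g : vB f -> vB g -> T (a *: f + g) = a *: T f + T g.
Proof. by have [_ h _] := bT; rewrite vbergmanE; exact: h. Qed.

Lemma opD f g : vB f -> vB g -> T (f + g) = T f + T g.
Proof. by move=> Bf Bg; have := op_lin 1 Bf Bg; rewrite !scale1r. Qed.

Lemma op0 : T 0 = 0.
Proof.
have B0 := v_bergman0 S; have := opD B0 B0; rewrite addr0 => e.
by apply: (addrI (T 0)); rewrite addr0 -e.
Qed.

Lemma opZ (a : R[i]) f : vB f -> T (a *: f) = a *: T f.
Proof. by move=> Bf; have := op_lin a Bf (v_bergman0 S); rewrite op0 !addr0. Qed.

Lemma opBB f g : vB f -> vB g -> T (f - g) = T f - T g.
Proof.
move=> Bf Bg; rewrite -(scaleN1r g) (opD Bf (v_bergmanZ Omo _ Bg)) (opZ _ Bg).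
by rewrite scaleN1r.
Qed.

Lemma op_bound : exists2 M : R, 0 < M & forall f, vB f -> nrm (T f) <= M * nrm f.
Proof.
have [_ _ [M hM]] := bT; rewrite vnormE vbergmanE; exists (`|M| + 1); first by rewrite ltr_wpDl.
move=> f Bf; apply: le_trans (hM f Bf) _; apply: ler_wpM2r; first exact: sqrtr_ge0.
by rewrite (le_trans (ler_norm M)) // lerDl.
Qed.

(** The Riesz theorem gives the identity of real parts; at - i f it becomes that of imaginary
    parts. *)
Lemma adjointP g : vB g -> vB (adjoint S T g) /\
  forall f, vB f -> v_dot S (T f) g = v_dot S f (adjoint S T g).
Proof.
move=> Bg; rewrite /adjoint vbergmanE; case: xgetP => [h -> //|] /=; rewrite -vbergmanE.
have [M M0 hM] := op_bound.
have [|||h Bh hP] := @riesz _ _ _ _ _ _ H (fun f => rdot (T f) g) (M * nrm g).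
- by move=> f f' Bf Bf'; rewrite (opD Bf Bf') (dotDl H (BL (opB Bf)) (BL (opB Bf')) (BL Bg)).
- by move=> a f Bf; rewrite (opZ _ Bf) (dotZl H _ (BL (opB Bf)) (BL Bg)).
- move=> f Bf; apply: le_trans (cauchy_schwarz H (BL (opB Bf)) (BL Bg)) _.
  by rewrite mulrAC; apply: ler_wpM2r; [exact: v_norm_ge0|exact: hM].
move=> /(_ h) []; split => // f Bf; rewrite !v_dotE (hP _ Bf); congr (_ +i* _).
by rewrite -(hP _ (v_bergmanZ Omo _ Bf)) (opZ _ Bf).
Qed.

Opaque adjoint.

Lemma adjoint_bergman g : vB g -> vB (adjoint S T g).
Proof. by move=> /adjointP[]. Qed.

Lemma adjoint_rdot f g : vB f -> vB g -> rdot (T f) g = rdot f (adjoint S T g).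
Proof. by move=> Bf /adjointP[_ h]; rewrite !rdot_Re (h _ Bf). Qed.

Lemma adjoint_eq g h : vB g -> vB h -> (forall f, vB f -> rdot (T f) g = rdot f h) ->
  adjoint S T g = h.
Proof.
move=> Bg Bh hP; apply: (dot_inj H (adjoint_bergman Bg) Bh) => f Bf.
by rewrite -(adjoint_rdot Bf Bg) (hP _ Bf).
Qed.

Lemma adjointD f g : vB f -> vB g -> adjoint S T (f + g) = adjoint S T f + adjoint S T g.
Proof.
move=> Bf Bg; have Af := adjoint_bergman Bf; have Ag := adjoint_bergman Bg.
apply: (adjoint_eq (v_bergmanD Omo Bf Bg) (v_bergmanD Omo Af Ag)) => x Bx.
have Bx' := BL (opB Bx); have Lx := BL Bx.
by rewrite (dotDr H (BL Bf) (BL Bg) Bx') (dotDr H (BL Af) (BL Ag) Lx) (adjoint_rdot Bx Bf) (adjoint_rdot Bx Bg).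
Qed.

Lemma adjointZ (a : R[i]) g : vB g -> adjoint S T (a *: g) = a *: adjoint S T g.
Proof.
move=> Bg; have Ag := adjoint_bergman Bg.
apply: (adjoint_eq (v_bergmanZ Omo _ Bg) (v_bergmanZ Omo _ Ag)) => x Bx.
have bx : vB ((a^*)%R *: x) := v_bergmanZ Omo _ Bx.
have e (y y' : vfun) : rdot y (a *: y') = rdot ((a^*)%R *: y) y' by rewrite rdot_conj conjCK.
by rewrite !e -(adjoint_rdot bx Bg) (opZ _ Bx).
Qed.

Lemma adjoint_bound (M : R) : 0 <= M -> (forall f, vB f -> nrm (T f) <= M * nrm f) ->
  forall g, vB g -> nrm (adjoint S T g) <= M * nrm g.
Proof.
move=> M0 hM g Bg; have Ag := adjoint_bergman Bg.
have [->|n0] := eqVneq (nrm (adjoint S T g)) 0; first by rewrite mulr_ge0 ?v_norm_ge0.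
have np : 0 < nrm (adjoint S T g) by rewrite lt_neqAle eq_sym n0 v_norm_ge0.
rewrite -(ler_pM2l np) -expr2 (nrm_sqr H (BL Ag)) -(adjoint_rdot Ag Bg).
apply: le_trans (dot_le H (BL (opB Ag)) (BL Bg)) _; rewrite mulrA [nrm _ * M]mulrC.
by apply: ler_wpM2r; [exact: v_norm_ge0|exact: hM].
Qed.

Lemma adjoint_op : bounded_operator S (adjoint S T).
Proof.
split; rewrite -?vbergmanE; first exact: adjoint_bergman.
- move=> a f g Bf Bg; rewrite -[LHS]/(adjoint S T (a *: f + g)).
  by rewrite (adjointD (v_bergmanZ Omo a Bf) Bg) (adjointZ a Bf).
- have [M M0 hM] := op_bound; exists M; rewrite -vnormE.
  exact: (adjoint_bound (ltW M0) hM).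
Qed.

(** Both sides are the modulus of <T K_w e_i, K_z e_k>. Rows of the kernel of T are thus columns of
    the kernel of its adjoint, and column estimates for the adjoint serve as row estimates for T. *)
Lemma adjoint_entry z k w i : Om z -> Om w ->
  cmod (adjoint S T (Kv z k) w i) = cmod (T (Kv w i) z k).
Proof.
move=> Oz Ow; have Bz := Kv_bergman HS k Oz; have Bw := Kv_bergman HS i Ow.
rewrite -(v_dot_Kv HS i (adjoint_bergman Bz) Ow) -(v_dot_Kv HS k (opB Bw) Oz).
have [_ e] := adjointP Bz; rewrite (e _ Bw).
by rewrite (v_dot_conj (BL (adjoint_bergman Bz)) (BL Bw)) -[(_^*)%R]/(conjc _) cmodJ.
Qed.

(** Pairing with K_z e_k and moving T and then the projection to the other side shows that T P is
    dominated by an integral operator whose kernel consists of the moduli of the values of T K_w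
    e_i. *)
Lemma op_proj_entry F z k : vL F -> Om z -> ((cmod (T (proj F) z k))%:E <=
  \int[mu]_(w in Om) \sum_(0 <= i <oo) (cmod (F w i) * cmod (T (Kv w i) z k))%:E)%E.
Proof.
move=> LF Oz; have BF := proj_bergman LF; have BK := Kv_bergman HS k Oz.
have [c c1 ->] := eval_cmod k (opB BF) Oz.
have BcK := v_bergmanZ Omo c BK.
rewrite (adjoint_rdot BF BcK) rdotC (proj_dot LF (adjoint_bergman BcK)).
rewrite rdotC (adjointZ _ BK).
have LA : vL (c *: adjoint S T (Kv z k)) := v_L2Z Omo c (BL (adjoint_bergman BK)).
apply: le_trans (_ : (`|rdot F (c *: adjoint S T (Kv z k))|%:E <= _)%E).
  by rewrite lee_fin ler_norm.
apply: le_trans (rdot_le Omo LF LA) _.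
rewrite le_eqVlt; apply/orP; left; apply/eqP; apply: eq_integral => w /set_mem Ow.
apply: eq_eseriesr => i _; rewrite -[(c *: _) w i]/(c * _) cmodM c1 mul1r.
by rewrite adjoint_entry.
Qed.

End bounded_operator.

Lemma translation_op z : Om z -> bounded_operator S (translation S z).
Proof.
move=> Oz; have [C C0 h] := translation_bounded HS; split.
- by rewrite -vbergmanE => f Bf; have [] := h z f Oz Bf.
- move=> a f g _ _; apply/funext => w; apply/funext => k; rewrite /translation; ring.
- by exists C; rewrite -vbergmanE -vnormE => f Bf; have [] := h z f Oz Bf.
Qed.

Lemma translation_inv_op z : Om z -> bounded_operator S (translation_inv S z).
Proof.
move=> Oz; have [C C0 h] := translation_inv_bounded HS; split.
- by rewrite -vbergmanE => f Bf; have [] := h z f Oz Bf.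
- move=> a f g _ _; apply/funext => w; apply/funext => k.
  rewrite !translation_invE; ring.
- by exists C; rewrite -vbergmanE -vnormE => f Bf; have [] := h z f Oz Bf.
Qed.

Lemma id_op : bounded_operator S id.
Proof. by split => //; exists 1 => f _; rewrite mul1r. Qed.

Lemma translationE z f w k : translation S z f w k = f (phi z w) k * nkernel S z w.
Proof. by []. Qed.

(** The adjoint of U_z^-1 U_z = id. It writes any g in B(Omega) as the image under the adjoint of
    U_z of a vector whose size is controlled uniformly in z. *)
Lemma adjoint_translationK z g : Om z -> vB g ->
  adjoint S (translation S z) (adjoint S (translation_inv S z) g) = g.
Proof.
move=> Oz Bg; have bU := translation_op Oz; have bV := translation_inv_op Oz.
apply: (adjoint_eq bU (adjoint_bergman bV Bg) Bg) => f Bf.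
by rewrite -(adjoint_rdot bV (opB bU Bf) Bg) (translation_invK HS Oz Bf).
Qed.

Lemma nrm_translation_ge : exists2 C : R, 0 < C & forall z f, Om z -> vB f ->
  nrm f <= C * nrm (translation S z f).
Proof.
have [C C0 h] := translation_inv_bounded HS; exists C => // z f Oz Bf.
have [_ + _] := h z (translation S z f) Oz (opB (translation_op Oz) Bf).
by rewrite (translation_invK HS Oz Bf).
Qed.

Lemma adjoint_translation_Kv z w i : Om z -> Om w ->
  adjoint S (translation S z) (Kv w i) = ((nkernel S z w)^*)%R *: Kv (phi z w) i.
Proof.
move=> Oz Ow; have Op := phi_Omega HS Oz Ow; have bU := translation_op Oz.
have BK := Kv_bergman HS i Op.
apply: (adjoint_eq bU (Kv_bergman HS i Ow) (v_bergmanZ Omo _ BK)) => f Bf.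
rewrite -rdot_conj (rdot_Kv HS i (opB bU Bf) Ow) (rdot_Kv HS i (v_bergmanZ Omo _ Bf) Op).
by rewrite -[(_ *: f) _ _]/(_ * f _ _) mulrC.
Qed.

End operators.

Global Opaque proj adjoint translation.

(** * From the kernel condition to Schur estimates *)

Lemma powR_expR (R : realType) (x r : R) : 0 < x -> x `^ r = expR (r * ln x).
Proof. by move=> x0; rewrite /powR gt_eqF. Qed.

(** Young's inequality with exponents p and p / (p - 1) for X m^(1/p) and y m^(-1/p), the factors
    1/p and (p - 1)/p being bounded by 1. The weight m stays free so that it can carry the powers of
    |K|. *)
Lemma young_poweR (R : realType) (p m y : R) (X : \bar R) : 1 < p -> 0 < m -> 0 <= y -> (0 <= X)%E ->
  (X * y%:E <= X `^ p * m%:E + (m `^ (- (p - 1)^-1) * y `^ (p / (p - 1)))%:E)%E.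
Proof.
move=> p1 m0 y0; have p0 : 0 < p by exact: lt_trans p1.
have q0 : 0 < p / (p - 1) by rewrite divr_gt0 // subr_gt0.
case: X => [x||//] X0; last first.
  have -> : (+oo `^ p * m%:E = +oo)%E by rewrite /= gt_eqF // gt0_mulye ?lte_fin.
  by rewrite addye // leey.
rewrite -!EFinM -EFinD !lee_fin in X0 *.
have s0 : 0 < m `^ p^-1 by rewrite powR_gt0.
have pn : p != 0 by rewrite gt_eqF.
have pn1 : p - 1 != 0 by rewrite subr_eq0 gt_eqF.
have := @conjugate_powR R (x * m `^ p^-1) (y * m `^ (- p^-1)) p (p / (p - 1)).
move=> /(_ (mulr_ge0 X0 (ltW s0)) (mulr_ge0 y0 (powR_ge0 _ _)) p0 q0).
rewrite invf_div => /(_ ltac:(by field)).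
rewrite mulrACA powRN mulfV ?gt_eqF // mulr1 => h; apply: le_trans h _.
rewrite !powRM ?powR_ge0 ?invr_ge0 //; last exact: ltW.
rewrite -powRN -!powRrM mulVf // powRr1 ?(ltW m0) //.
rewrite (_ : - p^-1 * (p / (p - 1)) = - (p - 1)^-1); last by field; rewrite ?pn ?pn1.
rewrite lerD //; first by rewrite ler_piMr ?mulr_ge0 ?powR_ge0 ?(ltW m0) // invf_le1 // ltW.
rewrite [_ * y `^ _]mulrC -[leRHS]mulr1; apply: ler_wpM2l; first by rewrite mulr_ge0 ?powR_ge0.
by rewrite ler_pdivrMr // mul1r; lra.
Qed.

(** Exponent arithmetic for x = |K_w|, y = |K_z|, v = |K_{phi_w(z)}|: the second term of Young's
    inequality is, up to powers of s and x, the integrand of [rudin_forelli_weight] times a further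
    power of v. The exponent e is the one for which the powers of y match. *)
Lemma young_weight (R : realType) (p b t s x y v : R) :
  2 < p -> 0 < s -> 0 < x -> 0 < y -> 0 < v -> let e := 1 - b * (p - 1) / p in
  (s * x `^ e * (y `^ (2 - p) * v `^ (p - 2) * x `^ (- p))) `^ (- (p - 1)^-1) *
    (y `^ e) `^ (p / (p - 1)) =
  s `^ (- (p - 1)^-1) * x `^ (e + b) * (v `^ (- t) * y `^ (2 - b)) *
    v `^ (t - (p - 2) / (p - 1)).
Proof.
move=> p2 s0 x0 y0 v0 e; have pn : p != 0 by rewrite gt_eqF // (lt_trans _ p2).
have pn1 : p - 1 != 0 by rewrite subr_eq0 gt_eqF // (lt_trans _ p2) // ltr1n.
have E (u r : R) : expR u `^ r = expR (r * u) by rewrite powR_expR ?expR_gt0 // expRK.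
rewrite -(lnK s0) -(lnK x0) -(lnK y0) -(lnK v0).
move: (ln s) (ln x) (ln y) (ln v) => s' x' y' v'.
by rewrite !E -!expRD !E -!expRD; congr expR; rewrite /e; field; rewrite pn pn1.
Qed.

Section kernel_estimate.
Variables (R : realType) (n : nat) (S : bergman_data R n) (HS : bergman_type S).
Local Notation X := (cspace R n).
Local Notation BX := (borel_cspace R n).
Local Notation Om := (Omega S).
Local Notation mu := (sigma S).
Local Notation vfun := (X -> nat -> R[i]).
Local Notation nK := (normK S).
Local Notation vB := (vbergman S).
Local Notation phi := (phi S).
Local Notation Kv := (Kv S).
Implicit Types f g h : vfun.

Let Omo : open Om := Omega_open HS.
Let mOm : measurable (Om : set BX) := open_borel Omo.

(** Cleared of denominators, both the hypothesis and the second conclusion read 4 - kappa < (2 -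
    kappa) p. *)
Lemma kappa_exponent (p : R) : (4 - kappa S) / (2 - kappa S) < p ->
  2 < p /\ kappa S / 2 < (p - 2) / (p - 1).
Proof.
move=> hp; have [k0 k2] : 0 <= kappa S /\ kappa S < 2.
  by case: (kappa_rudin_forelli HS) => [[/andP[/ltW ? ?] _]|[-> _]]; split => //; lra.
have h2 : 0 < 2 - kappa S by rewrite subr_gt0.
have h := hp; rewrite ltr_pdivrMr // in h.
have p2 : 2 < p.
  apply: le_lt_trans hp; rewrite ler_pdivlMr //; lra.
split => //; rewrite ltr_pdivlMr ?subr_gt0 ?(lt_trans _ p2) //; last lra.
by nra.
Qed.

Lemma phi_normK_measurable w : Om w -> measurable_fun (Om : set BX) (fun z => nK (phi w z)).
Proof.
move=> Ow; apply: (@measurable_comp _ _ _ BX BX _ Om nK _ (phi w)) => //.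
- by move=> _ [z Oz <-]; exact: (phi_Omega HS).
- exact: normK_measurable.
- exact: phi_measurable.
Qed.

Lemma powR_measurable (f : X -> R) (r : R) :
  measurable_fun (Om : set BX) f -> measurable_fun (Om : set BX) (fun z => f z `^ r).
Proof. by move=> mf; exact: (measurable_comp measurableT _ (measurable_powR r) mf). Qed.

(** This is (A.6) for the exponents t' + b and t' - b, whose half-sum is t', once |K_w(z)| is
    bounded below by |K_w| |K_z| / |K_{phi_w(z)}| up to a constant. *)
Lemma rudin_forelli_weight (t : R) : kappa S / 2 < t ->
  exists t' b C : R, [/\ 0 < t', t' < t, 0 < C & forall w, Om w ->
   (\int[mu]_(z in Om) (nK (phi w z) `^ (- t') * nK z `^ (2 - b))%:E <= (C * nK w `^ (- b))%:E)%E].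
Proof.
move=> kt.
have [t' [b [t'0 t't b0 rf]]] : exists t' b : R, [/\ 0 < t', t' < t, 0 <= b &
    rudin_forelli S (t' + b) (t' - b)].
  case: (kappa_rudin_forelli HS) => [[/andP[k0 k2] h]|[k0 h]].
    (* t' lies strictly between kappa/2 and t. Then |t' - kappa| < t', and any b between these two
       numbers gives t' + b > kappa > t' - b > 0. *)
    pose t' := Num.min ((t + kappa S / 2) / 2) ((1 + kappa S / 2) / 2).
    have [t1 t2 t3] : [/\ kappa S / 2 < t', t' < t & t' < 1].
      by rewrite /t' lt_min !gt_min; split; apply/orP || apply/andP; [split|left|right]; lra.
    pose b := (`|t' - kappa S| + t') / 2.
    have hb : `|t' - kappa S| < t' by rewrite ltr_norml; apply/andP; split; lra.
    have hb2 : `|t' - kappa S| < b by rewrite /b; lra.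
    exists t', b; split; [lra|by []|by rewrite /b divr_ge0 ?addr_ge0 //; lra|apply: h].
      by move: hb2; rewrite ltr_norml => /andP[]; lra.
    by move: hb2; rewrite ltr_norml /b => /andP[]; lra.
  exists (t / 2), 0; split; rewrite ?addr0 ?subr0; try lra.
  by apply: h; lra.
have [C1 hC] := rf; have [C0 C00 hK] := nkernel_dot HS.
exists t', b, (C0 `^ t' * (`|C1| + 1)); split => //.
  by rewrite mulr_gt0 ?powR_gt0 // ltr_wpDl.
move=> w Ow; have nw := normK_gt0 HS Ow.
have [_ aK _] := kernel_bergman HS Ow.
have mK := cmeasurable_cmod (analytic_cmeasurable Omo aK).
have mn := normK_measurable HS.
pose g z := cmod (sc_dot S (Defs.kernel S w) (Defs.kernel S z)) `^ ((t' + b + (t' - b)) / 2) /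
               (nK w `^ (t' - b) * nK z `^ (t' + b)).
have hg := hC w Ow.
have mg : measurable_fun (Om : set BX) (fun z => g z * nK z ^+ 2).
  apply: measurable_funM; last exact: normK2_measurable.
  apply: (@eq_measurable_fun _ _ BX _ _ (fun z => cmod (Defs.kernel S w z) `^ ((t' + b + (t' - b)) / 2) *
             ((nK w `^ (t' - b)) * nK z `^ (t' + b))^-1)).
    by move=> z /set_mem Oz; rewrite /g (sc_dot_K HS).
  apply: measurable_funM; first exact: powR_measurable.
  apply: measurable_fun_inv.
    by move=> z Oz; rewrite mulr_gt0 ?powR_gt0 // (normK_gt0 HS).
  by apply: measurable_funM => //; exact: powR_measurable.
apply: (@le_trans _ _ (\int[mu]_(z in Om) ((C0 `^ t' * nK w `^ (- b))%:E * (g z * nK z ^+ 2)%:E))%E).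
  apply: ge0_le_integral => //.
  - by move=> z _; rewrite lee_fin mulr_ge0 ?powR_ge0.
  - apply/measurable_EFinP; apply: measurable_funM; apply: powR_measurable => //.
    exact: phi_normK_measurable.
  - by apply: measurable_funeM; exact/measurable_EFinP.
  move=> z Oz; rewrite -EFinM lee_fin.
  have nz := normK_gt0 HS Oz; have np := normK_gt0 HS (phi_Omega HS Ow Oz).
  have [_ h] := hK w z Ow Oz; rewrite sc_dot_nkernel // in h.
  rewrite cmodM cmodV cmodR gtr0_norm ?mulr_gt0 // in h.
  have x0 : 0 < cmod (Defs.kernel S w z).
    apply: cmod_gt0; apply/eqP => k0.
    by have := nkernel_neq0 HS Ow Oz; rewrite /nkernel k0 mul0r eqxx.
  rewrite /g (sc_dot_K HS) //; set x := cmod _ in h x0 *.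
  rewrite (_ : (t' + b + (t' - b)) / 2 = t'); last by field.
  have y0 : 0 < C0 * (x / (nK w * nK z)) by rewrite mulr_gt0 ?divr_gt0 ?mulr_gt0.
  have h1 : (nK (phi w z)) `^ (- t') <= (C0 * (x / (nK w * nK z))) `^ t'.
    rewrite !powR_expR // ler_expR mulNr -mulrN ler_pM2l // -lnV ?posrE // ler_ln ?posrE ?invr_gt0 //.
  apply: le_trans (ler_wpM2r (powR_ge0 _ _) h1) _; rewrite -(powR_mulrn 2 (ltW nz)).
  have wz : 0 < nK w * nK z by exact: mulr_gt0.
  have iwz : 0 < (nK w * nK z)^-1 by rewrite invr_gt0.
  have xwz : 0 < x / (nK w * nK z) by exact: mulr_gt0.
  rewrite !powR_expR // !lnM ?posrE // lnV ?posrE // lnM ?posrE //.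
  rewrite -!expRD -expRN -!expRD ler_expR.
  by rewrite le_eqVlt; apply/orP; left; apply/eqP; ring.
rewrite ge0_integralZl_EFin ?mulr_ge0 ?powR_ge0 //; first last.
- exact/measurable_EFinP.
- by move=> z Oz; rewrite lee_fin mulr_ge0 ?sqr_ge0 // divr_ge0 ?mulr_ge0 ?powR_ge0.
apply: (@le_trans _ _ ((C0 `^ t' * nK w `^ (- b))%:E * C1%:E)%E).
  by apply: lee_wpmul2l => //; rewrite lee_fin mulr_ge0 ?powR_ge0.
rewrite -EFinM lee_fin mulrAC; apply: ler_wpM2r; first exact: powR_ge0.
by apply: ler_wpM2l; rewrite ?powR_ge0 // (le_trans (ler_norm _)) // lerDl.
Qed.

Section column_sums.
Variables (Q : vfun -> vfun) (bQ : bounded_operator S Q).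

Definition colsum (w : X) (i : nat) (z : X) : \bar R :=
  (\sum_(0 <= k <oo) (cmod (Q (Kv w i) z k))%:E)%E.

Lemma colsum_ge0 w i z : (0 <= colsum w i z)%E.
Proof. by apply: nneseries_ge0 => k _ _; rewrite lee_fin cmod_ge0. Qed.

Lemma l1norm_measurable f : (forall k, cmeasurable S (f ^~ k)) ->
  measurable_fun (Om : set BX) (fun z => \sum_(0 <= k <oo) (cmod (f z k))%:E)%E.
Proof.
move=> mf; apply: ge0_emeasurable_sum => [k z _ _|k _]; first by rewrite lee_fin cmod_ge0.
by apply/measurable_EFinP; exact: cmeasurable_cmod.
Qed.

Lemma colsum_measurable w i : Om w -> measurable_fun (Om : set BX) (colsum w i).
Proof.
move=> Ow; apply: l1norm_measurable => k.
exact: (v_L2_cmeasurable k (v_bergman_L2 (opB bQ (Kv_bergman HS i Ow)))).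
Qed.

Lemma l1norm_translation w i z : Om w ->
  (\sum_(0 <= k <oo) (cmod (translation S w (Q (kvec S w (l2basis R i))) z k))%:E =
   colsum w i (phi w z) * ((nK w)^-1 * cmod (nkernel S w z))%:E)%E.
Proof.
move=> Ow; rewrite muleC /colsum -nneseriesZl; last first.
  by move=> k _; rewrite lee_fin cmod_ge0.
apply: eq_eseriesr => k _; rewrite translationE kvecE (opZ bQ _ (Kv_bergman HS i Ow)).
rewrite -EFinM; congr EFin; rewrite -[(_ *: _) _ _]/(_ * Q (Kv w i) (phi w z) k) !cmodM cmodR.
rewrite ger0_norm ?invr_ge0 ?(ltW (normK_gt0 HS Ow)) //; ring.
Qed.

(** The substitution u = phi_w(z) in the kernel condition, with |k_w(phi_w(z))| comparable to
    |K_{phi_w(z)}| / |K_z|; the powers 2 and -2 come from passing through lambda. *)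
Lemma kernel_condition_moment (p : R) : 0 < p -> kernel_condition S Q p ->
  exists2 M : R, 0 < M & forall w i, Om w ->
   (\int[mu]_(z in Om) (colsum w i z `^ p *
      (nK z `^ (2 - p) * nK (phi w z) `^ (p - 2) * nK w `^ (- p))%:E) <= M%:E)%E.
Proof.
move=> p0 hQ.
have [M0 M00 hM0] : exists2 M0 : R, 0 < M0 & forall w i, Om w ->
    (\int[mu]_(u in Om) (\sum_(0 <= k <oo)
      (cmod (translation S w (Q (kvec S w (l2basis R i))) u k))%:E) `^ p <= M0%:E)%E.
  move: hQ; rewrite /kernel_condition.
  set A := [set y | _]; move=> hA.
  have [m m0 hm] : exists2 m : R, 0 < m & (ereal_sup A <= m%:E)%E.
    move: hA; case: (ereal_sup A) => [r _|//|_]; last by exists 1 => //; exact: leNye.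
    by exists (`|r| + 1); rewrite ?ltr_wpDl // lee_fin (le_trans (ler_norm r)) // lerDl.
  exists (m `^ p); first by rewrite powR_gt0.
  move=> w i Ow; set I := (\int[_]_(_ in _) _)%E.
  have I0 : (0 <= I)%E by apply: integral_ge0 => u _; exact: poweR_ge0.
  have : (I `^ p^-1 <= m%:E)%E.
    by apply: le_trans hm; apply: ereal_sup_ubound; exists i, w.
  move=> h; have pn0 : p != 0 by rewrite gt_eqF.
  rewrite -[I]poweRe1 // -(mulVf pn0) poweRrM -poweR_EFin.
  apply: gt0_ler_poweR => //; rewrite ?ltW // in_itv /= ?poweR_ge0 ?leey //.
  by rewrite lee_fin ltW.
have [C C0 hC] := change_of_variable HS.
have [C1 C10 hK] := nkernel_mod HS.
exists (C1 `^ p * (C * M0)); first by rewrite !mulr_gt0 ?powR_gt0.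
move=> w i Ow; have nw := normK_gt0 HS Ow.
pose s u := (\sum_(0 <= k <oo)
      (cmod (translation S w (Q (kvec S w (l2basis R i))) u k))%:E)%E.
have s0 u : (0 <= s u)%E by apply: nneseries_ge0 => k _ _; rewrite lee_fin cmod_ge0.
have mpow (h : X -> \bar R) : measurable_fun (Om : set BX) h ->
    measurable_fun (Om : set BX) (fun u => h u `^ p)%E.
  by move=> mh; exact: (measurable_comp measurableT _ (measurable_poweR p) mh).
have Bk : vB (kvec S w (l2basis R i)).
  by rewrite kvecE; exact: (v_bergmanZ Omo _ (Kv_bergman HS i Ow)).
have ms : measurable_fun (Om : set BX) (fun u => s u `^ p)%E.
  apply: (mpow); apply: l1norm_measurable => k.
  exact: (v_L2_cmeasurable k (v_bergman_L2 (opB (translation_op HS Ow) (opB bQ Bk)))).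
have mn2 := normK2_measurable HS.
have mi2 : measurable_fun (Om : set BX) (fun u => (nK u ^+ 2)^-1).
  by apply: measurable_fun_inv => // u Ou; rewrite exprn_gt0 // (normK_gt0 HS).
pose g u := (s u `^ p * ((nK u ^+ 2)^-1)%:E)%E.
have mg : measurable_fun (Om : set BX) g.
  by apply: emeasurable_funM => //; exact/measurable_EFinP.
have g0 u : (0 <= g u)%E by rewrite mule_ge0 ?poweR_ge0 // lee_fin invr_ge0 sqr_ge0.
have h1 : (\int[mu]_(u in Om) (g u * (nK u ^+ 2)%:E) <= M0%:E)%E.
  apply: le_trans (hM0 w i Ow); rewrite le_eqVlt; apply/orP; left; apply/eqP.
  apply: eq_integral => u /set_mem Ou; rewrite /g -muleA -EFinM mulVf ?mule1 //.
  by rewrite expf_neq0 // gt_eqF // (normK_gt0 HS).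
have h2 := le_trans (hC w g Ow mg (fun u _ => g0 u)) (lee_wpmul2l _ h1).
have C0e : (0 <= C%:E)%E by rewrite lee_fin ltW.
have {}h2 := h2 C0e.
rewrite EFinM; apply: le_trans (lee_wpmul2l _ h2); last by rewrite lee_fin powR_ge0.
have mgp : measurable_fun (Om : set BX) (fun z => g (phi w z) * (nK z ^+ 2)%:E)%E.
  apply: emeasurable_funM; last exact/measurable_EFinP.
  apply: (@measurable_comp _ _ _ BX BX _ Om g _ (phi w)) => //.
    by move=> _ [z Oz <-]; exact: (phi_Omega HS).
  exact: phi_measurable.
have gp0 z : (0 <= g (phi w z) * (nK z ^+ 2)%:E)%E by rewrite mule_ge0 // lee_fin sqr_ge0.
rewrite -ge0_integralZl_EFin ?powR_ge0 //.
apply: ge0_le_integral => //.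
- by move=> z _; rewrite mule_ge0 ?poweR_ge0 // lee_fin !mulr_ge0 ?powR_ge0.
- apply: emeasurable_funM; first by apply: (mpow); exact: colsum_measurable.
  apply/measurable_EFinP; apply: measurable_funM => //; apply: measurable_funM.
    by apply: powR_measurable; exact: normK_measurable.
  by apply: powR_measurable; exact: phi_normK_measurable.
- by apply: measurable_funeM.
move=> z Oz; have Op := phi_Omega HS Ow Oz.
have nz := normK_gt0 HS Oz; have np := normK_gt0 HS Op.
rewrite /g /s l1norm_translation // (phi_involution HS Ow Oz).
rewrite poweRM ?colsum_ge0 ?lee_fin ?mulr_ge0 ?invr_ge0 ?cmod_ge0 ?(ltW nw) // poweR_EFin.
rewrite -!muleA [leRHS]muleCA; apply: lee_wpmul2l; first exact: poweR_ge0.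
rewrite -!EFinM lee_fin.
have [_ h3] := hK w (phi w z) Ow Op; rewrite (phi_involution HS Ow Oz) in h3.
have : (nK (phi w z) / nK z) `^ p <= (C1 * cmod (nkernel S w (phi w z))) `^ p.
  by apply: ge0_ler_powR => //; rewrite ?nnegrE ?ltW ?divr_gt0 // (lt_le_trans _ h3) // divr_gt0.
have c0 := cmod_gt0 (nkernel_neq0 HS Ow Op).
move: (cmod _) c0 => c c0; rewrite -(powR_mulrn 2 (ltW nz)) -(powR_mulrn 2 (ltW np)).
rewrite !powR_expR ?mulr_gt0 ?invr_gt0 // !lnM ?posrE ?invr_gt0 // !lnV ?posrE //.
rewrite -!expRN -!expRD !ler_expR => h4; lra.
Qed.

(** Here s is the free parameter of Young's inequality and c bounds on A the power of |K_{phi_w(z)}|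
    left over. With A = Omega this yields a bounded Schur sum; with A far from w, c is small and s
    can then be taken small too. *)
Lemma kernel_condition_on (p t' b C1 : R) : 2 < p -> t' < (p - 2) / (p - 1) -> 0 < C1 ->
  (forall w, Om w -> (\int[mu]_(z in Om) (nK (phi w z) `^ (- t') * nK z `^ (2 - b))%:E <=
     (C1 * nK w `^ (- b))%:E)%E) ->
  kernel_condition S Q p ->
  exists2 M : R, 0 < M & forall w i (s c : R) (A : set X), Om w -> 0 < s -> 0 <= c ->
    measurable (A : set BX) -> A `<=` Om ->
    (forall z, A z -> nK (phi w z) `^ (t' - (p - 2) / (p - 1)) <= c) ->
    (\int[mu]_(z in A) (colsum w i z * (nK z `^ (1 - b * (p - 1) / p))%:E) <=
      ((s + s `^ (- (p - 1)^-1) * c) * M * nK w `^ (1 - b * (p - 1) / p))%:E)%E.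
Proof.
move=> p2 tt C10 rf hQ; have p0 : 0 < p by exact: lt_trans p2.
have p1 : 1 < p by rewrite (lt_trans _ p2) // ltr1n.
have pn : p != 0 by rewrite gt_eqF.
have pn1 : p - 1 != 0 by rewrite subr_eq0 gt_eqF.
have [M0 M00 hM] := kernel_condition_moment p0 hQ.
exists (M0 + C1); first exact: addr_gt0.
move=> w i s c A Ow s0 c0 mA AO hA; have nw := normK_gt0 HS Ow.
pose e := 1 - b * (p - 1) / p.
pose W z := nK z `^ (2 - p) * nK (phi w z) `^ (p - 2) * nK w `^ (- p).
pose G z := nK (phi w z) `^ (- t') * nK z `^ (2 - b).
pose a1 := s * nK w `^ e.
pose a2 := s `^ (- (p - 1)^-1) * c * nK w `^ (e + b).
have a10 : 0 <= a1 by rewrite mulr_ge0 ?powR_ge0 ?(ltW s0).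
have a20 : 0 <= a2 by rewrite !mulr_ge0 ?powR_ge0.
have A10 : (0 <= a1%:E)%E by rewrite lee_fin.
have A20 : (0 <= a2%:E)%E by rewrite lee_fin.
have mn := normK_measurable HS; have mp := phi_normK_measurable Ow.
have mX := colsum_measurable i Ow.
have mXW : measurable_fun (Om : set BX) (fun z => colsum w i z `^ p * (W z)%:E)%E.
  apply: emeasurable_funM; first exact: (measurable_comp measurableT _ (measurable_poweR p) mX).
  apply/measurable_EFinP; apply: measurable_funM => //.
  by apply: measurable_funM; exact: powR_measurable.
have mG : measurable_fun (Om : set BX) (fun z => (G z)%:E).
  by apply/measurable_EFinP; apply: measurable_funM; exact: powR_measurable.
have XW0 z : (0 <= colsum w i z `^ p * (W z)%:E)%E.
  by rewrite mule_ge0 ?poweR_ge0 // lee_fin !mulr_ge0 ?powR_ge0.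
have G0 z : (0 <= (G z)%:E)%E by rewrite lee_fin mulr_ge0 ?powR_ge0.
apply: (@le_trans _ _ (\int[mu]_(z in Om) (a1%:E * (colsum w i z `^ p * (W z)%:E) + a2%:E * (G z)%:E))%E).
  apply: (@le_trans _ _ (\int[mu]_(z in A) (a1%:E * (colsum w i z `^ p * (W z)%:E) + a2%:E * (G z)%:E))%E); last first.
    apply: ge0_subset_integral => //.
    - by apply: emeasurable_funD; apply: measurable_funeM.
    - by move=> z _; exact: adde_ge0 (mule_ge0 A10 (XW0 z)) (mule_ge0 A20 (G0 z)).
  apply: ge0_le_integral => //.
  - by move=> z _; rewrite mule_ge0 ?colsum_ge0 // lee_fin powR_ge0.
  - apply: (measurable_funS mOm AO); apply: emeasurable_funM => //.
    by apply/measurable_EFinP; exact: powR_measurable.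
  - apply: (measurable_funS mOm AO).
    by apply: emeasurable_funD; apply: measurable_funeM.
  move=> z Az; have Oz := AO z Az; have nz := normK_gt0 HS Oz.
  have np := normK_gt0 HS (phi_Omega HS Ow Oz).
  have W0 : 0 < W z by rewrite !mulr_gt0 ?powR_gt0.
  have m0 : 0 < a1 * W z by rewrite !mulr_gt0 ?powR_gt0.
  (* The weight is m = s |K_w|^e W(z): the first term is integrated by the moment bound, the second
     by (A.6). *)
  apply: le_trans (young_poweR p1 m0 (powR_ge0 _ _) (colsum_ge0 w i z)) _.
  have -> : (colsum w i z `^ p * (a1 * W z)%:E = a1%:E * (colsum w i z `^ p * (W z)%:E))%E.
    by rewrite EFinM muleCA.
  apply: leeD; first exact: lexx.
  rewrite -EFinM lee_fin.
  have h : a2 * G z = s `^ (- (p - 1)^-1) * nK w `^ (e + b) * G z * c by rewrite /a2; ring.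
  rewrite h; have hc := hA z Az.
  apply: le_trans (ler_wpM2l _ hc); last by rewrite !mulr_ge0 ?powR_ge0.
  rewrite le_eqVlt; apply/orP; left; apply/eqP.
  exact: (@young_weight R p b t' s (nK w) (nK z) (nK (phi w z)) p2 s0 nw nz np).
pose f1 z := (a1%:E * (colsum w i z `^ p * (W z)%:E))%E.
pose f2 z := (a2%:E * (G z)%:E)%E.
have f10 z : Om z -> (0 <= f1 z)%E := fun _ => mule_ge0 A10 (XW0 z).
have f20 z : Om z -> (0 <= f2 z)%E := fun _ => mule_ge0 A20 (G0 z).
have mf1 : measurable_fun (Om : set BX) f1 by apply: measurable_funeM; exact: mXW.
have mf2 : measurable_fun (Om : set BX) f2 by apply: measurable_funeM; exact: mG.
rewrite (@ge0_integralD _ BX _ mu _ mOm f1 f2 f10 mf1 f20 mf2) .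
have e1 := @ge0_integralZl_EFin _ BX _ mu _ mOm _ (fun z _ => XW0 z) mXW a1 a10.
have e2 := @ge0_integralZl_EFin _ BX _ mu _ mOm _ (fun z _ => G0 z) mG a2 a20.
have h1 := lee_wpmul2l A10 (hM w i Ow); rewrite -e1 in h1.
have h2 := lee_wpmul2l A20 (rf w Ow); rewrite -e2 in h2.
apply: (@le_trans _ _ (a1%:E * M0%:E + a2%:E * (C1 * nK w `^ (- b))%:E)%E).
  exact: leeD h1 h2.
rewrite -!EFinM -EFinD lee_fin -/e.
have -> : a2 * (C1 * nK w `^ (- b)) = s `^ (- (p - 1)^-1) * c * nK w `^ e * C1.
  have -> : nK w `^ e = nK w `^ (e + b) * nK w `^ (- b).
    by rewrite -powRD ?addrK ?(gt_eqF nw) ?implybT.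
  by rewrite /a2; ring.
rewrite /a1; have u0 := powR_ge0 (nK w) e; have v0 : 0 <= s `^ (- (p - 1)^-1) * c by rewrite mulr_ge0 ?powR_ge0.
move: (nK w `^ e) u0 (s `^ _ * c) v0 => u u0 v v0.
have x1 := mulr_ge0 (mulr_ge0 (ltW s0) u0) (ltW C10).
have x2 := mulr_ge0 (mulr_ge0 v0 u0) (ltW M00).
rewrite (_ : (s + v) * (M0 + C1) * u = s * u * M0 + v * u * C1 + (s * u * C1 + v * u * M0)); last by ring.
by rewrite lerDl addr_ge0.
Qed.

(* The exponent is the one for which Young's inequality turns the kernel condition
   and (A.6) into a Schur estimate with the same weight H on both sides; as it
   depends on p and b only, H serves for both T and its adjoint. *)
Lemma kernel_condition_schur (p t' b C1 : R) : 2 < p -> t' < (p - 2) / (p - 1) -> 0 < C1 ->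
  (forall w, Om w -> (\int[mu]_(z in Om) (nK (phi w z) `^ (- t') * nK z `^ (2 - b))%:E <=
     (C1 * nK w `^ (- b))%:E)%E) ->
  kernel_condition S Q p ->
  let H z := nK z `^ (1 - b * (p - 1) / p) in
  (exists2 C : R, 0 < C & forall w i, Om w ->
    (\int[mu]_(z in Om) (colsum w i z * (H z)%:E) <= (C * H w)%:E)%E) /\
  (forall e : R, 0 < e -> exists2 r : R, 0 < r & forall w i, Om w ->
    (\int[mu]_(z in Om `\` dball S w r) (colsum w i z * (H z)%:E) <= (e * H w)%:E)%E).
Proof.
move=> p2 tt C10 rf hQ H; have [M M0 hM] := kernel_condition_on p2 tt C10 rf hQ.
set t := (p - 2) / (p - 1) in tt hM.
have tt0 : 0 < t - t' by rewrite subr_gt0.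
split.
  have [l l0 hl] := normK_lower HS.
  (* Take s = 1; since t' < t, the lower bound l of |K| bounds the leftover power by l^(t' - t). *)
  exists ((1 + 1 `^ (- (p - 1)^-1) * l `^ (t' - t)) * M).
    by rewrite mulr_gt0 // ltr_wpDr // mulr_ge0 ?powR_ge0.
  move=> w i Ow; apply: hM => //; first exact: powR_ge0.
  move=> z Oz; have := hl _ (phi_Omega HS Ow Oz) => h.
  rewrite !powR_expR ?(lt_le_trans l0) // ler_expR -opprB !mulNr lerN2 ler_pM2l //.
  by rewrite ler_ln ?posrE ?(lt_le_trans l0).
move=> e e0.
(* Both s M and s^(-1/(p-1)) c M equal e / 2. *)
pose s := e / (2 * M); have s0 : 0 < s by rewrite divr_gt0 ?mulr_gt0.
pose c := e / (2 * M * s `^ (- (p - 1)^-1)).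
have c0 : 0 < c by rewrite divr_gt0 ?mulr_gt0 ?powR_gt0.
(* Beyond distance B from 0 the leftover power of |K| is at most c; the radius C (|B| + 1) below
   forces phi_w(z) to be that far. *)
have [B hB] : exists B : R, forall z, Om z -> B < dist S z 0 -> c `^ (- (t - t')^-1) <= nK z.
  have : (\forall x \near +oo, c `^ (- (t - t')^-1) <= x) by exact: nbhs_pinfty_ge.
  by move=> /(normK_infty HS)[B hB]; exists B.
have [C C0 hC] := dist_phi HS.
exists (C * (`|B| + 1)); first by rewrite mulr_gt0 // ltr_wpDl.
move=> w i Ow.
rewrite (_ : e * H w = (s + s `^ (- (p - 1)^-1) * c) * M * H w); last first.
  congr (_ * _); rewrite /c; have h := powR_gt0 (- (p - 1)^-1) s0.
  move: (s `^ _) h => v v0; rewrite /s.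
  by field; rewrite !gt_eqF.
have [d0 _ dC _] := dist_metric HS.
apply: hM => //.
- exact: ltW.
- by apply: measurableD => //; exact: (dball_borel HS).
move=> z [Oz nz].
have hz : C * (`|B| + 1) <= dist S z w.
  rewrite leNgt; apply/negP => h; apply: nz; split => //; rewrite dC //.
have Op := phi_Omega HS Ow Oz.
have [h1 _] := hC w z Ow Oz.
have h2 : B < dist S (phi w z) 0.
  have := le_trans hz h1; rewrite ler_pM2l //; apply: lt_le_trans.
  by rewrite (le_lt_trans (ler_norm B)) // ltrDl.
have h3 := hB _ Op h2; have np := normK_gt0 HS Op.
have -> : c = (c `^ (- (t - t')^-1)) `^ (t' - t).
  rewrite -powRrM (_ : - (t - t')^-1 * (t' - t) = 1) ?powRr1 ?ltW //.
  by rewrite -(opprB t t') mulrNN mulVf // gt_eqF.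
have k0 : 0 < c `^ (- (t - t')^-1) by rewrite powR_gt0.
rewrite [leLHS]powR_expR // [leRHS]powR_expR // ler_expR -opprB !mulNr lerN2 ler_pM2l //.
by rewrite ler_ln ?posrE.
Qed.

End column_sums.

End kernel_estimate.

(** * Measurability and smallness of the kernel away from the diagonal *)

Lemma measurable_fun_if_out d (T : measurableType d) (R : realType) (D A : set T) (f : T -> R) :
  measurable D -> measurable A -> measurable_fun D f ->
  measurable_fun D (fun x => if `[< A x >] then 0 else f x).
Proof.
move=> mD mA mf; rewrite (_ : (fun x => _) = f \_ (~` A)).
  apply/(measurable_restrict _ _ _).1 => //; first exact: measurableC.
  by apply: measurable_funS mf => // x [].
apply/funext => x; rewrite patchE in_setC; case: asboolP => Ax; first by rewrite mem_set.
by rewrite memNset.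
Qed.

Section schur_tail.
Variables (R : realType) (n : nat) (S : bergman_data R n) (HS : bergman_type S).
Local Notation X := (cspace R n).
Local Notation BX := (borel_cspace R n).
Local Notation Om := (Omega S).
Local Notation mu := (sigma S).
Local Notation vfun := (X -> nat -> R[i]).
Local Notation nK := (normK S).
Local Notation Kv := (Kv S).
Implicit Types f g h : vfun.

Let Omo : open Om := Omega_open HS.
Let mOm : measurable (Om : set BX) := open_borel Omo.

(** The triangle inequality through a point of the dense sequence near z writes the set as a
    countable union of products of balls. *)
Lemma dist_lt_measurable (r : R) :
  measurable ([set p | [/\ Om p.1, Om p.2 & dist S p.1 p.2 < r]] : set (BX * BX)).
Proof.
have [a [aO ad]] := dense_dsequence HS; have [_ _ dC dT] := dist_metric HS.
rewrite (_ : [set p | _] = \bigcup_j \bigcup_(k : nat)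
    (dball S (a j) k.+1%:R^-1 `*` dball S (a j) (r - k.+1%:R^-1))).
  apply: bigcupT_measurable => j; apply: bigcupT_measurable => k.
  by apply: measurableX; exact: (dball_borel HS).
apply/seteqP; split => [[z w] /= [Oz Ow zw]|[z w] [j _ [k _ [[Oz /= h1] [Ow /= h2]]]]]; last first.
  split => //; apply: le_lt_trans (dT z (a j) w Oz (aO j) Ow) _.
  by rewrite (dC z) //; move: (k.+1%:R^-1) h1 h2 => e; lra.
have e0 : 0 < (r - dist S z w) / 2 by rewrite divr_gt0 // subr_gt0.
pose k := Num.trunc ((r - dist S z w) / 2)^-1.
have kr : k.+1%:R^-1 < (r - dist S z w) / 2 :> R by rewrite invf_plt ?posrE // truncnS_gt.
have k0 : 0 < k.+1%:R^-1 :> R by rewrite invr_gt0.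
have [j zj] := ad z _ Oz k0; have Oj := aO j.
exists j => //; exists k => //; split; split => //=; first by rewrite dC.
have := dT (a j) z w Oj Oz Ow; rewrite [dist S (a j) z]dC //.
by move: (k.+1%:R^-1) kr zj => e; lra.
Qed.

Section tail.
Variables (T : vfun -> vfun) (bT : bounded_operator S T).

Definition entry (i k : nat) (z w : X) : R := cmod (T (Kv w i) z k).

Lemma entry_ge0 i k z w : 0 <= entry i k z w.
Proof. exact: cmod_ge0. Qed.

(** The entry is continuous in z because T K_w e_i is analytic, and measurable in w because it is,
    in modulus, an entry of the adjoint: a Caratheodory function. *)
Lemma entry_measurable i k : measurable_fun ((Om : set BX) `*` (Om : set BX))
  (fun p : BX * BX => entry i k p.1 p.2).
Proof.
apply: (@caratheodory_measurable R n _ BX Om Om (entry i k) Omo mOm).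
  move=> z w Oz Ow; have BTK := opB bT (Kv_bergman HS i Ow).
  exact: analytic_cmod_cvg (v_bergman_analytic k BTK) Oz.
move=> z Oz; have BA := adjoint_bergman HS bT (Kv_bergman HS k Oz).
apply: (@eq_measurable_fun _ _ BX _ _ (fun w => cmod (adjoint S T (Kv z k) w i))).
  by move=> w /set_mem Ow; rewrite (adjoint_entry HS bT).
exact: cmeasurable_cmod (v_L2_cmeasurable i (v_bergman_L2 BA)).
Qed.

Definition far_entry (r : R) (i k : nat) (z w : X) : R :=
  if `[< dist S z w < r >] then 0 else entry i k z w.

Lemma far_entry_ge0 r i k z w : 0 <= far_entry r i k z w.
Proof. by rewrite /far_entry; case: asboolP => // _; exact: entry_ge0. Qed.

Lemma far_entry_le r i k z w : far_entry r i k z w <= entry i k z w.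
Proof. by rewrite /far_entry; case: asboolP => // _; exact: entry_ge0. Qed.

Lemma far_entry_measurable r i k : measurable_fun ((Om : set BX) `*` (Om : set BX))
  (fun p : BX * BX => far_entry r i k p.1 p.2).
Proof.
have mD := dist_lt_measurable r.
apply: (@eq_measurable_fun _ _ (BX * BX)%type _ _ (fun p => if `[< [set p : BX * BX | [/\ Om p.1, Om p.2 & dist S p.1 p.2 < r]] p >] then 0
   else entry i k p.1 p.2)).
  move=> [z w] /set_mem [/= Oz Ow]; rewrite /far_entry; congr (if _ then _ else _).
  by apply/asboolP/asboolP => // -[].
apply: (@measurable_fun_if_out _ (BX * BX)%type R _ _ _ _ mD (entry_measurable i k)).
exact: measurableX.
Qed.

(** The condition on the adjoint gives a row bound C1, a single entry being at most the column sum
    of the adjoint. The condition on T gives the column bound e / C1 once r is large, and Schur's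
    test multiplies the two. *)
Lemma schur_tail (p : R) : (4 - kappa S) / (2 - kappa S) < p ->
  kernel_condition S (adjoint S T) p -> kernel_condition S T p ->
  forall e : R, 0 < e -> exists2 r : R, 0 < r & forall i (F : X -> R),
    (forall w, Om w -> 0 <= F w) -> measurable_fun (Om : set BX) F ->
    (\int[mu]_(z in Om) \sum_(0 <= k <oo)
       (\int[mu]_(w in Om) (far_entry r i k z w * F w)%:E *
        \int[mu]_(w in Om) (far_entry r i k z w * F w)%:E) <=
     e%:E * \int[mu]_(w in Om) (F w ^+ 2)%:E)%E.
Proof.
move=> hp hA hT e e0; have [p2 kt] := kappa_exponent HS hp.
have [t' [b [C0 [t'0 t't C00 rf]]]] := rudin_forelli_weight HS kt.
have bA := adjoint_op HS bT.
have [[C1 C10 h1] _] := kernel_condition_schur HS bA p2 t't C00 rf hA.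
have [_ h2] := kernel_condition_schur HS bT p2 t't C00 rf hT.
have e1 : 0 < e / C1 by exact: divr_gt0.
have [r r0 {}h2] := h2 _ e1; exists r => // i F F0 mF.
set H := fun z : X => nK z `^ (1 - b * (p - 1) / p) in h1 h2.
have H0 z : Om z -> 0 < H z by move=> Oz; rewrite powR_gt0 // (normK_gt0 HS).
have mH : measurable_fun (Om : set BX) H by apply: powR_measurable; exact: normK_measurable.
have [_ _ dC _] := dist_metric HS.
rewrite (_ : e = C1 * (e / C1)); last by rewrite mulrC mulfVK // gt_eqF.
apply: (@schur_test _ BX R mu Om (far_entry r i) H F C1 (e / C1)) => //.
- exact: ltW.
- by move=> k z w _ _; exact: far_entry_ge0.
- by move=> k; exact: far_entry_measurable.
- move=> k z Oz; apply: le_trans (h1 z k Oz).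
  have mc := colsum_measurable HS bA k Oz.
  apply: ge0_le_integral => //.
  + by move=> w Ow; rewrite lee_fin mulr_ge0 ?far_entry_ge0 // ltW // H0.
  + apply/measurable_EFinP; apply: measurable_funM => //.
    exact: (@measurable_fun_pairl _ _ _ BX BX _ Om Om (far_entry r i k) z Oz mOm mOm (far_entry_measurable r i k)).
  + by apply: emeasurable_funM => //; exact/measurable_EFinP.
  move=> w Ow; rewrite EFinM; apply: lee_wpmul2r; first by rewrite lee_fin ltW // H0.
  apply: (@le_trans _ _ (entry i k z w)%:E); first by rewrite lee_fin far_entry_le.
  rewrite /entry -(adjoint_entry HS bT k i Oz Ow) /colsum.
  rewrite (nneseriesD1 (n := i)) //; last by move=> j _; rewrite lee_fin cmod_ge0.
  by rewrite leeDl // nneseries_ge0 // => j _ _; rewrite lee_fin cmod_ge0.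
move=> w Ow; apply: le_trans (h2 w i Ow).
have mc := colsum_measurable HS bT i Ow.
have mD : measurable (dball S w r : set BX) by exact: (dball_borel HS).
rewrite (_ : (\int[mu]_(z in Om) _)%E = (\int[mu]_(z in Om) ((fun z => colsum S T w i z * (H z)%:E) \_ (~` dball S w r)) z)%E).
  by rewrite -integral_mkcondr.
apply: eq_integral => z /set_mem Oz; rewrite patchE in_setC /far_entry dC //.
case: asboolP => h.
  rewrite mem_set //= eseries0 // => k _ _; by rewrite mul0r.
rewrite memNset /=; last by case.
rewrite /colsum muleC -nneseriesZl; last by move=> k _; rewrite lee_fin cmod_ge0.
by apply: eq_eseriesr => k _; rewrite EFinM muleC.
Qed.

End tail.

End schur_tail.

(** * A covering by balls of bounded overlap *)

(** When P says that two points of a sequence are far apart, this builds a maximal separated subset: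
    k is kept when it is far from all indices kept before. *)
Fixpoint greedy (P : nat -> nat -> bool) (m : nat) : seq nat :=
  if m is k.+1 then (if all (P k) (greedy P k) then k :: greedy P k else greedy P k) else [::].

Lemma mem_greedy (P : nat -> nat -> bool) m i :
  (i \in greedy P m) = (i < m)%N && all (P i) (greedy P i).
Proof.
elim: m => [|m IH] //=; rewrite ltnS leq_eqVlt.
case: (boolP (all (P m) (greedy P m))) => h; rewrite ?inE IH; have [->|] //= := eqVneq i m.
by rewrite ltnn /= (negbTE h).
Qed.

Lemma lime_nneseries_le (R : realType) (u : nat -> \bar R) (x : \bar R) :
  (forall k, (0 <= u k)%E) -> (forall m, (\sum_(0 <= k < m) u k <= x)%E) ->
  (\sum_(0 <= k <oo) u k <= x)%E.
Proof.
move=> u0 h; apply: lime_le; first by apply: is_cvg_nneseries => k _ _; exact: u0.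
by apply: nearW => m; exact: h.
Qed.

Section covering.
Variables (R : realType) (n : nat) (S : bergman_data R n) (HS : bergman_type S).
Local Notation X := (cspace R n).
Local Notation BX := (borel_cspace R n).
Local Notation Om := (Omega S).
Local Notation mu := (sigma S).
Local Notation nK := (normK S).

Let Omo : open Om := Omega_open HS.
Let mOm : measurable (Om : set BX) := open_borel Omo.

Let mball z r : Om z -> measurable (dball S z r : set BX).
Proof. exact: (dball_borel HS). Qed.

Lemma lambda_le (A B : set BX) : measurable A -> measurable B -> A `<=` B -> B `<=` Om ->
  (lambda S A <= lambda S B)%E.
Proof.
move=> mA mB AB BO; apply: ge0_subset_integral => //.
- by apply: (measurable_funS mOm BO); apply/measurable_EFinP; exact: normK2_measurable.
- by move=> w _; rewrite lee_fin sqr_ge0.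
Qed.

Lemma dball_Om z r : dball S z r `<=` Om.
Proof. by move=> w []. Qed.

Lemma normK_bounded_dball z r : Om z -> exists M : R, forall w, dball S z r w -> nK w <= M.
Proof.
move=> Oz; pose F (m : nat) := [set w | Om w /\ nK w < m%:R].
have oF m : [set: nat] m -> dopen S (F m).
  move=> _; split; first by move=> w [].
  move=> w [Ow wm]; have e0 : 0 < m%:R - nK w by rewrite subr_gt0.
  have [s s0 h] := normK_continuous HS Ow e0; exists s => // v Bv; split; first by case: Bv.
  by have := h v Bv; rewrite ltr_norml => /andP[_]; rewrite ltrBrDr subrK.
have [|D _ hD] := @dist_proper _ _ _ HS z r Oz nat [set: nat] F oF.
  move=> w [Ow _]; exists (Num.trunc (nK w)).+1 => //; split => //=.
  by rewrite truncnS_gt.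
(* The sum of the indices of the finite subcover stands in for their maximum. *)
exists (\sum_(m <- finmap.enum_fset D) m%:R) => w [Ow /ltW wr].
have [m Dm [_ wm]] := hD w (conj Ow wr).
apply: le_trans (ltW wm) _.
rewrite (big_rem m) //= lerDl; apply: sumr_ge0 => j _; exact: ler0n.
Qed.

Lemma lambda_dball_fin z r : Om z -> (lambda S (dball S z r) < +oo)%E.
Proof.
move=> Oz; have [M hM] := normK_bounded_dball r Oz.
apply: (@le_lt_trans _ _ (\int[mu]_(w in (dball S z r : set BX)) (M ^+ 2)%:E)%E).
  apply: ge0_le_integral; first exact: mball.
  - by move=> w _; rewrite lee_fin sqr_ge0.
  - apply: (measurable_funS mOm (@dball_Om _ _)); apply/measurable_EFinP.
    exact: normK2_measurable.
  - exact: measurable_cst.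
  move=> w Bw; rewrite lee_fin; have k0 := normK_gt0 HS (dball_Om Bw).
  have h := hM w Bw; rewrite lerXn2r // nnegrE ?(ltW k0) //.
  by apply: le_trans h; exact: ltW.
rewrite integral_cst; last exact: mball.
by rewrite lte_mul_pinfty ?lee_fin ?sqr_ge0 // ltey_eq fin_num_measure //; exact: mball.
Qed.

(** If one ball were null, doubling would make all concentric balls of radius 2^k r null, hence
    sigma(Omega) = 0 and |K_z| = 0. *)
Lemma lambda_dball_gt0 z r : Om z -> 0 < r -> (0 < lambda S (dball S z r))%E.
Proof.
move=> Oz r0; have l0 A : (0 <= lambda S A)%E.
  by apply: integral_ge0 => w _; rewrite lee_fin sqr_ge0.
rewrite lt_neqAle l0 andbT eq_sym; apply/eqP => h.
have [C C1 hC] := lambda_doubling HS.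
have hk k : lambda S (dball S z (2 ^+ k * r)) = 0%E.
  elim: k => [|k IH]; first by rewrite expr0 mul1r.
  have := hC z (2 ^+ k * r) Oz; rewrite IH mule0 mulrA -exprS => h1.
  by apply/eqP; rewrite eq_le l0 andbT; apply: h1; rewrite mulr_gt0 // exprn_gt0.
have mb k : measurable (dball S z (2 ^+ k * r) : set BX) by exact: mball.
have [c c0 hc] := normK_lower HS.
have mu0 k : mu (dball S z (2 ^+ k * r) : set BX) = 0%E.
  have : ((c ^+ 2)%:E * mu (dball S z (2 ^+ k * r) : set BX) <= 0)%E.
    rewrite -(hk k) -integral_cst; last exact: mb.
    apply: ge0_le_integral; first exact: mb.
    - by move=> w _; rewrite lee_fin sqr_ge0.
    - exact: measurable_cst.
    - apply: (measurable_funS mOm (@dball_Om _ _)); apply/measurable_EFinP.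
      exact: normK2_measurable.
    move=> w Bw; have h2 := hc w (dball_Om Bw).
    by rewrite lee_fin lerXn2r // nnegrE ltW // (lt_le_trans c0).
  rewrite pmule_rle0 ?lte_fin ?exprn_gt0 // => h2.
  by apply/eqP; rewrite eq_le h2 measure_ge0.
have muO : mu (Om : set BX) = 0%E.
  apply/eqP; rewrite eq_le measure_ge0 andbT.
  have e : (Om : set BX) = \bigcup_k (dball S z (2 ^+ k * r) : set BX).
    apply/seteqP; split => [w Ow|w [k _ []]//].
    pose k := Num.trunc (dist S z w / r); exists k => //; split => //.
    rewrite -ltr_pdivrMr //; apply: lt_le_trans (truncnS_gt _) _.
    by rewrite -natrX ler_nat ltn_expl.
  have h1 : (Om : set BX) `<=` \bigcup_k (dball S z (2 ^+ k * r) : set BX) by rewrite -e.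
  apply: le_trans (measure_sigma_subadditive mu mb mOm h1) _.
  by rewrite eseries0 // => k _ _; exact: mu0.
have := normK_gt0 HS Oz; rewrite /normK /sc_norm /sc_sqnorm.
have [_ aK [mK _]] := kernel_bergman HS Oz.
rewrite (@null_set_integral _ BX) //= ?sqrtr0 ?ltxx //.
by apply/measurable_EFinP; exact: cmeasurable_cmod2.
Qed.

Lemma covering : exists2 N : R, 0 < N & forall rho : R, 0 < rho ->
  exists (z : nat -> X) (F G : nat -> set BX),
   [/\ forall j, [/\ Om (z j), measurable (F j), measurable (G j), F j `<=` Om &
           G j `<=` dball S (z j) (2 * rho)],
       forall j w v, F j w -> Om v -> ~ G j v -> rho <= dist S w v,
       forall g : X -> \bar R, measurable_fun (Om : set BX) g -> (forall w, Om w -> (0 <= g w)%E) ->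
         (\int[mu]_(w in Om) g w = \sum_(0 <= j <oo) \int[mu]_(w in F j) g w)%E
     & forall g : X -> \bar R, measurable_fun (Om : set BX) g -> (forall w, Om w -> (0 <= g w)%E) ->
         (\sum_(0 <= j <oo) \int[mu]_(w in G j) g w <= N%:E * \int[mu]_(w in Om) g w)%E].
Proof.
have [d0 dE dC dT] := dist_metric HS; have [C C1 hC] := lambda_doubling HS.
have C0 : 0 < C by exact: lt_trans C1.
exists (C ^+ 5); first exact: exprn_gt0.
move=> rho rho0; have [a [aO ad]] := dense_dsequence HS.
pose P j i := rho / 2 <= dist S (a j) (a i).
pose sel j := all (P j) (greedy P j).
have selP i j : sel i -> sel j -> i != j -> rho / 2 <= dist S (a i) (a j).
  move=> si sj; rewrite neq_ltn => /orP[] ij.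
    by move/allP: sj => /(_ i); rewrite mem_greedy ij -/(sel i) si dC //; exact.
  by move/allP: si => /(_ j); rewrite mem_greedy ij -/(sel j) sj; exact.
have nselP j : ~~ sel j -> exists2 i, sel i & dist S (a j) (a i) < rho / 2.
  rewrite /sel -has_predC => /hasP[l]; rewrite mem_greedy => /andP[_ si].
  by rewrite /= /P -ltNge => ji; exists l.
pose B j : set BX := if sel j then dball S (a j) rho else set0.
pose G j : set BX := if sel j then dball S (a j) (2 * rho) else set0.
have mB j : measurable (B j) by rewrite /B; case: ifP => _; [exact: mball|exact: measurable0].
have mG j : measurable (G j) by rewrite /G; case: ifP => _; [exact: mball|exact: measurable0].
have GO j : G j `<=` Om by rewrite /G; case: ifP => _ w // [].
have mF := seqDU_measurable mB; pose F := seqDU B.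
have FB j : F j `<=` B j := @subset_seqDU _ B j.
have BO j : B j `<=` Om by rewrite /B; case: ifP => _ w // [].
have FO : \bigcup_j F j = Om.
  rewrite -seqDU_bigcup_eq; apply/seteqP; split => [w [j _]|w Ow]; first exact: BO.
  have r2 : 0 < rho / 2 by rewrite divr_gt0.
  have [j wj] := ad w _ Ow r2; have [sj|nsj] := boolP (sel j).
    by exists j => //; rewrite /B sj; split => //; rewrite dC //; lra.
  have [i si ji] := nselP j nsj.
  exists i => //; rewrite /B si; split => //.
  have := dT (a i) (a j) w (aO i) (aO j) Ow; rewrite (dC (a i) (a j)) // (dC (a j) w) //; lra.
exists a, F, G; split.
- move=> j; split => //; first by move=> w /FB /BO.
  by rewrite /G; case: ifP => // _ w [].
- move=> j w v /FB; rewrite /B /G; case: ifP => // _ [Ow wj] Ov nG.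
  rewrite leNgt; apply/negP => h; apply: nG; split => //.
  by have := dT (a j) w v (aO j) Ow Ov; lra.
- move=> g mg g0; rewrite -{1}FO; apply: ge0_integral_bigcup => //.
  + by rewrite FO.
  + by rewrite FO.
  + exact: trivIset_seqDU.
move=> g mg g0.
under eq_eseriesr => j _ do rewrite -(setIidr (GO j)) integral_mkcondr.
have mGg j : measurable_fun (Om : set BX) (g \_ (G j)).
  apply: (iffLR (@measurable_restrict _ _ BX _ (G j) Om g (mG j) mOm)).
  by apply: measurable_funS mg => // w [].
have g0' j w : Om w -> (0 <= (g \_ (G j)) w)%E by move=> Ow; rewrite patchE; case: ifP => // _; exact: g0.
rewrite -(@integral_nneseries _ BX R mu Om mOm _ mGg g0').
rewrite -(@ge0_integralZl_EFin _ BX R mu Om mOm _ g0 mg _ (ltW (exprn_gt0 5 C0))).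
apply: (@ge0_le_integral _ BX R mu Om mOm).
- by move=> w Ow; apply: nneseries_ge0 => j _ _; exact: g0'.
- by apply: ge0_emeasurable_sum => // j w Ow _; exact: g0'.
- exact: measurable_funeM.
move=> w Ow; apply: lime_nneseries_le => [j|m]; first exact: g0'.
(* The doubled balls that contain w; it remains to bound their number by C^5. *)
pose s := [seq j <- iota 0 m | w \in G j].
have hs j : j \in s -> sel j /\ dist S (a j) w < 2 * rho.
  by rewrite mem_filter => /andP[/set_mem + _]; rewrite /G; case: ifP => // sj [].
have -> : (\sum_(0 <= j < m) (g \_ (G j)) w = \sum_(j <- s) g w)%E.
  by rewrite big_filter /index_iota subn0 [RHS]big_mkcond; apply: eq_bigr => j _; rewrite patchE.
have gs (t : seq nat) : (\sum_(j <- t) g w = (size t)%:R%:E * g w)%E.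
  elim: t => [|j t IH]; first by rewrite big_nil mul0e.
  rewrite big_cons IH /= -natr1 EFinD ge0_muleDl ?lee_fin ?ler0n ?ler01 //.
  by rewrite mul1e addeC.
rewrite gs; apply: lee_wpmul2r; first exact: g0.
have r4 : 0 < rho / 4 by rewrite divr_gt0.
pose E j : set BX := if sel j then dball S (a j) (rho / 4) else set0.
have mE j : measurable (E j) by rewrite /E; case: ifP => _; [exact: mball|exact: measurable0].
have l0 := lambda_dball_gt0 Ow (mulr_gt0 (ltr0n R 3) rho0).
have lfin := lambda_dball_fin (3 * rho) Ow.
have mn2 : measurable_fun (Om : set BX) (fun w => (nK w ^+ 2)%:E).
  by apply/measurable_EFinP; exact: normK2_measurable.
have tI : trivIset [set` s] E.
  move=> i j /= /hs[si _] /hs[sj _] [v []]; rewrite /E si sj => -[Ov vi] [_ vj].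
  apply/eqP/negPn/negP => ij; have := selP i j si sj ij.
  by have := dT (a i) v (a j) (aO i) Ov (aO j); rewrite (dC v (a j)) //; lra.
have EO : \big[setU/set0]_(j <- s) E j `<=` dball S w (3 * rho).
  rewrite -bigcup_seq => v [j /= /hs[sj wj]]; rewrite /E sj => -[Ov vj]; split => //.
  by have := dT w (a j) v Ow (aO j) Ov; rewrite (dC w (a j)) //; lra.
have up : (\sum_(j <- s) lambda S (E j) <= lambda S (dball S w (3 * rho)))%E.
  have us : uniq s by rewrite filter_uniq // iota_uniq.
  rewrite /lambda -(@ge0_integral_bigsetU _ BX R mu _ E (fun w : BX => (nK w ^+ 2)%:E) s mE us tI).
  - apply: lambda_le => //; [exact: bigsetU_measurable|exact: mball|exact: dball_Om].
  - by apply: (measurable_funS mOm _ mn2) => v /EO[].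
  - by move=> v _; rewrite lee_fin sqr_ge0.
have lo j : j \in s -> (lambda S (dball S w (3 * rho)) <= (C ^+ 5)%:E * lambda S (E j))%E.
  move=> /hs[sj wj]; rewrite /E sj.
  (* 2^5 rho/4 = 8 rho, whereas D(w, 3 rho) lies within 5 rho of a j; four doublings would not
     reach. *)
  apply: (@le_trans _ _ (lambda S (dball S (a j) (2 ^+ 5 * (rho / 4))))).
    apply: lambda_le; [exact: mball|exact: mball| |exact: dball_Om].
    move=> v [Ov vw]; split => //.
    by have := dT (a j) w v (aO j) Ow Ov; rewrite !exprS expr0; lra.
  elim: (5)%N => [|k IH]; first by rewrite !expr0 mul1r mul1e.
  rewrite exprS -mulrA [in leRHS]exprS EFinM -muleA.
  apply: le_trans (hC _ _ (aO j) _) _; first by rewrite mulr_gt0 ?exprn_gt0.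
  by apply: lee_wpmul2l => //; rewrite lee_fin ltW.
move: l0 lfin up lo; set L := lambda S (dball S w (3 * rho)).
case: L => [l||//]; rewrite ?ltxx // lte_fin => l0 _ up lo.
(* Adding up [lo] and comparing with [up] gives size(s) l <= C^5 l with 0 < l finite. *)
have key (t : seq nat) : {subset t <= s} -> (((size t)%:R * l)%:E <= (C ^+ 5)%:E * \sum_(j <- t) lambda S (E j))%E.
  have lE j : (0 <= lambda S (E j))%E by apply: integral_ge0 => v _; rewrite lee_fin sqr_ge0.
  elim: t => [|j t IH] ts; first by rewrite big_nil mul0r mule0.
  rewrite big_cons ge0_muleDr ?sume_ge0 //= -natr1 mulrDl mul1r EFinD addeC; apply: leeD.
    by apply: lo; apply: ts; rewrite mem_head.
  by apply: IH => i it; apply: ts; rewrite in_cons it orbT.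
have := le_trans (key s (fun _ h => h)) (lee_wpmul2l _ up).
by rewrite -EFinM !lee_fin => /(_ (ltW (exprn_gt0 5 C0))); rewrite ler_pM2r.
Qed.

End covering.

(** * Compactness by domination *)

Lemma cvg_sum0 (R : realType) (F : nat -> nat -> R) (m : nat) :
  (forall k, F k j @[j --> \oo] --> (0 : R)) ->
  \sum_(0 <= k < m) F k j @[j --> \oo] --> (0 : R).
Proof.
move=> h; elim: m => [|m IH].
  by rewrite (_ : (fun j => _) = fun=> 0); [exact: cvg_cst|apply/funext => j; rewrite big_nil].
rewrite (_ : (fun j => _) = fun j => \sum_(0 <= k < m) F k j + F m j); last first.
  by apply/funext => j; rewrite big_nat_recr.
by rewrite -[X in _ --> X](addr0 (0 : R)); exact: cvgD.
Qed.

Section restriction.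
Variables (R : realType) (n : nat) (S : bergman_data R n) (HS : bergman_type S).
Local Notation X := (cspace R n).
Local Notation BX := (borel_cspace R n).
Local Notation Om := (Omega S).
Local Notation mu := (sigma S).
Local Notation vfun := (X -> nat -> R[i]).
Local Notation K := (Defs.kernel S).
Local Notation vB := (vbergman S).
Local Notation vL := (vL2 S).
Local Notation rdot := (@rdot R n S).
Local Notation nrm := (vnorm S).
Local Notation Kv := (Kv S).
Local Notation proj := (proj S).
Implicit Types f g h F : vfun.

Let Omo : open Om := Omega_open HS.
Let mOm : measurable (Om : set BX) := open_borel Omo.
Let H := bergman_hilbert HS.
Let BL f : vB f -> vL f := @v_bergman_L2 R n S f.

Definition restr (A : set X) f : vfun := fun w k => if `[< A w >] then f w k else 0.

Definition head (m : nat) f : vfun := fun w k => if (k < m)%N then f w k else 0.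

Lemma restr_in A f w : A w -> restr A f w = f w.
Proof. by move=> Aw; apply/funext => k; rewrite /restr; case: asboolP. Qed.

Lemma restr_out A f w : ~ A w -> restr A f w = 0.
Proof. by move=> Aw; apply/funext => k; rewrite /restr; case: asboolP. Qed.

Lemma l2sqnorm_restr A f w : l2sqnorm (restr A f w) = ((fun w => l2sqnorm (f w)) \_ A) w.
Proof.
rewrite patchE; case: ifPn => [/set_mem Aw|/negP Aw]; first by rewrite restr_in.
by rewrite restr_out ?l2sqnorm0 // => Aw'; apply: Aw; exact: mem_set.
Qed.

Lemma v_sqnorm_restr A f : A `<=` Om -> v_sqnorm S (restr A f) = (\int[mu]_(w in (A : set BX)) l2sqnorm (f w))%E.
Proof.
move=> AO; rewrite /v_sqnorm -[in RHS](setIidr AO) integral_mkcondr.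
by apply: eq_integral => w _; rewrite l2sqnorm_restr.
Qed.

Lemma restr_L2 A f : measurable (A : set BX) -> vL f -> vL (restr A f).
Proof.
move=> mA Lf.
have mr k : cmeasurable S (fun w => restr A f w k).
  exact: (cmeasurable_if Omo mA (v_L2_cmeasurable k Lf) (cmeasurable_cst S 0)).
have le w : (l2sqnorm (restr A f w) <= l2sqnorm (f w))%E.
  by rewrite l2sqnorm_restr patchE; case: ifP => // _; exact: l2sqnorm_ge0.
apply/vL2P; split => //.
- by move=> w Ow; apply: le_lt_trans (le w) _; exact: (v_L2_fin Lf).
- apply: le_lt_trans (v_L2_lty Lf); apply: ge0_le_integral => //.
  + by move=> w _; exact: l2sqnorm_ge0.
  + exact: l2sqnorm_measurable.
  + exact: v_L2_measurable.
Qed.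

Lemma l2sqnorm_head m f w : (l2sqnorm (head m f w) <= l2sqnorm (f w))%E.
Proof.
apply: lee_nneseries => k _; first by move=> _; rewrite lee_fin sqr_ge0.
by rewrite lee_fin /head; case: ifP => // _; rewrite cmod0 expr0n sqr_ge0.
Qed.

Lemma head_L2 m f : vL f -> vL (head m f).
Proof.
move=> Lf; have mr k : cmeasurable S (fun w => head m f w k).
  rewrite /head; case: (k < m)%N; [exact: (v_L2_cmeasurable k Lf)|exact: cmeasurable_cst].
apply/vL2P; split => //.
- by move=> w Ow; apply: le_lt_trans (l2sqnorm_head m f w) _; exact: (v_L2_fin Lf).
- apply: le_lt_trans (v_L2_lty Lf); apply: ge0_le_integral => //.
  + by move=> w _; exact: l2sqnorm_ge0.
  + exact: l2sqnorm_measurable.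
  + exact: v_L2_measurable.
  + by move=> w _; exact: l2sqnorm_head.
Qed.

Lemma rdot_eq0 F g : vL F -> vL g ->
  (forall w k, Om w -> F w k = 0 \/ g w k = 0) -> rdot F g = 0.
Proof.
move=> LF Lg h; have := rdot_le Omo LF Lg.
rewrite integral0_eq; last first.
  move=> w Ow; apply: eseries0 => k _ _.
  by case: (h w k Ow) => ->; rewrite cmod0 ?mul0r ?mulr0.
by rewrite lee_fin normr_le0 => /eqP.
Qed.

Lemma rdot_supp F g A : measurable (A : set BX) -> vL F -> vL g ->
  (forall w, Om w -> ~ A w -> F w = 0) -> rdot F g = rdot F (restr A g).
Proof.
move=> mA LF Lg F0; have Lr := restr_L2 mA Lg.
apply/eqP; rewrite -subr_eq0 -(dotBr H Lg Lr LF); apply/eqP.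
apply: (rdot_eq0 LF (v_L2B Omo Lg Lr)) => w k Ow.
have [Aw|nA] := pselect (A w); last by left; rewrite F0.
by right; rewrite -[(_ - _) w k]/(g w k - restr A g w k) restr_in // subrr.
Qed.

Lemma rdot_supp_sqr F g A : measurable (A : set BX) -> A `<=` Om -> vL F -> vL g ->
  (forall w, Om w -> ~ A w -> F w = 0) ->
  ((rdot F g ^+ 2)%:E <= (nrm F ^+ 2)%:E * \int[mu]_(w in (A : set BX)) l2sqnorm (g w))%E.
Proof.
move=> mA AO LF Lg F0; have Lr := restr_L2 mA Lg.
rewrite (rdot_supp mA LF Lg F0) -(v_sqnorm_restr _ AO) -(v_norm_sqr Lr) -EFinM lee_fin.
rewrite -exprMn -real_normK ?num_real //.
rewrite lerXn2r ?nnegrE ?mulr_ge0 ?v_norm_ge0 //; exact: (cauchy_schwarz H LF Lr).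
Qed.

(** The projection acts on each coordinate separately: pairing with a multiple of K_w e_i sees only
    the coordinate i of F. *)
Lemma proj_head F w i m : vL F -> Om w -> (m <= i)%N ->
  (forall u k, Om u -> (m <= k)%N -> F u k = 0) -> proj F w i = 0.
Proof.
move=> LF Ow mi F0; apply: cmod_eq0.
have BP := proj_bergman HS LF; have [c c1 ->] := eval_cmod HS i BP Ow.
have BcK := v_bergmanZ Omo c (Kv_bergman HS i Ow).
rewrite rdotC (proj_dot HS LF BcK) rdotC; apply: (rdot_eq0 LF (BL BcK)) => u k Ou.
have [km|mk] := ltnP k m; last by left; exact: F0.
right; rewrite -[(c *: _) u k]/(c * Kv w i u k) KvE /l2basis.
by rewrite (ltn_eqF (leq_trans km mi)) !mulr0.
Qed.

(** By Cauchy-Schwarz, a coordinate of P F at w has squared modulus at most |F|^2 times this when F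
    vanishes off D(0, r). By symmetry of |K| its integral over w is lambda(D(0, r)), which is
    finite: an integrable dominating function. *)
Definition gamma (r : R) (w : X) : \bar R :=
  (\int[mu]_(u in (dball S (0%R : X) r : set BX)) (cmod (K w u) ^+ 2)%:E)%E.

Lemma kernel_sym z w : Om z -> Om w -> cmod (K z w) = cmod (K w z).
Proof.
move=> Oz Ow; have Bz := Kv_bergman HS 0 Oz; have Bw := Kv_bergman HS 0 Ow.
have e x y : Kv x 0 y 0 = K x y by rewrite KvE /l2basis eqxx mulr1.
rewrite -e -(v_dot_Kv HS 0 Bz Ow) (v_dot_conj HS (BL Bz) (BL Bw)).
by rewrite -[(_^*)%R]/(conjc _) cmodJ (v_dot_Kv HS 0 Bw Oz) e.
Qed.

Lemma kernel2_measurable : measurable_fun ((Om : set BX) `*` (Om : set BX))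
  (fun p : BX * BX => (cmod (K p.1 p.2) ^+ 2)%:E).
Proof.
apply/measurable_EFinP; apply: measurable_funX.
apply: (@eq_measurable_fun _ _ (BX * BX)%type _ _ (fun p : BX * BX => entry S id 0 0 p.1 p.2)).
  move=> [z w] /set_mem [/= Oz Ow].
  by rewrite /entry KvE /l2basis eqxx mulr1 kernel_sym.
exact: (entry_measurable HS (id_op S)).
Qed.

Let mball r : measurable (dball S (0%R : X) r : set BX).
Proof. by apply: (dball_borel HS); exact: Omega0 HS. Qed.

Let kernel2_ballM r : measurable_fun ((Om : set BX) `*` (dball S (0%R : X) r : set BX))
  (fun p : BX * BX => (cmod (K p.1 p.2) ^+ 2)%:E).
Proof.
apply: (@measurable_funS _ _ (BX * BX)%type _ _ _ _ _ _ kernel2_measurable).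
  exact: measurableX.
by move=> [z w] [/= ? []].
Qed.

Lemma gamma_ge0 r w : (0 <= gamma r w)%E.
Proof. by apply: integral_ge0 => u _; rewrite lee_fin sqr_ge0. Qed.

Lemma gamma_measurable r : measurable_fun (Om : set BX) (gamma r).
Proof.
have h0 w u : Om w -> dball S 0 r u -> (0%R <= (cmod (K w u) ^+ 2)%:E)%E.
  by move=> _ _; rewrite lee_fin sqr_ge0.
exact: (tonelli_measurable mu mOm (mball r) h0 (@kernel2_ballM r)).
Qed.

Lemma gamma_integral r : (\int[mu]_(w in Om) gamma r w < +oo)%E.
Proof.
have h0 w u : Om w -> dball S (0%R : X) r u -> (0%R <= (cmod (K w u) ^+ 2)%:E)%E.
  by move=> _ _; rewrite lee_fin sqr_ge0.
rewrite /gamma (@tonelli_on _ _ BX BX R mu mu Om (dball S (0%R : X) r) mOm (mball r)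
   (fun w u => (cmod (K w u) ^+ 2)%:E) h0 (@kernel2_ballM r)).
apply: le_lt_trans (lambda_dball_fin HS r (Omega0 HS)).
rewrite le_eqVlt; apply/orP; left; apply/eqP; apply: eq_integral => u /set_mem[Ou _].
have LK := BL (Kv_bergman HS 0 Ou).
rewrite -(Kv_norm S u 0) (v_norm_sqr LK); apply: eq_integral => w /set_mem Ow.
by rewrite l2sqnorm_Kv kernel_sym.
Qed.

(** A vector orthogonal to the kernels at the points of a dense sequence vanishes there, hence on
    Omega by continuity. The factors 1 and i recover both parts of the value from the real form. *)
Lemma Kv_total : exists e : nat -> vfun, total_in vB rdot (range e) /\
  forall j, exists c z k, Om z /\ e j = c *: Kv z k.
Proof.
have [q qP] := dense_sequence R n.
pose e (j : nat) : vfun := if unpickle j is Some (l, k, b) then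
  (if `[< Om (q l) >] then (if (b : bool) then 1 else 'i : R[i]) *: Kv (q l) k else 0) else 0.
exists e; split; last first.
  move=> j; rewrite /e; case: unpickle => [[[l k] b]|]; last first.
    by exists 0, 0, 0%N; split; [exact: Omega0 HS|rewrite scale0r].
  case: asboolP => Oq; first by eexists; exists (q l), k.
  by exists 0, 0, 0%N; split; [exact: Omega0 HS|rewrite scale0r].
split=> [_ [j _ <-]|g Bg hg].
  rewrite /e; case: unpickle => [[[l k] b]|]; last exact: v_bergman0.
  case: asboolP => Oq; last exact: v_bergman0.
  exact: (v_bergmanZ Omo _ (Kv_bergman HS k Oq)).
have gq l k : Om (q l) -> g (q l) k = 0.
  move=> Oq; have BK := Kv_bergman HS k Oq.
  have h1 := hg _ (ex_intro2 _ _ (pickle (l, k, true)) I erefl).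
  have h2 := hg _ (ex_intro2 _ _ (pickle (l, k, false)) I erefl).
  rewrite /e pickleK in h1; rewrite /e pickleK in h2; move: h1 h2; case: asboolP => // _.
  rewrite scale1r rdotC (rdot_Kv HS k Bg Oq) => h1.
  rewrite rdot_conj -[('i^*)%R]/(conjc 'i) rdotC.
  rewrite (rdot_Kv HS k (v_bergmanZ Omo _ Bg) Oq) -[(_ *: g) _ _]/(conjc 'i * g _ _).
  move: h1; case: (g (q l) k) => x y /= -> h2; congr (_ +i* _).
  by move: h2; lra.
apply/funext => z; apply/funext => k; have [Oz|nz] := pselect (Om z); last first.
  by rewrite (v_bergman_out Bg nz).
apply: contrapT => /eqP gz; have g0 := cmod_gt0 gz.
have := qP (Om `&` [set x | 0 < cmod (g x k)]); case.
- rewrite openE => x [Ox gx]; apply: filterI; first exact: open_nbhs_nbhs.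
  have := analytic_cmod_cvg (v_bergman_analytic k Bg) Ox.
  by move=> /(_ _ (lt_nbhsr gx)).
- by exists z; split.
by move=> l [Ol]; rewrite /= (gq l k Ol) cmod0 ltxx.
Qed.

Lemma l2sqnorm_finite m (a : nat -> R[i]) : (forall k, (m <= k)%N -> a k = 0) ->
  l2sqnorm a = (\sum_(0 <= k < m) cmod (a k) ^+ 2)%:E.
Proof.
move=> a0; rewrite /l2sqnorm (nneseries_split 0 m); last by move=> k _; rewrite lee_fin sqr_ge0.
rewrite add0n eseries0 ?adde0 ?sumEFin // => k mk _.
by rewrite a0 // cmod0 expr0n.
Qed.

(* Weak compactness gives pointwise convergence along a subsequence, which the
   domination turns into convergence in norm. *)
Lemma dominated_compactness (u : nat -> vfun) (M : R) (m : nat) (G : X -> \bar R) :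
  (forall j, vB (u j) /\ nrm (u j) <= M) ->
  (forall j w k, Om w -> (m <= k)%N -> u j w k = 0) ->
  measurable_fun (Om : set BX) G -> (\int[mu]_(w in Om) G w < +oo)%E ->
  (forall j w k, Om w -> ((cmod (u j w k) ^+ 2)%:E <= G w)%E) ->
  exists (s : nat -> nat) (f : vfun),
    [/\ forall j, (s j < s j.+1)%N, vB f & nrm (u (s j) - f) @[j --> \oo] --> (0 : R)].
Proof.
move=> uM u0 mG IG uG; have [e [etot _]] := Kv_total.
have [s [f [sS Bf wn]]] := weak_compactness H etot uM.
exists s, f; split => //.
pose v j := u (s j) - f.
have Bu j : vB (u j) := (uM j).1.
have Bv j : vB (v j) := v_bergmanB Omo (Bu (s j)) Bf.
have cv w k : Om w -> cmod (v j w k) ^+ 2 @[j --> \oo] --> (0 : R).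
  move=> Ow; have BK := Kv_bergman HS k Ow.
  have h1 : complex.Re (v j w k) @[j --> \oo] --> (0 : R).
    have := wn _ BK; rewrite (_ : (fun j => _) = (fun j => complex.Re (v j w k))) //.
    by apply/funext => j; rewrite (rdot_Kv HS k (Bv j) Ow).
  have h2 : complex.Im (v j w k) @[j --> \oo] --> (0 : R).
    have := wn _ (v_bergmanZ Omo 'i BK).
    rewrite (_ : (fun j => _) = (fun j => complex.Im (v j w k))) //.
    apply/funext => j; have -> : ('i : R[i]) = ((conjc 'i)^*)%R.
      by rewrite -[(_^*)%R]/(conjc (conjc 'i)) conjcK.
    rewrite -rdot_conj (rdot_Kv HS k (v_bergmanZ Omo _ (Bv j)) Ow).
    rewrite -[(_ *: _) _ _]/(conjc 'i * v j w k); case: (v j w k) => x y /=; ring.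
  have : complex.Re (v j w k) * complex.Re (v j w k) + complex.Im (v j w k) * complex.Im (v j w k)
      @[j --> \oo] --> (0 * 0 + 0 * 0 : R) by apply: cvgD; exact: cvgM.
  rewrite !mulr0 addr0 (_ : (fun j => _ + _) = (fun j => cmod (v j w k) ^+ 2)) //.
  by apply/funext => j; rewrite cmod_sqr !expr2.
(* For these coordinates v j w k = - f w k does not depend on j, yet tends to 0. *)
have f0 w k : Om w -> (m <= k)%N -> f w k = 0.
  move=> Ow mk; apply: cmod_eq0.
  have := cv w k Ow; rewrite (_ : (fun j => _) = (fun=> cmod (f w k) ^+ 2)).
    by move=> /cvg_lim; rewrite lim_cst // => /(_ (@Rhausdorff _)) /eqP; rewrite sqrf_eq0 => /eqP.
  apply/funext => j; rewrite -[v j w k]/(u (s j) w k - f w k) u0 // sub0r cmodN //.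
have v0 j w k : Om w -> (m <= k)%N -> v j w k = 0.
  by move=> Ow mk; rewrite -[v j w k]/(u (s j) w k - f w k) u0 // f0 // subrr.
(* Only m coordinates survive, so coordinatewise convergence is convergence in l^2. *)
have cl w : Om w -> l2sqnorm (v j w) @[j --> \oo] --> 0%E.
  move=> Ow.
  rewrite (_ : (fun j => _) = (fun j => (\sum_(0 <= k < m) cmod (v j w k) ^+ 2)%:E)).
    apply: cvg_EFin; first by apply: nearW.
    rewrite (_ : fine \o _ = (fun j => \sum_(0 <= k < m) cmod (v j w k) ^+ 2)) //.
    by apply: (@cvg_sum0 R (fun k j => cmod (v j w k) ^+ 2)) => k; exact: cv.
  by apply/funext => j; apply: l2sqnorm_finite => k mk; exact: v0.
have lu j w : Om w -> (l2sqnorm (u j w) <= m%:R%:E * G w)%E.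
  move=> Ow; rewrite (l2sqnorm_finite (m := m)) => [|k mk]; last exact: u0.
  have G0 : (0 <= G w)%E by apply: le_trans (uG 0%N w 0%N Ow); rewrite lee_fin sqr_ge0.
  elim: {u0 f0 v0 cl}m => [|l IH]; first by rewrite big_nil mul0e.
  rewrite big_nat_recr //= -natr1 !EFinD ge0_muleDl ?lee_fin ?ler0n ?ler01 // mul1e.
  exact: leeD IH (uG j w l Ow).
(* |u_j - f|^2 <= 2 |u_j|^2 + 2 |f|^2, and |u_j|^2 has m terms, each at most G. *)
pose g w := (2%:E * (m%:R%:E * G w) + 2%:E * l2sqnorm (f w))%E.
have Lf := BL Bf; have mf := v_L2_measurable Lf.
have G0 w : Om w -> (0 <= G w)%E.
  by move=> Ow; apply: le_trans (uG 0%N w 0%N Ow); rewrite lee_fin sqr_ge0.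
have m0 : (0 <= m%:R%:E :> \bar R)%E by rewrite lee_fin ler0n.
have two0 : (0 <= 2%:E :> \bar R)%E by rewrite lee_fin.
have g10 w : Om w -> (0 <= 2%:E * (m%:R%:E * G w))%E.
  by move=> Ow; exact: (mule_ge0 two0 (mule_ge0 m0 (G0 w Ow))).
have g20 w : Om w -> (0 <= 2%:E * l2sqnorm (f w))%E.
  by move=> _; exact: (mule_ge0 two0 (l2sqnorm_ge0 _)).
have mg1 : measurable_fun (Om : set BX) (fun w => 2%:E * (m%:R%:E * G w))%E.
  by apply: measurable_funeM; apply: measurable_funeM; exact: mG.
have mg2 : measurable_fun (Om : set BX) (fun w => 2%:E * l2sqnorm (f w))%E.
  by apply: measurable_funeM; exact: mf.
have mg : measurable_fun (Om : set BX) g by apply: emeasurable_funD; [exact: mg1|exact: mg2].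
have ig : mu.-integrable (Om : set BX) g.
  apply/integrableP; split; first exact: mg.
  rewrite (@eq_integral _ BX R mu Om g); last first.
    by move=> w /set_mem Ow; rewrite gee0_abs //; exact: (adde_ge0 (g10 w Ow) (g20 w Ow)).
  rewrite (@ge0_integralD _ BX R mu Om mOm _ _ g10 mg1 g20 mg2).
  have two : 0 <= 2 :> R by [].
  have mGm : measurable_fun (Om : set BX) (fun w => m%:R%:E * G w)%E.
    by apply: measurable_funeM; exact: mG.
  rewrite (@ge0_integralZl_EFin _ BX R mu Om mOm _ (fun w Ow => mule_ge0 m0 (G0 w Ow)) mGm 2 two).
  rewrite (@ge0_integralZl_EFin _ BX R mu Om mOm G G0 mG m%:R (ler0n _ _)).
  have e2 := @ge0_integralZl_EFin _ BX R mu Om mOm _ (fun w _ => l2sqnorm_ge0 (f w)) mf 2 two.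
  rewrite e2 lte_add_pinfty // lte_mul_pinfty //; last exact: (v_L2_lty Lf).
  by rewrite lte_mul_pinfty.
have mv j : measurable_fun (Om : set BX) (fun w => l2sqnorm (v j w)).
  exact: v_L2_measurable (BL (Bv j)).
have [||_ _ cI] := @dominated_convergence _ BX R mu Om mOm (fun j w => l2sqnorm (v j w)) (cst 0%E) g mv
  (measurable_cst _) _ ig _.
- by apply: aeW => w Ow; exact: cl.
- apply: aeW => w j Ow; rewrite gee0_abs ?l2sqnorm_ge0 //.
  apply: (@le_trans _ _ (2%:E * l2sqnorm (u (s j) w) + 2%:E * l2sqnorm (f w))%E).
    by rewrite -l2sqnorm_parallelogram leeDr // l2sqnorm_ge0.
  by apply: leeD => //; exact: lee_wpmul2l two0 _ _ (lu (s j) w Ow).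
rewrite integral0 in cI.
have cN : nrm (v j) ^+ 2 @[j --> \oo] --> (0 : R).
  have h : v_sqnorm S (v j) @[j --> \oo] --> (0 : R)%:E by exact: cI.
  have {}h : fine (v_sqnorm S (v j)) @[j --> \oo] --> (0 : R) by apply: fine_cvg; exact: h.
  rewrite (_ : (fun j => _) = (fun j => fine (v_sqnorm S (v j)))) //.
  by apply/funext => j; rewrite -(v_norm_sqr (BL (Bv j))).
have := cvg_comp _ _ cN (@sqrt_continuous R 0); rewrite sqrtr0.
rewrite (_ : Num.sqrt \o _ = (fun j => nrm (v j))) //.
by apply/funext => j /=; rewrite sqrtr_sqr ger0_norm ?v_norm_ge0.
Qed.

End restriction.

(** * Localization near infinity *)

Section localization.
Variables (R : realType) (n : nat) (S : bergman_data R n) (HS : bergman_type S).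
Local Notation X := (cspace R n).
Local Notation BX := (borel_cspace R n).
Local Notation Om := (Omega S).
Local Notation mu := (sigma S).
Local Notation vfun := (X -> nat -> R[i]).
Local Notation vB := (vbergman S).
Local Notation vL := (vL2 S).
Local Notation nrm := (vnorm S).
Local Notation Kv := (Kv S).
Local Notation phi := (phi S).
Local Notation proj := (proj S).
Implicit Types f g h F : vfun.

Let Omo : open Om := Omega_open HS.
Let mOm : measurable (Om : set BX) := open_borel Omo.
Let H := bergman_hilbert HS.
Let BL f : vB f -> vL f := @v_bergman_L2 R n S f.

Lemma comp_op (P Q : vfun -> vfun) : bounded_operator S P -> bounded_operator S Q ->
  bounded_operator S (fun f => P (Q f)).
Proof.
move=> bP bQ; have [MP MP0 hP] := op_bound bP; have [MQ MQ0 hQ] := op_bound bQ.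
split; rewrite -?vbergmanE.
- by move=> f Bf; exact: (opB bP (opB bQ Bf)).
- move=> a f g Bf Bg; rewrite -[X in P (Q X)]/(a *: f + g) (op_lin bQ a Bf Bg).
  by rewrite (op_lin bP a (opB bQ Bf) (opB bQ Bg)).
exists (MP * MQ); rewrite -vnormE => f Bf; apply: le_trans (hP _ (opB bQ Bf)) _.
by rewrite -mulrA; apply: ler_wpM2l; [exact: ltW|exact: hQ].
Qed.

Lemma conj_translation_op (T : vfun -> vfun) z : bounded_operator S T -> Om z ->
  bounded_operator S (conj_translation S T z).
Proof.
move=> bT Oz; have bU := translation_op HS Oz.
exact: (comp_op bU (comp_op bT (adjoint_op HS bU))).
Qed.

Lemma adjoint_translation_bounded : exists2 C : R, 0 < C & forall z f, Om z -> vB f ->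
  nrm (adjoint S (translation S z) f) <= C * nrm f.
Proof.
have [C C0 h] := translation_bounded HS; exists C => // z f Oz Bf.
apply: (adjoint_bound HS (translation_op HS Oz) (ltW C0) _ Bf) => g Bg.
exact: (h z g Oz Bg).2.
Qed.

(* Since phi_z maps balls about z into balls about 0, with radii comparable
   uniformly in z, the dominating function does not depend on z. *)
Lemma adjoint_translation_inv_gamma : exists2 C : R, 0 < C & forall z F (rho : R) w k,
  Om z -> vL F -> Om w -> (forall u, Om u -> ~ dball S z rho u -> F u = 0) ->
  ((cmod (adjoint S (translation_inv S z) (proj F) w k) ^+ 2)%:E <=
    (nrm F ^+ 2)%:E * ((C ^+ 2)%:E * gamma S (C * rho) w))%E.
Proof.
have [C1 C10 hV] := translation_inv_bounded HS; have [C2 C20 hd] := dist_phi HS.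
(* One constant serves both as factor and in the radius; the sum dominates each of the two. *)
exists (C1 + C2) => [|z F rho w k Oz LF Ow F0]; first exact: addr_gt0.
have bV := translation_inv_op HS Oz; have BP := proj_bergman HS LF.
have BA := adjoint_bergman HS bV BP; have BK := Kv_bergman HS k Ow.
have [c c1 ->] := eval_cmod HS k BA Ow.
have BcK := v_bergmanZ Omo c BK; have BV := opB bV BcK.
(* The value becomes the pairing of F with the image of c K_w e_k under U_z^-1, of which only the
   part on D(z, rho) counts. *)
rewrite rdotC -(adjoint_rdot HS bV BcK BP) (proj_dot HS LF BV) rdotC.
have mA : measurable (dball S z rho : set BX) by exact: (dball_borel HS).
have AO : dball S z rho `<=` Om by exact: dball_Om.
apply: le_trans (rdot_supp_sqr HS mA AO LF (BL BV) F0) _.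
apply: lee_wpmul2l; first by rewrite lee_fin sqr_ge0.
have [_ _ h] := hV z _ Oz BcK; apply: le_trans (h _ mA AO) _.
have g0 r : (0 <= gamma S r w)%E := gamma_ge0 S r w.
apply: (@le_trans _ _ ((C1 ^+ 2)%:E * gamma S ((C1 + C2) * rho) w)%E); last first.
  apply: lee_wpmul2r => //; rewrite lee_fin lerXn2r ?nnegrE ?addr_ge0 ?(ltW C10) ?(ltW C20) //.
  by rewrite lerDl ltW.
apply: lee_wpmul2l; first by rewrite lee_fin sqr_ge0.
have mP : measurable (Om `&` phi z @^-1` dball S z rho : set BX).
  by apply: (phi_measurable HS Oz).
have mLK := v_L2_measurable (BL BcK).
have [d0 _ dC _] := dist_metric HS; have O0 := Omega0 HS.
have sub : Om `&` phi z @^-1` dball S z rho `<=` dball S (0%R : X) ((C1 + C2) * rho).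
  move=> u [Ou [Op hu]]; split => //; have [_ h2] := hd z (phi z u) Oz Op.
  rewrite (phi_involution HS) // in h2; rewrite dC //; apply: le_lt_trans h2 _.
  rewrite dC //; apply: le_lt_trans (_ : (C1 + C2) * dist S z (phi z u) < _).
    by apply: ler_wpM2r; [exact: d0|rewrite lerDr ltW].
  by rewrite ltr_pM2l // addr_gt0.
have lE u : l2sqnorm ((c *: Kv w k) u) = (cmod (Defs.kernel S w u) ^+ 2)%:E.
  by rewrite -[(c *: Kv w k) u]/(c *: Kv w k u) l2sqnormZ c1 expr1n mul1e l2sqnorm_Kv.
under eq_integral do rewrite lE.
apply: ge0_subset_integral => //.
- by apply: (dball_borel HS); exact: O0.
- apply: (@eq_measurable_fun _ _ BX _ _ (fun u => l2sqnorm ((c *: Kv w k) u))).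
    by move=> u _; rewrite lE.
  by apply: (measurable_funS mOm _ mLK); exact: dball_Om.
by move=> u _; rewrite lee_fin sqr_ge0.
Qed.

(** U_z^-1 has a scalar weight, so it preserves the coordinates, as does the projection. *)
Lemma adjoint_translation_inv_head z F w k m : Om z -> vL F -> Om w -> (m <= k)%N ->
  (forall u k, Om u -> (m <= k)%N -> F u k = 0) ->
  adjoint S (translation_inv S z) (proj F) w k = 0.
Proof.
move=> Oz LF Ow mk F0.
have bV := translation_inv_op HS Oz; have BP := proj_bergman HS LF.
have BA := adjoint_bergman HS bV BP; have BK := Kv_bergman HS k Ow.
apply: cmod_eq0; have [c c1 ->] := eval_cmod HS k BA Ow.
have BcK := v_bergmanZ Omo c BK; have BV := opB bV BcK.
rewrite rdotC -(adjoint_rdot HS bV BcK BP) (proj_dot HS LF BV) rdotC.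
apply: (rdot_eq0 HS LF (BL BV)) => u l Ou; have [lm|ml] := ltnP l m; last by left; exact: F0.
right; rewrite translation_invE -[(c *: _) _ l]/(c * Kv w k _ l) KvE /l2basis.
by rewrite (ltn_eqF (leq_trans lm mk)) !mulr0 mul0r.
Qed.

(** The middle quantity of (a) is at most b. The radius r depends on f; uniformity over a family of
    f will come from its compactness. *)
Definition berezin_bound (T : vfun -> vfun) (b : R) : Prop :=
  forall f e, vB f -> nrm f <= 1 -> 0 < e -> exists r : R, forall z, Om z -> r < dist S z 0 ->
    nrm (conj_translation S T z f) <= b + e.

Lemma berezin_boundE T b f e : bounded_operator S T -> berezin_bound T b -> vB f -> 0 < e ->
  exists r : R, forall z, Om z -> r < dist S z 0 ->
    nrm (conj_translation S T z f) <= b * nrm f + e.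
Proof.
move=> bT hb Bf e0; have [f0|f0] := eqVneq (nrm f) 0.
  exists 0 => z Oz _; have [M M0 hM] := op_bound (conj_translation_op bT Oz).
  by apply: le_trans (hM f Bf) _; rewrite f0 !mulr0 add0r ltW.
have fp : 0 < nrm f by rewrite lt_neqAle eq_sym f0 v_norm_ge0.
have Bf' := v_bergmanZ Omo ((nrm f)^-1)%:C Bf.
have nf : nrm (((nrm f)^-1)%:C *: f) <= 1.
  by rewrite (v_normZ Omo _ (BL Bf)) cmodR ger0_norm ?invr_ge0 ?(ltW fp) // mulVf.
have [r hr] := hb _ _ Bf' nf (divr_gt0 e0 fp).
exists r => z Oz rz; have := hr z Oz rz.
have bC := conj_translation_op bT Oz.
rewrite (opZ bC _ Bf) (v_normZ Omo _ (BL (opB bC Bf))) cmodR ger0_norm ?invr_ge0 ?(ltW fp) //.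
rewrite mulrC ler_pdivrMr // => h; apply: le_trans h _.
by rewrite mulrDl mulfVK.
Qed.

(** If no r worked, there would be z_j tending to infinity and unit vectors F_j violating the bound.
    Their h_j converge in norm along a subsequence to some g, and as T P F_j is T applied to the
    adjoint of U_{z_j} at h_j, replacing h_j by g contradicts the bound for g. The constant is C3,
    comparing |f| with |U_z f|, times C2, bounding |g|; rho and m influence only r. *)
Lemma localized_bound : exists2 C : R, 0 < C & forall T b, bounded_operator S T -> 0 <= b ->
  berezin_bound T b -> forall (rho : R) (m : nat) (e : R), 0 < e -> exists r : R,
    forall z F, Om z -> r < dist S z 0 -> vL F ->
      (forall u, Om u -> ~ dball S z rho u -> F u = 0) ->
      (forall u k, Om u -> (m <= k)%N -> F u k = 0) ->
      nrm (T (proj F)) <= (C * b + e) * nrm F.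
Proof.
have [C1 C10 hg] := adjoint_translation_inv_gamma.
have [C2 C20 hV] := translation_inv_bounded HS.
have [C3 C30 hU] := nrm_translation_ge HS.
have [C4 C40 hU'] := adjoint_translation_bounded.
exists (C3 * C2); first exact: mulr_gt0.
move=> T b bT b0 hb rho m e e0; have [M M0 hM] := op_bound bT.
apply: contrapT => hn.
have /choice[zF hzF] : forall j : nat, exists zF : X * vfun,
    [/\ Om zF.1, j%:R < dist S zF.1 0, vL zF.2, nrm zF.2 = 1 &
     [/\ forall u, Om u -> ~ dball S zF.1 rho u -> zF.2 u = 0,
      forall u k, Om u -> (m <= k)%N -> zF.2 u k = 0 &
      C3 * C2 * b + e < nrm (T (proj zF.2))]].
  move=> j; apply: contrapT => hj; apply: hn; exists j%:R => z F Oz jz LF F1 F2.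
  rewrite leNgt; apply/negP => hF.
  have BP := proj_bergman HS LF.
  have Fn0 : nrm F != 0.
    apply/eqP => F0; have := hM _ BP; rewrite leNgt => /negP; apply.
    apply: le_lt_trans hF; rewrite F0 mulr0.
    by have := nrm_proj HS LF; rewrite F0 => h; rewrite mulr_ge0_le0 // ltW.
  have Fp : 0 < nrm F by rewrite lt_neqAle eq_sym Fn0 v_norm_ge0.
  have i0 : 0 <= (nrm F)^-1 by rewrite invr_ge0 ltW.
  apply: hj; exists (z, ((nrm F)^-1)%:C *: F); split => //=.
  - exact: (v_L2Z Omo _ LF).
  - by rewrite (v_normZ Omo _ LF) cmodR ger0_norm // mulVf.
  split.
  - by move=> u Ou nu; rewrite -[(_ *: F) u]/(_ *: F u) F1 // scaler0.
  - by move=> u k Ou mk; rewrite -[(_ *: F) u k]/(_ * F u k) F2 // mulr0.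
  rewrite (projZ HS _ LF) (opZ bT _ BP) (v_normZ Omo _ (BL (opB bT BP))) cmodR ger0_norm //.
  by rewrite [ltRHS]mulrC ltr_pdivlMr.
pose z j := (zF j).1; pose F j := (zF j).2.
pose h j := adjoint S (translation_inv S (z j)) (proj (F j)).
have Oz j : Om (z j) by have [] := hzF j.
have LF j : vL (F j) by have [] := hzF j.
have BP j : vB (proj (F j)) := proj_bergman HS (LF j).
have Bh j : vB (h j) := adjoint_bergman HS (translation_inv_op HS (Oz j)) (BP j).
have nF j : nrm (F j) = 1 by have [] := hzF j.
have nh j : nrm (h j) <= C2.
  have hVj g : vB g -> nrm (translation_inv S (z j) g) <= C2 * nrm g.
    by move=> Bg; have [] := hV _ g (Oz j) Bg.
  apply: le_trans (adjoint_bound HS (translation_inv_op HS (Oz j)) (ltW C20) hVj (BP j)) _.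
  by have := nrm_proj HS (LF j); rewrite nF => ?; rewrite ler_piMr // ltW.
have [|||||s [g [sS Bg cg]]] := @dominated_compactness _ _ _ HS h C2 m
    (fun w => (C1 ^+ 2)%:E * gamma S (C1 * rho) w)%E.
- by move=> j; split.
- move=> j w k Ow mk; have [_ _ _ _ [_ F2 _]] := hzF j.
  exact: adjoint_translation_inv_head (Oz j) (LF j) Ow mk F2.
- by apply: measurable_funeM; exact: gamma_measurable.
- rewrite (@ge0_integralZl_EFin _ BX R mu Om mOm _ (fun w _ => gamma_ge0 S (C1 * rho) w)
    (gamma_measurable HS (C1 * rho)) _ (sqr_ge0 C1)).
  by rewrite lte_mul_pinfty ?lee_fin ?sqr_ge0 //; exact: gamma_integral.
- move=> j w k Ow; have [_ _ _ _ [F1 _ _]] := hzF j.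
  by have := hg (z j) (F j) rho w k (Oz j) (LF j) Ow F1; rewrite nF expr1n mul1e.
have ng : nrm g <= C2.
  apply/ler_addgt0Pr => d d0.
  have /cvgr0Pnorm_lt /(_ d d0)[N _ hN] := cg; have := hN N (leqnn N).
  rewrite ger0_norm ?v_norm_ge0 // => hd.
  have -> : g = h (s N) - (h (s N) - g) by rewrite opprB addrC subrK.
  apply: le_trans (nrmB H (BL (Bh _)) (BL (v_bergmanB Omo (Bh _) Bg))) _.
  by apply: lerD; [exact: nh|exact: ltW].
(* The errors from the limsup at g and from replacing h_j by g are each at most e/3, leaving e/3 for
   the contradiction. *)
have e3 : 0 < e / (3 * C3) by rewrite divr_gt0 // mulr_gt0.
have [r hr] := berezin_boundE bT hb Bg e3.
have e4 : 0 < e / (3 * (M * C4)) by rewrite divr_gt0 ?mulr_gt0.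
have /cvgr0Pnorm_lt /(_ _ e4)[N _ hN] := cg.
pose j := maxn N (Num.trunc `|r|).+1.
have := hN j (leq_maxl _ _); rewrite /= ger0_norm ?v_norm_ge0 // => hj.
have [_ zj _ _ [_ _ big]] := hzF (s j).
have rz : r < dist S (z (s j)) 0.
  apply: lt_trans zj; apply: le_lt_trans (ler_norm r) _; apply: lt_le_trans (truncnS_gt _) _.
  by rewrite ler_nat (leq_trans _ (subseq_ge sS j)) // leq_maxr.
have Ozj := Oz (s j); have hz := hr _ Ozj rz.
have bU := adjoint_op HS (translation_op HS Ozj).
have eP : proj (F (s j)) = adjoint S (translation S (z (s j))) (h (s j)).
  by rewrite /h (adjoint_translationK HS Ozj (BP _)).
have addKB (x y : vfun) : x = y + (x - y) by rewrite addrC subrK.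
have eh := addKB (h (s j)) g.
have Bd := v_bergmanB Omo (Bh (s j)) Bg.
rewrite -/(F (s j)) eP eh (opD bU Bg Bd) (opD bT (opB bU Bg) (opB bU Bd)) in big.
have t1 : nrm (T (adjoint S (translation S (z (s j))) g)) <= C3 * (b * nrm g + e / (3 * C3)).
  apply: le_trans (hU _ _ Ozj (opB bT (opB bU Bg))) _.
  by apply: ler_wpM2l; [exact: ltW|exact: hz].
have t2 : nrm (T (adjoint S (translation S (z (s j))) (h (s j) - g))) <= e / 3.
  apply: le_trans (hM _ (opB bU Bd)) _.
  apply: le_trans (ler_wpM2l (ltW M0) (hU' _ _ Ozj Bd)) _.
  rewrite mulrA; apply: le_trans (ler_wpM2l _ (ltW hj)) _; first by rewrite mulr_ge0 // ltW.
  by rewrite le_eqVlt; apply/orP; left; apply/eqP; field; rewrite !gt_eqF.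
have t3 := nrmD H (BL (opB bT (opB bU Bg))) (BL (opB bT (opB bU Bd))).
have t4 : C3 * (b * nrm g + e / (3 * C3)) <= C3 * C2 * b + e / 3.
  rewrite mulrDr; apply: lerD; last first.
    by rewrite le_eqVlt; apply/orP; left; apply/eqP; field; rewrite gt_eqF.
  by rewrite -mulrA ler_pM2l // [C2 * b]mulrC; exact: ler_wpM2l.
have absurd (q x y v p' : R) : q + e < x -> x <= y + v -> y <= p' -> p' <= q + e / 3 -> v <= e / 3 -> False.
  by move: e0; clear; lra.
exact: (absurd _ _ _ _ _ big t3 t1 t4 t2).
Qed.

End localization.

(** * The essential norm *)

(** Iterates (a + b)^2 <= 2 a^2 + 2 b^2. The crude factor is harmless because m is fixed before the
    small parameter is chosen. *)
Lemma sqr_sum_le (R : realType) (x : nat -> \bar R) (m : nat) : (forall i, (0 <= x i)%E) ->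
  ((\sum_(0 <= i < m) x i) * (\sum_(0 <= i < m) x i) <=
   (2 ^+ m)%:E * \sum_(0 <= i < m) x i * x i)%E.
Proof.
move=> x0; have sq (a b : \bar R) : (0 <= a)%E -> (0 <= b)%E ->
    ((a + b) * (a + b) <= 2%:E * (a * a) + 2%:E * (b * b))%E.
  case: a => [a||//] a0; case: b => [b||//] b0 //=.
  - rewrite -[leLHS]/(((a + b) * (a + b))%:E) -[leRHS]/((2 * (a * a) + 2 * (b * b))%:E) lee_fin; have := sqr_ge0 (a - b); rewrite !expr2; lra.
  - rewrite mulyy gt0_muley ?lte_fin // addey ?leey //; by rewrite -!EFinM.
  - rewrite mulyy gt0_muley ?lte_fin // addye ?leey //; by rewrite -!EFinM.
  - by rewrite mulyy gt0_muley ?lte_fin // addye ?leey.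
elim: m => [|m IH]; first by rewrite !big_nil !mule0.
rewrite !big_nat_recr //=; apply: le_trans (sq _ _ _ (x0 m)) _; first exact: sume_ge0.
have xx i : (0 <= x i * x i)%E by exact: mule_ge0.
have s0 : (0 <= \sum_(0 <= i < m) x i * x i)%E by apply: sume_ge0 => i _; exact: xx.
rewrite ge0_muleDr //; apply: leeD.
  by rewrite exprS EFinM -muleA; apply: lee_wpmul2l IH; rewrite lee_fin.
apply: lee_wpmul2r; first exact: xx.
by rewrite lee_fin exprS ler_peMr // exprn_ege1 // ler1n.
Qed.

Section essential_norm.
Variables (R : realType) (n : nat) (S : bergman_data R n) (HS : bergman_type S).
Local Notation X := (cspace R n).
Local Notation BX := (borel_cspace R n).
Local Notation Om := (Omega S).
Local Notation mu := (sigma S).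
Local Notation vfun := (X -> nat -> R[i]).
Local Notation vB := (vbergman S).
Local Notation vL := (vL2 S).
Local Notation nrm := (vnorm S).
Local Notation proj := (proj S).
Implicit Types f g h F : vfun.

Let Omo : open Om := Omega_open HS.
Let mOm : measurable (Om : set BX) := open_borel Omo.
Let BL f : vB f -> vL f := @v_bergman_L2 R n S f.

Section far.
Variables (T : vfun -> vfun) (bT : bounded_operator S T).

Definition far_int (rho : R) g (i k : nat) (w : X) : \bar R :=
  (\int[mu]_(v in Om) (far_entry S T rho i k w v * cmod (g v i))%:E)%E.

Lemma far_int_ge0 rho g i k w : (0 <= far_int rho g i k w)%E.
Proof. by apply: integral_ge0 => v _; rewrite lee_fin mulr_ge0 ?far_entry_ge0 ?cmod_ge0. Qed.

Let far_measurable rho g i k : vL g ->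
  measurable_fun ((Om : set BX) `*` (Om : set BX))
    (fun p : BX * BX => (far_entry S T rho i k p.1 p.2 * cmod (g p.2 i))%:E).
Proof.
move=> Lg; apply/measurable_EFinP; apply: measurable_funM; first exact: far_entry_measurable.
exact: (@measurable_fun_sndX _ _ _ BX BX R Om Om (fun v => cmod (g v i)) mOm mOm
  (cmeasurable_cmod (v_L2_cmeasurable i Lg))).
Qed.

Lemma far_int_measurable rho g i k : vL g -> measurable_fun (Om : set BX) (far_int rho g i k).
Proof.
move=> Lg; have h0 w v : Om w -> Om v -> (0%R <= (far_entry S T rho i k w v * cmod (g v i))%:E)%E.
  by move=> _ _; rewrite lee_fin mulr_ge0 ?far_entry_ge0 ?cmod_ge0.
exact: (tonelli_measurable mu mOm mOm h0 (@far_measurable rho g i k Lg)).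
Qed.

(** A pointwise majorant of the far part of |T P g|^2. It depends on g alone and not on the ball
    removed around w, so that its integrals over the disjoint sets F j add up. *)
Definition far_sqr rho g m (w : X) : \bar R :=
  ((2 ^+ m)%:E * \sum_(0 <= i < m) \sum_(0 <= k <oo) far_int rho g i k w * far_int rho g i k w)%E.

Let far_sqr_in i (rho : R) g w : (0 <= \sum_(0 <= k <oo) far_int rho g i k w * far_int rho g i k w)%E.
Proof. by apply: nneseries_ge0 => k _ _; apply: mule_ge0; exact: far_int_ge0. Qed.

Let far_sqr_inm i (rho : R) g : vL g -> measurable_fun (Om : set BX)
  (fun w => \sum_(0 <= k <oo) far_int rho g i k w * far_int rho g i k w)%E.
Proof.
move=> Lg; apply: ge0_emeasurable_sum => [k w _ _|k _]; first by apply: mule_ge0; exact: far_int_ge0.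
by apply: emeasurable_funM; exact: far_int_measurable.
Qed.

Lemma far_sqr_ge0 rho g m w : (0 <= far_sqr rho g m w)%E.
Proof. by apply: mule_ge0; [rewrite lee_fin exprn_ge0|apply: sume_ge0 => i _; exact: far_sqr_in]. Qed.

Lemma far_sqr_measurable rho g m : vL g -> measurable_fun (Om : set BX) (far_sqr rho g m).
Proof.
by move=> Lg; apply: measurable_funeM; apply: emeasurable_sum => i; exact: far_sqr_inm.
Qed.

(** Since g' vanishes within rho of w, only far entries contribute at w, and there |g'| may be
    replaced by |g|. *)
Lemma far_part_le rho g g' m w : vL g -> vL g' -> Om w ->
  (forall v i, Om v -> cmod (g' v i) <= cmod (g v i)) ->
  (forall v, Om v -> dist S w v < rho -> g' v = 0) ->
  (forall v i, Om v -> (m <= i)%N -> g' v i = 0) ->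
  (l2sqnorm (T (proj g') w) <= far_sqr rho g m w)%E.
Proof.
move=> Lg Lg' Ow gg g0 gm.
have pt k : ((cmod (T (proj g') w k))%:E <= \sum_(0 <= i < m) far_int rho g i k w)%E.
  apply: le_trans (op_proj_entry HS bT k Lg' Ow) _.
  have f0 i v : Om v -> (0 <= (far_entry S T rho i k w v * cmod (g v i))%:E)%E.
    by move=> _; rewrite lee_fin mulr_ge0 ?far_entry_ge0 ?cmod_ge0.
  have mf i : measurable_fun (Om : set BX) (fun v => (far_entry S T rho i k w v * cmod (g v i))%:E).
    exact: (@measurable_fun_pairl _ _ _ BX BX _ Om Om (fun w v => (far_entry S T rho i k w v * cmod (g v i))%:E)
       w Ow mOm mOm (@far_measurable rho g i k Lg)).
  rewrite -(@ge0_integral_sum _ BX R mu Om mOm _ _ mf f0 (index_iota 0 m)).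
  apply: (@ge0_le_integral _ BX R mu Om mOm).
  - by move=> v _; apply: nneseries_ge0 => i _ _; rewrite lee_fin mulr_ge0 ?cmod_ge0.
  - apply: ge0_emeasurable_sum => [i v _ _|i _]; first by rewrite lee_fin mulr_ge0 ?cmod_ge0.
    apply/measurable_EFinP; apply: measurable_funM.
      exact: (cmeasurable_cmod (v_L2_cmeasurable i Lg')).
    exact: (@measurable_fun_pairl _ _ _ BX BX _ Om Om (entry S T i k) w Ow mOm mOm (entry_measurable HS bT i k)).
  - by apply: emeasurable_sum => i; exact: mf.
  move=> v Ov; rewrite (nneseries_split 0 m); last by move=> i _; rewrite lee_fin mulr_ge0 ?cmod_ge0.
  rewrite add0n eseries0 ?adde0; last by move=> i mi _; rewrite gm // cmod0 mul0r.
  apply: lee_sum => i _; rewrite lee_fin /far_entry.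
  case: asboolP => hd; first by rewrite g0 // cmod0 !mul0r.
  by rewrite mulrC; apply: ler_wpM2l; [exact: entry_ge0|exact: gg].
have sq k : ((cmod (T (proj g') w k) ^+ 2)%:E <=
    (2 ^+ m)%:E * \sum_(0 <= i < m) far_int rho g i k w * far_int rho g i k w)%E.
  apply: le_trans (sqr_sum_le m (fun i => far_int_ge0 rho g i k w)).
  rewrite expr2 EFinM; apply: lee_pmul => //; rewrite lee_fin cmod_ge0 //.
apply: (@le_trans _ _ (\sum_(0 <= k <oo) ((2 ^+ m)%:E * \sum_(0 <= i < m) far_int rho g i k w * far_int rho g i k w))%E).
  by apply: lee_nneseries => k _ //; rewrite lee_fin sqr_ge0.
have ff i k : (0 <= far_int rho g i k w * far_int rho g i k w)%E by apply: mule_ge0; exact: far_int_ge0.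
rewrite nneseriesZl; last by move=> k _; apply: sume_ge0 => i _; exact: ff.
apply: lee_wpmul2l; first by rewrite lee_fin exprn_ge0.
rewrite le_eqVlt; apply/orP; left; apply/eqP.
elim: (m) => [|l IH]; first by rewrite big_nil eseries0 // => k _ _; rewrite big_nil.
rewrite big_nat_recr //= -IH -nneseriesD; last first.
- by move=> k _ _; exact: ff.
- by move=> k _ _; apply: sume_ge0 => i _; exact: ff.
by apply: eq_eseriesr => k _; rewrite big_nat_recr.
Qed.

Lemma far_sqr_integral rho g m e : 0 <= e -> vL g ->
  (forall i (F : X -> R), (forall w, Om w -> 0 <= F w) -> measurable_fun (Om : set BX) F ->
    (\int[mu]_(z in Om) \sum_(0 <= k <oo)
       (\int[mu]_(w in Om) (far_entry S T rho i k z w * F w)%:E *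
        \int[mu]_(w in Om) (far_entry S T rho i k z w * F w)%:E) <=
     e%:E * \int[mu]_(w in Om) (F w ^+ 2)%:E)%E) ->
  (\int[mu]_(w in Om) far_sqr rho g m w <= (2 ^+ m * (m%:R * e) * nrm g ^+ 2)%:E)%E.
Proof.
move=> e0 Lg h; have p0 : 0 <= 2 ^+ m :> R by rewrite exprn_ge0.
have s0 w : Om w -> (0 <= \sum_(0 <= i < m) \sum_(0 <= k <oo) far_int rho g i k w * far_int rho g i k w)%E.
  by move=> _; apply: sume_ge0 => i _; exact: far_sqr_in.
have ms : measurable_fun (Om : set BX)
   (fun w => \sum_(0 <= i < m) \sum_(0 <= k <oo) far_int rho g i k w * far_int rho g i k w)%E.
  by apply: emeasurable_sum => i; exact: far_sqr_inm.
rewrite /far_sqr (@ge0_integralZl_EFin _ BX R mu Om mOm _ s0 ms _ p0).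
rewrite -mulrA EFinM; apply: lee_wpmul2l; first by rewrite lee_fin.
rewrite (@ge0_integral_sum _ BX R mu Om mOm _ _ (fun i => @far_sqr_inm i rho g Lg)
  (fun i w _ => @far_sqr_in i rho g w) (index_iota 0 m)).
have one i : (\int[mu]_(w in Om) \sum_(0 <= k <oo) (far_int rho g i k w * far_int rho g i k w) <=
    (e * nrm g ^+ 2)%:E)%E.
  have mg := cmeasurable_cmod (v_L2_cmeasurable i Lg).
  apply: le_trans (h i (fun v => cmod (g v i)) (fun v _ => cmod_ge0 _) mg) _.
  rewrite EFinM; apply: lee_wpmul2l; first by rewrite lee_fin.
  rewrite (v_norm_sqr Lg); apply: (@ge0_le_integral _ BX R mu Om mOm).
  - by move=> v _; rewrite lee_fin sqr_ge0.
  - by apply/measurable_EFinP; apply: measurable_funX.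
  - exact: v_L2_measurable.
  move=> v _; rewrite /l2sqnorm (nneseriesD1 (n := i)) //; last by move=> j _; rewrite lee_fin sqr_ge0.
  by rewrite leeDl // nneseries_ge0 // => j _ _; rewrite lee_fin sqr_ge0.
elim: (m) => [|l IH]; first by rewrite big_nil mul0r mul0r.
rewrite big_nat_recr //= -natr1 mulrDl mul1r mulrDl EFinD; exact: leeD IH (one l).
Qed.

End far.

(* The kernel entries at distance at least rho are small by Schur's test; the rest is
   localized to balls of radius 2 rho, whose overlap N does not depend on rho. *)
Lemma far_bound : exists2 C : R, 0 < C & forall T b p, bounded_operator S T -> 0 <= b ->
  berezin_bound S T b -> (4 - kappa S) / (2 - kappa S) < p ->
  kernel_condition S (adjoint S T) p -> kernel_condition S T p ->
  forall (m : nat) (e : R), 0 < e -> exists r : R, forall g, vL g ->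
    (forall w, Om w -> dist S w 0 < r -> g w = 0) ->
    (forall w k, Om w -> (m <= k)%N -> g w k = 0) ->
    nrm (T (proj g)) <= (C * b + e) * nrm g.
Proof.
have [N N0 hcov] := covering HS; have [C0 C00 hloc] := localized_bound HS.
(* The factor 2 comes from splitting a square of a sum in two, and N from the overlap. *)
pose s2 := Num.sqrt (2 * N); have s20 : 0 < s2 by rewrite sqrtr_gt0 mulr_gt0.
exists (s2 * C0); first exact: mulr_gt0.
move=> T b p bT b0 hb hp hA hT m e e0.
pose K2 : R := 2 ^+ m * m%:R.
have K20 : 0 <= K2 by rewrite mulr_ge0 ?exprn_ge0 ?ler0n.
(* With these choices s2 e1 = e/2 and 2 K2 e2 <= (e/2)^2; K2 + 1 avoids dividing by 0 when m = 0. *)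
pose e1 := e / (2 * s2); have e10 : 0 < e1 by rewrite divr_gt0 ?mulr_gt0.
pose e2 := (e / 2) ^+ 2 / (2 * (K2 + 1)).
have e20 : 0 < e2 by rewrite divr_gt0 ?exprn_gt0 ?mulr_gt0 ?divr_gt0 // ltr_wpDl.
have [rho rho0 hsch] := schur_tail HS bT hp hA hT e20.
have [z [F [G [hFG hsep hF hG]]]] := hcov rho rho0.
have [r0 hr0] := hloc T b bT b0 hb (2 * rho) m e1 e10.
(* A ball G j whose center is within r0 of 0 then lies where g vanishes, and all other balls are
   covered by the localized bound. *)
exists (r0 + 2 * rho) => g Lg g0 gm.
pose L := C0 * b + e1.
have L0 : 0 <= L by apply: addr_ge0 (mulr_ge0 (ltW C00) b0) (ltW e10).
have [d0 _ dC dT] := dist_metric HS; have O0 := Omega0 HS.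
have BP := proj_bergman HS Lg; have Bh := opB bT BP.
pose x j := restr (G j) g.
have Lx j : vL (x j) by have [_ _ mG _ _] := hFG j; exact: (restr_L2 HS mG Lg).
have GO j : G j `<=` Om.
  by have [_ _ _ _ h] := hFG j; apply: (subset_trans h); exact: dball_Om.
have xG j : v_sqnorm S (x j) = (\int[mu]_(w in G j) l2sqnorm (g w))%E.
  exact: (v_sqnorm_restr g (GO j)).
have Tx j : nrm (T (proj (x j))) <= L * nrm (x j).
  have [Oz _ _ _ Gz] := hFG j; have [far|near] := ltP r0 (dist S (z j) 0).
    apply: (hr0 (z j) (x j) Oz far (Lx j)).
    - by move=> u Ou nu; apply: restr_out => Gu; apply: nu; exact: Gz.
    - by move=> u k Ou mk; rewrite /x /restr; case: asboolP => // _; exact: gm.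
  have x0 : nrm (x j) = 0.
    apply/eqP; rewrite -sqrf_eq0; apply/eqP; apply: EFin_inj; rewrite (v_norm_sqr (Lx j)) xG.
    apply: integral0_eq => w Gw; have Ow := GO j w Gw.
    rewrite g0 ?l2sqnorm0 //; have [_ zw] := Gz w Gw.
    have := dT w (z j) 0 Ow Oz O0; rewrite (dC w (z j)) // => h.
    by apply: le_lt_trans h _; rewrite addrC; exact: ler_ltD.
  have [M M0 hM] := op_bound bT; have BPx := proj_bergman HS (Lx j).
  apply: le_trans (hM _ BPx) _; rewrite x0 mulr0; have := nrm_proj HS (Lx j); rewrite x0 => h.
  by rewrite mulr_ge0_le0 // ltW.
have Ly j : vL (g - x j) := v_L2B Omo Lg (Lx j).
have Ba j := opB bT (proj_bergman HS (Lx j)).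
have Bb j := opB bT (proj_bergman HS (Ly j)).
have addKB (u v : vfun) : u = v + (u - v) by rewrite addrC subrK.
have hab j : T (proj g) = T (proj (x j)) + T (proj (g - x j)).
  rewrite -(opD bT (proj_bergman HS (Lx j)) (proj_bergman HS (Ly j))) -(projD HS (Lx j) (Ly j)).
  by rewrite -addKB.
have ypt j w : F j w -> (l2sqnorm (T (proj (g - x j)%R) w) <= far_sqr T rho g m w)%E.
  move=> Fw; have [_ _ _ FO _] := hFG j; have Ow := FO w Fw.
  apply: (far_part_le bT Lg (Ly j) Ow) => [v i Ov|v Ov wv|v i Ov mi].
  - rewrite -[(g - x j) v i]/(g v i - x j v i) /x /restr.
    by case: asboolP => _; rewrite ?subr0 // subrr cmod0 cmod_ge0.
  - have Gv : G j v by apply: contrapT => nG; have := hsep j w v Fw Ov nG; rewrite leNgt wv.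
    by rewrite -[(g - x j) v]/(g v - x j v) /x restr_in // subrr.
  - rewrite -[(g - x j) v i]/(g v i - x j v i) /x /restr gm //.
    by case: asboolP => _; rewrite subr0.
have mfs := far_sqr_measurable bT rho m Lg.
have two0 : (0 <= 2%:E :> \bar R)%E by rewrite lee_fin.
have mlh := v_L2_measurable (BL Bh).
have mlg := v_L2_measurable Lg.
have part j : (\int[mu]_(w in F j) l2sqnorm (T (proj g) w) <=
    (2 * L ^+ 2)%:E * \int[mu]_(w in G j) l2sqnorm (g w) +
    2%:E * \int[mu]_(w in F j) far_sqr T rho g m w)%E.
  have [Oz mF mG FO _] := hFG j.
  have mla := measurable_funS mOm FO (v_L2_measurable (BL (Ba j))).
  have mfF := measurable_funS mOm FO mfs.
  pose f1 w := (2%:E * l2sqnorm (T (proj (x j)) w))%E.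
  pose f2 w := (2%:E * far_sqr T rho g m w)%E.
  have f10 w : F j w -> (0 <= f1 w)%E := fun _ => mule_ge0 two0 (l2sqnorm_ge0 _).
  have f20 w : F j w -> (0 <= f2 w)%E := fun _ => mule_ge0 two0 (far_sqr_ge0 T rho g m w).
  have mf1 : measurable_fun (F j) f1 by apply: measurable_funeM; exact: mla.
  have mf2 : measurable_fun (F j) f2 by apply: measurable_funeM; exact: mfF.
  apply: (@le_trans _ _ (\int[mu]_(w in F j) (f1 w + f2 w))%E).
    apply: (@ge0_le_integral _ BX R mu (F j) mF).
    - by move=> w _; exact: l2sqnorm_ge0.
    - exact: measurable_funS mOm FO mlh.
    - by apply: emeasurable_funD; [exact: mf1|exact: mf2].
    move=> w Fw; rewrite (hab j).
    apply: (@le_trans _ _ (2%:E * l2sqnorm (T (proj (x j)) w) + 2%:E * l2sqnorm (T (proj (g - x j)%R) w))%E).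
      by rewrite -l2sqnorm_parallelogram leeDl // l2sqnorm_ge0.
    by apply: leeD; [exact: lexx|apply: lee_wpmul2l two0 _ _ (ypt j w Fw)].
  rewrite (@ge0_integralD _ BX R mu (F j) mF f1 f2 f10 mf1 f20 mf2); apply: leeD; last first.
    by rewrite (@ge0_integralZl_EFin _ BX R mu (F j) mF _ (fun w _ => far_sqr_ge0 T rho g m w) mfF 2).
  rewrite (@ge0_integralZl_EFin _ BX R mu (F j) mF _ (fun w _ => l2sqnorm_ge0 _) mla 2) //.
  rewrite EFinM -muleA; apply: lee_wpmul2l => //.
  apply: (@le_trans _ _ (v_sqnorm S (T (proj (x j))))).
    by apply: ge0_subset_integral => //; [exact: v_L2_measurable (BL (Ba j))|move=> w _; exact: l2sqnorm_ge0].
  rewrite -xG -(v_norm_sqr (BL (Ba j))) -(v_norm_sqr (Lx j)) -EFinM lee_fin -exprMn.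
  by rewrite lerXn2r // nnegrE ?mulr_ge0 ?v_norm_ge0.
have h1 := hF _ mlh (fun w _ => l2sqnorm_ge0 _).
have h2 := hF _ mfs (fun w _ => far_sqr_ge0 T rho g m w).
have h3 := hG _ mlg (fun w _ => l2sqnorm_ge0 _).
have h4 := far_sqr_integral bT m (ltW e20) Lg hsch.
have LL : 0 <= 2 * L ^+ 2 by rewrite mulr_ge0 ?sqr_ge0.
have LLe : (0 <= (2 * L ^+ 2)%:E)%E by rewrite lee_fin.
have i1 j : (0 <= \int[mu]_(w in G j) l2sqnorm (g w))%E by apply: integral_ge0 => w _; exact: l2sqnorm_ge0.
have i2 j : (0 <= \int[mu]_(w in F j) far_sqr T rho g m w)%E by apply: integral_ge0 => w _; exact: far_sqr_ge0.
have tot : (v_sqnorm S (T (proj g)) <= ((2 * N * L ^+ 2 + 2 * (K2 * e2)) * nrm g ^+ 2)%:E)%E.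
  rewrite /v_sqnorm h1.
  apply: (@le_trans _ _ (\sum_(0 <= j <oo) ((2 * L ^+ 2)%:E * \int[mu]_(w in G j) l2sqnorm (g w) +
    2%:E * \int[mu]_(w in F j) far_sqr T rho g m w))%E).
    by apply: lee_nneseries => j _; [move=> _; apply: integral_ge0 => w _; exact: l2sqnorm_ge0|exact: part].
  rewrite nneseriesD; last 2 first.
  - by move=> j _ _; exact: mule_ge0.
  - by move=> j _ _; exact: mule_ge0.
  rewrite !nneseriesZl //.
  have spl (A B y : R) : ((A + B) * y)%:E = ((A * y)%:E + (B * y)%:E)%E by rewrite mulrDl EFinD.
  rewrite -h2 (spl (2 * N * L ^+ 2) (2 * (K2 * e2)) (nrm g ^+ 2)); apply: leeD.
    apply: le_trans (lee_wpmul2l LLe h3) _.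
    rewrite -[(\int[mu]_(w in Om) _)%E]/(v_sqnorm S g) -(v_norm_sqr Lg) -!EFinM lee_fin.
    by rewrite le_eqVlt; apply/orP; left; apply/eqP; ring.
  apply: le_trans (lee_wpmul2l two0 h4) _; rewrite -EFinM lee_fin /K2.
  by rewrite le_eqVlt; apply/orP; left; apply/eqP; ring.
have c0 : 0 <= s2 * C0 * b + e by rewrite addr_ge0 ?mulr_ge0 ?(ltW s20) ?(ltW C00) ?(ltW e0).
apply/(v_norm_le (BL Bh)); first by rewrite mulr_ge0 ?v_norm_ge0.
apply: le_trans tot _; rewrite lee_fin exprMn; apply: ler_wpM2r; first exact: sqr_ge0.
have q1 : 2 * N * L ^+ 2 = (s2 * L) ^+ 2 by rewrite exprMn sqr_sqrtr // mulr_ge0 // ltW.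
have q2 : 2 * (K2 * e2) <= (e / 2) ^+ 2.
  rewrite /e2; move: ((e / 2) ^+ 2) (sqr_ge0 (e / 2)) => y y0.
  rewrite (_ : 2 * _ = y * (K2 / (K2 + 1))); last by field; rewrite gt_eqF // ltr_wpDl.
  by apply: ler_piMr => //; rewrite ler_pdivrMr ?ltr_wpDl // mul1r lerDl.
have q3 : s2 * C0 * b + e = s2 * L + e / 2 by rewrite /L /e1; field; rewrite gt_eqF.
rewrite q1 q3; have q4 : 0 <= s2 * L * (e / 2) by rewrite !mulr_ge0 ?(ltW s20) // ltW // divr_gt0.
rewrite sqrrD; apply: le_trans (lerD (lexx _) q2) _.
by apply: lerD => //; rewrite lerDl mulrn_wge0.
Qed.

End essential_norm.

(** * The essential norm bounded by the limit of the translated operators *)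

Section essential_norm_le.
Variables (R : realType) (n : nat) (S : bergman_data R n) (HS : bergman_type S).
Local Notation X := (cspace R n).
Local Notation BX := (borel_cspace R n).
Local Notation Om := (Omega S).
Local Notation mu := (sigma S).
Local Notation vfun := (X -> nat -> R[i]).
Local Notation vB := (vbergman S).
Local Notation vL := (vL2 S).
Local Notation nrm := (vnorm S).
Local Notation Kv := (Kv S).
Local Notation proj := (proj S).
Implicit Types f g h F : vfun.

Let Omo : open Om := Omega_open HS.
Let mOm : measurable (Om : set BX) := open_borel Omo.
Let H := bergman_hilbert HS.
Let BL f : vB f -> vL f := @v_bergman_L2 R n S f.

Lemma head_bergman m f : vB f -> vB (head m f).
Proof.
move=> Bf; apply/vbergmanP; split; last exact: (head_L2 HS m (BL Bf)).
- by move=> z nz; apply/funext => k; rewrite /head (v_bergman_out Bf nz) if_same.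
- move=> k; rewrite /head; case: (k < m)%N; first exact: v_bergman_analytic.
  by move=> z Oz; exact: (@differentiable_cst _ X R[i]^o).
Qed.

Lemma mult_tailE m f : mult_tail m f = f - head m f.
Proof.
apply/funext => w; apply/funext => k; rewrite -[RHS]/(f w k - head m f w k) /mult_tail /head.
by case: ifP => _; rewrite ?subrr ?subr0.
Qed.

Lemma nrm_mono f g : vL f -> vL g -> (forall w, Om w -> (l2sqnorm (f w) <= l2sqnorm (g w))%E) ->
  nrm f <= nrm g.
Proof.
move=> Lf Lg fg; apply/(v_norm_le Lf); first exact: v_norm_ge0.
rewrite (v_norm_sqr Lg); apply: (@ge0_le_integral _ BX R mu Om mOm) => //.
- by move=> w _; exact: l2sqnorm_ge0.
- exact: v_L2_measurable.
- exact: v_L2_measurable.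
Qed.

Definition cut (r : R) (m : nat) f : vfun := restr (dball S (0 : X) r) (head m f).

Let mball r : measurable (dball S (0 : X) r : set BX).
Proof. by apply: (dball_borel HS); exact: Omega0 HS. Qed.

Lemma cut_L2 r m f : vL f -> vL (cut r m f).
Proof. by move=> Lf; exact: (restr_L2 HS (mball r) (head_L2 HS m Lf)). Qed.

Lemma nrm_cut r m f : vL f -> nrm (cut r m f) <= nrm f.
Proof.
move=> Lf; apply: (nrm_mono (cut_L2 r m Lf) Lf) => w Ow.
apply: le_trans (l2sqnorm_head m f w); rewrite l2sqnorm_restr patchE.
by case: ifP => // _; exact: l2sqnorm_ge0.
Qed.

Lemma cut_lin r m (a : R[i]) f g : cut r m (a *: f + g) = a *: cut r m f + cut r m g.
Proof.
apply/funext => w; apply/funext => k.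
rewrite -[RHS]/(a * cut r m f w k + cut r m g w k) /cut /restr /head.
by case: asboolP => _; [case: ifP => _|]; rewrite ?mulr0 ?addr0.
Qed.

(** The projections of the cut functions have no coordinate from m on and are dominated by M^2
    [gamma]; T then preserves norm convergence. *)
Lemma compact_cut T r m : bounded_operator S T ->
  compact_operator S (fun f => T (proj (cut r m f))).
Proof.
move=> bT; have [M0 M00 hM] := op_bound bT.
have BP f : vB f -> vB (proj (cut r m f)).
  by move=> Bf; exact: (proj_bergman HS (cut_L2 r m (BL Bf))).
split.
  split; rewrite -?vbergmanE.
  - by move=> f Bf; exact: (opB bT (BP f Bf)).
  - move=> a f g Bf Bg; rewrite -[X in cut r m X]/(a *: f + g) cut_lin.
    have Lf := cut_L2 r m (BL Bf); have Lg := cut_L2 r m (BL Bg).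
    rewrite (projD HS (v_L2Z Omo a Lf) Lg) (projZ HS a Lf).
    by rewrite (op_lin bT a (BP f Bf) (BP g Bg)).
  - exists M0; rewrite -vnormE => f Bf; apply: le_trans (hM _ (BP f Bf)) _.
    rewrite ler_pM2l //; apply: le_trans (nrm_proj HS (cut_L2 r m (BL Bf))) _.
    exact: nrm_cut (BL Bf).
rewrite -vbergmanE -vnormE => u M uM.
have Bu j : vB (u j) := (uM j).1.
have Lu j : vL (cut r m (u j)) := cut_L2 r m (BL (Bu j)).
have cu0 j w k : Om w -> (m <= k)%N -> cut r m (u j) w k = 0.
  by move=> Ow mk; rewrite /cut /restr /head; case: asboolP => // _; rewrite ltnNge mk.
have cuM j : nrm (cut r m (u j)) <= M by apply: le_trans (nrm_cut r m (BL (Bu j))) (uM j).2.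
have [|||||s [f [sS Bf cf]]] := @dominated_compactness _ _ _ HS
    (fun j => proj (cut r m (u j))) M m (fun w => (M ^+ 2)%:E * gamma S r w)%E.
- move=> j; split; first exact: BP.
  by apply: le_trans (nrm_proj HS (Lu j)) _.
- by move=> j w k Ow mk; apply: (proj_head HS (Lu j) Ow mk) => v l Ov ml; exact: cu0.
- by apply: measurable_funeM; exact: gamma_measurable.
- rewrite (@ge0_integralZl_EFin _ BX R mu Om mOm _ (fun w _ => gamma_ge0 S r w)
    (gamma_measurable HS r) _ (sqr_ge0 M)).
  by rewrite lte_mul_pinfty ?lee_fin ?sqr_ge0 //; exact: gamma_integral.
- move=> j w k Ow; have BK := Kv_bergman HS k Ow.
  have [c c1 ->] := eval_cmod HS k (BP _ (Bu j)) Ow.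
  have BcK := v_bergmanZ Omo c BK.
  rewrite rdotC (proj_dot HS (Lu j) BcK) rdotC.
  apply: le_trans (rdot_supp_sqr HS (mball r) _ (Lu j) (BL BcK) _) _.
  + exact: dball_Om.
  + by move=> v Ov nv; exact: restr_out.
  apply: lee_pmul.
  + by rewrite lee_fin sqr_ge0.
  + by apply: integral_ge0 => v _; exact: l2sqnorm_ge0.
  + by rewrite lee_fin lerXn2r ?nnegrE ?v_norm_ge0 ?(le_trans (v_norm_ge0 _ _) (cuM j)).
  rewrite le_eqVlt; apply/orP; left; apply/eqP; apply: eq_integral => v _.
  by rewrite -[(c *: _) v]/(c *: Kv w k v) l2sqnormZ c1 expr1n mul1e l2sqnorm_Kv.
exists s, (T f); split => //; first exact: (opB bT Bf).
apply: (@squeeze_cvgr _ _ _ _ (fun=> 0) (fun j => M0 * nrm (proj (cut r m (u (s j))) - f))).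
- apply: nearW => j; rewrite v_norm_ge0 /= -(opBB HS bT (BP _ (Bu (s j))) Bf).
  exact: (hM _ (v_bergmanB Omo (BP _ (Bu (s j))) Bf)).
- exact: cvg_cst.
- by rewrite -(mulr0 M0); apply: cvgMr.
Qed.

Lemma sub_op T A : bounded_operator S T -> bounded_operator S A ->
  bounded_operator S (fun f => T f - A f).
Proof.
move=> bT bA; have [M1 M10 h1] := op_bound bT; have [M2 M20 h2] := op_bound bA.
split; rewrite -?vbergmanE.
- by move=> f Bf; exact: (v_bergmanB Omo (opB bT Bf) (opB bA Bf)).
- move=> a f g Bf Bg; rewrite -[X in T X]/(a *: f + g) -[X in A X]/(a *: f + g).
  rewrite (op_lin bT a Bf Bg) (op_lin bA a Bf Bg); apply/funext => w; apply/funext => k.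
  rewrite -[LHS]/((a * T f w k + T g w k) - (a * A f w k + A g w k)).
  by rewrite -[RHS]/(a * (T f w k - A f w k) + (T g w k - A g w k)); ring.
exists (M1 + M2); rewrite -vnormE => f Bf.
apply: le_trans (nrmB H (BL (opB bT Bf)) (BL (opB bA Bf))) _.
by rewrite mulrDl; apply: lerD; [exact: h1|exact: h2].
Qed.

Lemma opnorm_ub T e : bounded_operator S T -> (opnorm S T <= e%:E)%E ->
  forall f, vB f -> nrm (T f) <= e * nrm f.
Proof.
move=> bT he f Bf; have h g : vB g -> nrm g <= 1 -> nrm (T g) <= e.
  move=> Bg g1; rewrite -lee_fin; apply: le_trans he; apply: ereal_sup_ubound.
  by exists g; [rewrite -vbergmanE -vnormE; split|rewrite -vnormE].
have [f0|f0] := eqVneq (nrm f) 0.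
  have [M M0 hM] := op_bound bT; apply: le_trans (hM f Bf) _.
  by rewrite f0 !mulr0.
have fp : 0 < nrm f by rewrite lt_neqAle eq_sym f0 v_norm_ge0.
have i0 : 0 <= (nrm f)^-1 by rewrite invr_ge0 ltW.
have := h _ (v_bergmanZ Omo ((nrm f)^-1)%:C Bf).
rewrite (v_normZ Omo _ (BL Bf)) cmodR ger0_norm // mulVf // lexx => /(_ isT).
rewrite (opZ bT _ Bf) (v_normZ Omo _ (BL (opB bT Bf))) cmodR ger0_norm //.
by rewrite mulrC ler_pdivrMr.
Qed.

Lemma opnorm_ge0 T : (0 <= opnorm S T)%E.
Proof.
have m0 : v_bergman S (0 : vfun) /\ v_norm S (0 : vfun) <= 1.
  by rewrite -vbergmanE -vnormE (nrm0 H); split; [exact: v_bergman0|exact: ler01].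
apply: (@le_trans _ _ (v_norm S (T 0%R))%:E); first by rewrite lee_fin -vnormE v_norm_ge0.
by apply: ereal_sup_ubound; exists (0 : vfun); [exact: m0|exact: erefl].
Qed.

Lemma opnorm_le T e : (forall f, vB f -> nrm f <= 1 -> nrm (T f) <= e) -> (opnorm S T <= e%:E)%E.
Proof.
move=> h; apply: ge_ereal_sup => _ [f + <-]; rewrite -vbergmanE -vnormE => -[Bf f1].
by rewrite lee_fin; exact: h.
Qed.

(** T - A is T on the coordinates from m on, small by the choice of m, plus T P on the first m
    coordinates outside D(0, r), where [far_bound] applies. As r depends on m, the tail is cut
    first. *)
Lemma essnorm_le : exists2 C : R, 0 < C & forall T b p, bounded_operator S T -> 0 <= b ->
  berezin_bound S T b -> (4 - kappa S) / (2 - kappa S) < p ->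
  kernel_condition S (adjoint S T) p -> kernel_condition S T p ->
  limn_esup (fun m : nat => opnorm S (fun f => T (mult_tail m f))) = 0%E ->
  (essnorm S T <= (C * b)%:E)%E.
Proof.
have [C C0 hC] := far_bound HS; exists C => // T b p bT b0 hb hp hA hT hlim.
apply/lee_addgt0Pr => e e0; have e2 : 0 < e / 2 by rewrite divr_gt0.
have [m hm] : exists m : nat, (opnorm S (fun f => T (mult_tail m f)) <= (e / 2)%:E)%E.
  have : (limn_esup (fun m : nat => opnorm S (fun f => T (mult_tail m f))) < (e / 2)%:E)%E.
    by rewrite hlim lte_fin.
  move=> /ereal_inf_lt[_ [V [N _ NV] <-] hV]; exists N.
  apply: le_trans (ltW hV); apply: ereal_sup_ubound; exists N => //.
  by apply: NV => /=.
have [r hr] := hC T b p bT b0 hb hp hA hT m _ e2.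
pose A f := T (proj (cut r m f)).
apply: (@le_trans _ _ (opnorm S (fun f => T f - A f))).
  by apply: ereal_inf_lbound; exists A => //; exact: compact_cut.
rewrite -EFinD; apply: opnorm_le => f Bf f1.
have Bh := head_bergman m Bf; have Lh := BL Bh; have Lc := cut_L2 r m (BL Bf).
have Lg := v_L2B Omo Lh Lc.
have Bt : vB (mult_tail m f) by rewrite mult_tailE; exact: (v_bergmanB Omo Bf Bh).
have BPg := proj_bergman HS Lg; have BPc := proj_bergman HS Lc.
have addKB (u v : vfun) : u = v + (u - v) by rewrite addrC subrK.
have -> : T f - A f = T (proj (head m f - cut r m f)) + T (mult_tail m f).
  have e1 : f = head m f + mult_tail m f by rewrite mult_tailE -addKB.
  rewrite {1}e1 (opD bT Bh Bt) /A (projB HS Lh Lc) (proj_id HS Bh) (opBB HS bT Bh BPc).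
  by rewrite addrAC.
apply: le_trans (nrmD H (BL (opB bT BPg)) (BL (opB bT Bt))) _.
have t1 : nrm (T (mult_tail m f)) <= e / 2.
  rewrite -lee_fin; apply: le_trans hm; apply: ereal_sup_ubound.
  by exists f; [rewrite -vbergmanE -vnormE; split|rewrite -vnormE].
have [_ _ dC _] := dist_metric HS; have O0 := Omega0 HS.
have t2 : nrm (T (proj (head m f - cut r m f))) <= (C * b + e / 2) * nrm (head m f - cut r m f).
  apply: (hr _ Lg) => [w Ow wr|w k Ow mk].
    rewrite -[(head m f - cut r m f) w]/(head m f w - cut r m f w) /cut restr_in ?subrr //.
    by split => //; rewrite dC.
  rewrite -[(head m f - cut r m f) w k]/(head m f w k - cut r m f w k) /cut /restr /head.
  by rewrite ltnNge mk /= if_same subrr.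
have t3 : nrm (head m f - cut r m f) <= 1.
  apply: le_trans f1; apply: (nrm_mono Lg (BL Bf)) => w Ow.
  apply: le_trans (l2sqnorm_head m f w).
  rewrite -[(head m f - cut r m f) w]/(head m f w - cut r m f w).
  have [Dw|nD] := pselect (dball S (0 : X) r w).
    by rewrite /cut restr_in // subrr l2sqnorm0 l2sqnorm_ge0.
  by rewrite /cut restr_out // subr0.
have c0 : 0 <= C * b + e / 2 by apply: addr_ge0 (mulr_ge0 (ltW C0) b0) (ltW e2).
have t4 := le_trans t2 (ler_wpM2l c0 t3); rewrite mulr1 in t4.
apply: le_trans (lerD t4 t1) _.
by rewrite -addrA -splitr.
Qed.

End essential_norm_le.

(** * Behaviour at infinity *)

Section limits_at_infinity.
Variables (R : realType) (n : nat) (S : bergman_data R n) (HS : bergman_type S).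
Local Notation X := (cspace R n).
Local Notation Om := (Omega S).
Local Notation vfun := (X -> nat -> R[i]).
Local Notation K := (Defs.kernel S).
Local Notation nK := (normK S).
Local Notation vB := (vbergman S).
Local Notation vL := (vL2 S).
Local Notation rdot := (@rdot R n S).
Local Notation nrm := (vnorm S).
Local Notation Kv := (Kv S).
Local Notation phi := (phi S).
Implicit Types f g h F : vfun.

Let Omo : open Om := Omega_open HS.
Let H := bergman_hilbert HS.
Let BL f : vB f -> vL f := @v_bergman_L2 R n S f.

(** d(phi_z(w), 0) is comparable to d(w, z), which is at least d(z, 0) - d(w, 0). *)
Lemma dist_phi_infty w (M : R) : Om w -> exists r : R, forall z, Om z -> r < dist S z 0 ->
  M < dist S (phi z w) 0.
Proof.
move=> Ow; have [C C0 hC] := dist_phi HS; have [d0 _ dC dT] := dist_metric HS.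
have O0 := Omega0 HS; exists (C * `|M| + dist S w 0) => z Oz h.
have [h1 _] := hC z w Oz Ow; have h2 := dT z w 0 Oz Ow O0.
apply: le_lt_trans (ler_norm M) _; rewrite -(ltr_pM2l C0).
by apply: lt_le_trans h1; rewrite (dC w z) //; lra.
Qed.

Lemma normK_phi_infty w (M : R) : Om w -> exists r : R, forall z, Om z -> r < dist S z 0 ->
  M <= nK (phi w z).
Proof.
move=> Ow; have : (\forall x \near +oo, M <= x) by apply: nbhs_pinfty_ge; exact: num_real.
move=> /(normK_infty HS)[B hB]; have [C C0 hC] := dist_phi HS.
have [d0 _ dC dT] := dist_metric HS; have O0 := Omega0 HS.
exists (C * `|B| + dist S w 0) => z Oz h.
apply: hB; first exact: phi_Omega HS _ _ Ow Oz.
have [h1 _] := hC w z Ow Oz; have h2 := dT z w 0 Oz Ow O0.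
apply: le_lt_trans (ler_norm B) _; rewrite -(ltr_pM2l C0).
by apply: lt_le_trans h1; lra.
Qed.

(** The two kernel bounds multiply to C^2 |K_w| |K_x| / |K_{phi_w(phi_z(x))}|, the factors
    |K_{phi_z(x)}| cancelling; the remaining denominator tends to infinity with z. *)
Lemma translation_Kv_infty w k x l (e : R) : Om w -> Om x -> 0 < e ->
  exists r : R, forall z, Om z -> r < dist S z 0 -> cmod (translation S z (Kv w k) x l) <= e.
Proof.
move=> Ow Ox e0; have [C C0 hC] := nkernel_mod HS.
have nw := normK_gt0 HS Ow; have nx := normK_gt0 HS Ox.
have [B hB] := normK_phi_infty (C ^+ 2 * (nK w * nK x) / e) Ow.
have [r hr] := dist_phi_infty B Ox; exists r => z Oz rz.
have Op := phi_Omega HS Oz Ox; have h1 := hB _ Op (hr z Oz rz).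
have [h2 _] := hC z x Oz Ox; have [h3 _] := hC w (phi z x) Ow Op.
have np := normK_gt0 HS Op; have npp := normK_gt0 HS (phi_Omega HS Ow Op).
rewrite translationE cmodM KvE [cmod (K w _ * _)]cmodM.
have hb : cmod (l2basis R k l) <= 1.
  by rewrite /l2basis; case: (l == k); rewrite ?cmod1 // cmod0.
have hK : cmod (K w (phi z x)) <= nK w * (C * (nK (phi z x) / nK (phi w (phi z x)))).
  rewrite -ler_pdivrMl // mulrC; move: h3.
  by rewrite /nkernel cmodM cmodV cmodR gtr0_norm.
apply: (@le_trans _ _ (nK w * (C * (nK (phi z x) / nK (phi w (phi z x)))) * 1 * (C * (nK x / nK (phi z x))))).
  apply: ler_pM => //; rewrite ?mulr_ge0 ?cmod_ge0 //.
  by apply: ler_pM => //; rewrite ?cmod_ge0.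
rewrite (_ : _ * _ = C ^+ 2 * (nK w * nK x) / nK (phi w (phi z x))); last first.
  by field; rewrite !gt_eqF.
by rewrite ler_pdivrMr // [e * _]mulrC -ler_pdivrMr.
Qed.

Lemma cvg0_of_infty (z : nat -> X) (g : X -> R) : (forall m, Om (z m)) ->
  (forall m, m%:R < dist S (z m) 0) ->
  (forall e : R, 0 < e -> exists r : R, forall z, Om z -> r < dist S z 0 -> `|g z| <= e) ->
  g (z m) @[m --> \oo] --> (0 : R).
Proof.
move=> Oz zm h; apply/cvgr0Pnorm_le => e e0; have [r hr] := h e e0.
exists (Num.trunc `|r|).+1 => // m /= rm; apply: hr => //; apply: lt_trans (zm m).
apply: le_lt_trans (ler_norm r) _; apply: lt_le_trans (truncnS_gt _) _.
by rewrite ler_nat.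
Qed.

Lemma translation_Kv_weakly_null (z : nat -> X) w k (c : R[i]) : Om w -> (forall m, Om (z m)) ->
  (forall m, m%:R < dist S (z m) 0) ->
  weakly_null vB rdot (fun m => translation S (z m) (c *: Kv w k)).
Proof.
move=> Ow Oz zm; have [e [etot he]] := Kv_total HS; have [C C0 hC] := translation_bounded HS.
have BK := Kv_bergman HS k Ow; have BcK := v_bergmanZ Omo c BK.
apply: (weakly_null_total H (M := C * nrm (c *: Kv w k)) etot).
  by move=> m; exact: hC (Oz m) BcK.
move=> _ [j _ <-]; have [c' [x [l [Ox ->]]]] := he j.
apply: (cvg0_of_infty (g := fun z => rdot (translation S z (c *: Kv w k)) (c' *: Kv x l)) Oz zm).
move=> d d0; pose q := cmod c' * cmod c + 1.
have q0 : 0 < q by rewrite ltr_wpDl // mulr_ge0 ?cmod_ge0.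
have [r hr] := translation_Kv_infty k l Ow Ox (divr_gt0 d0 q0).
exists r => y Oy ry; have BU := opB (translation_op HS Oy) BcK.
have c'E : c' = (((c'^*)%R)^*)%R by rewrite conjCK.
rewrite {1}c'E -rdot_conj (rdot_Kv HS l (v_bergmanZ Omo _ BU) Ox).
apply: le_trans (Re_le_cmod _) _.
rewrite (opZ (translation_op HS Oy) c BK) -[(_ *: _) x l]/((c'^*)%R * (c * translation S y (Kv w k) x l)).
rewrite cmodM [cmod (c * _)]cmodM -[(c'^*)%R]/(conjc c') cmodJ mulrA.
apply: le_trans (ler_wpM2l _ (hr y Oy ry)) _; first by rewrite mulr_ge0 ?cmod_ge0.
rewrite mulrCA ler_piMr ?(ltW d0) // ler_pdivrMr // mul1r lerDl //.
Qed.

(** Tested against the total vectors c K_w e_k, the pairing moves U_z onto the test vector, and the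
    previous lemma applies. *)
Lemma adjoint_translation_weakly_null (z : nat -> X) f : vB f -> (forall m, Om (z m)) ->
  (forall m, m%:R < dist S (z m) 0) ->
  weakly_null vB rdot (fun m => adjoint S (translation S (z m)) f).
Proof.
move=> Bf Oz zm; have [e [etot he]] := Kv_total HS; have [C C0 hC] := adjoint_translation_bounded HS.
apply: (weakly_null_total H (M := C * nrm f) etot).
  move=> m; split; last exact: hC (Oz m) Bf.
  exact: (adjoint_bergman HS (translation_op HS (Oz m)) Bf).
move=> _ [j _ <-]; have [c [w [k [Ow ->]]]] := he j.
have := translation_Kv_weakly_null k c Ow Oz zm Bf.
rewrite (_ : (fun m => rdot (translation _ _ _) f) =
  (fun m => rdot (adjoint S (translation S (z m)) f) (c *: Kv w k))) //.
apply/funext => m.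
rewrite (adjoint_rdot HS (translation_op HS (Oz m)) (v_bergmanZ Omo c (Kv_bergman HS k Ow)) Bf).
by rewrite rdotC.
Qed.

(** Along a subsequence of any subsequence, A x_m tends in norm to some g. Pairing with g and using
    the adjoint of A, <A x_m, g> tends to 0, so <g, g> = 0. *)
Lemma compact_weakly_null A (x : nat -> vfun) (M : R) : compact_operator S A ->
  (forall m, vB (x m) /\ nrm (x m) <= M) -> weakly_null vB rdot x ->
  nrm (A (x m)) @[m --> \oo] --> (0 : R).
Proof.
move=> [bA cA] xM wn; apply: cvg_subsubseq => s sS.
rewrite -vbergmanE -vnormE in cA.
have [s' [g [s'S Bg cg]]] := cA (fun m => x (s m)) M (fun m => xM (s m)).
exists s' => //.
have Bx m : vB (x (s (s' m))) := (xM _).1.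
have BA m : vB (A (x (s (s' m)))) := opB bA (Bx m).
suff g0 : g = 0.
  move: cg; rewrite g0 (_ : (fun m => _) = (fun m => nrm (A (x (s (s' m)))))) //.
  by apply/funext => m; rewrite subr0.
apply: (dot_definite H Bg).
have c1 := cvg_dot_l H (fun m => BL (BA m)) (BL Bg) (BL Bg) cg.
have BAg := adjoint_bergman HS bA Bg.
have c2 : rdot (A (x (s (s' m)))) g @[m --> \oo] --> (0 : R).
  rewrite (_ : (fun m => _) = (fun m => rdot (x (s (s' m))) (adjoint S A g))).
    apply: (cvg_subseq (u := fun m => rdot (x (s m)) (adjoint S A g)) s'S).
    exact: (cvg_subseq (u := fun m => rdot (x m) (adjoint S A g)) sS (wn _ BAg)).
  by apply/funext => m; rewrite (adjoint_rdot HS bA (Bx m) Bg).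
exact: (cvg_unique (@Rhausdorff R) c1 c2).
Qed.

Lemma compact_adjoint_translation A f (e : R) : compact_operator S A -> vB f -> 0 < e ->
  exists r : R, forall z, Om z -> r < dist S z 0 -> nrm (A (adjoint S (translation S z) f)) <= e.
Proof.
move=> cA Bf e0; apply: contrapT => hn.
have /choice[z hz] : forall m : nat, exists z : X,
    [/\ Om z, m%:R < dist S z 0 & e < nrm (A (adjoint S (translation S z) f))].
  move=> m; apply: contrapT => hm; apply: hn; exists m%:R => z Oz mz.
  by rewrite leNgt; apply/negP => ez; apply: hm; exists z.
have Oz m : Om (z m) by have [] := hz m.
have zm m : m%:R < dist S (z m) 0 by have [] := hz m.
have [C C0 hC] := adjoint_translation_bounded HS.
have wn := adjoint_translation_weakly_null Bf Oz zm.
have xM m : vB (adjoint S (translation S (z m)) f) /\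
    nrm (adjoint S (translation S (z m)) f) <= C * nrm f.
  split; last exact: hC (Oz m) Bf.
  exact: (adjoint_bergman HS (translation_op HS (Oz m)) Bf).
have /cvgr0Pnorm_lt /(_ e e0)[N _ hN] := compact_weakly_null cA xM wn.
have := hN N (leqnn N); have [_ _ big] := hz N.
by rewrite ger0_norm ?v_norm_ge0 // => /(lt_trans big); rewrite ltxx.
Qed.

(** Split T as (T - A) + A: the first part costs the norms of U_z and of its adjoint times q, and
    the second vanishes at infinity. *)
Lemma conj_translation_le : exists2 C : R, 0 < C & forall T A f (e q : R),
  bounded_operator S T -> compact_operator S A -> vB f -> nrm f <= 1 -> 0 < e ->
  (opnorm S (fun f => (T f - A f)%R) <= q%:E)%E ->
  exists r : R, forall z, Om z -> r < dist S z 0 -> nrm (conj_translation S T z f) <= C * q + e.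
Proof.
have [C1 C10 hU] := translation_bounded HS; have [C2 C20 hU'] := adjoint_translation_bounded HS.
exists (C1 * C2); first exact: mulr_gt0.
move=> T A f e q bT cA Bf f1 e0 hq; have bA := cA.1.
have bD := sub_op HS bT bA; have hD := opnorm_ub HS bD hq.
have q0 : 0 <= q.
  by rewrite -lee_fin; apply: le_trans hq; exact: (opnorm_ge0 HS).
have [r hr] := compact_adjoint_translation cA Bf (divr_gt0 e0 C10).
exists r => z Oz rz; have bU := translation_op HS Oz.
have Bx := adjoint_bergman HS bU Bf; have BTx := opB bT Bx; have BAx := opB bA Bx.
have [_ h1] := hU z _ Oz BTx; apply: le_trans h1 _.
have addKB (u v : vfun) : u = (u - v) + v by rewrite subrK.
rewrite (addKB (T _) (A (adjoint S (translation S z) f))).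
have h2 := nrmD H (v_L2B Omo (BL BTx) (BL BAx)) (BL BAx).
apply: le_trans (ler_wpM2l (ltW C10) h2) _.
have h3 : nrm (T (adjoint S (translation S z) f) - A (adjoint S (translation S z) f)) <= q * C2.
  apply: le_trans (hD _ Bx) _; apply: ler_wpM2l => //.
  by apply: le_trans (hU' z f Oz Bf) _; rewrite ler_piMr // ltW.
apply: le_trans (ler_wpM2l (ltW C10) (lerD h3 (hr z Oz rz))) _.
by rewrite le_eqVlt; apply/orP; left; apply/eqP; field; rewrite gt_eqF.
Qed.

(* For (b): U_z^* K_w e_i is a multiple of K_v e_i with v = phi_z w, of norm
   bounded in z. *)
Lemma conj_translation_Kv T w i : bounded_operator S T -> Om w ->
  (forall e : R, 0 < e -> exists r : R, forall v, Om v -> r < dist S v 0 ->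
     nrm (T (kvec S v (l2basis R i))) <= e) ->
  forall e : R, 0 < e -> exists r : R, forall z, Om z -> r < dist S z 0 ->
     nrm (conj_translation S T z (Kv w i)) <= e.
Proof.
move=> bT Ow hT e e0; have [C1 C10 hU] := translation_bounded HS.
have [C C0 hC] := nkernel_mod HS; have nw := normK_gt0 HS Ow.
have q0 : 0 < C1 * (C * nK w) by rewrite !mulr_gt0.
have [B hB] := hT _ (divr_gt0 e0 q0); have [r hr] := dist_phi_infty B Ow.
exists r => z Oz rz; have Op := phi_Omega HS Oz Ow; have np := normK_gt0 HS Op.
have BK := Kv_bergman HS i Op.
rewrite /conj_translation (adjoint_translation_Kv HS i Oz Ow).
have -> : Kv (phi z w) i = (nK (phi z w))%:C *: kvec S (phi z w) (l2basis R i).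
  by rewrite kvecE scalerA -rmorphM /= mulfV ?gt_eqF // rmorph1 scale1r.
have Bk : vB (kvec S (phi z w) (l2basis R i)).
  by rewrite kvecE; exact: (v_bergmanZ Omo _ BK).
rewrite scalerA (opZ bT _ Bk).
have BT := v_bergmanZ Omo (((nkernel S z w)^*)%R * (nK (phi z w))%:C) (opB bT Bk).
have [_ h1] := hU z _ Oz BT; apply: le_trans h1 _.
rewrite (v_normZ Omo _ (BL (opB bT Bk))) cmodM -[(_^*)%R]/(conjc _) cmodJ cmodR gtr0_norm //.
have h2 := hB _ Op (hr z Oz rz); have [h3 _] := hC z w Oz Ow.
have h4 : cmod (nkernel S z w) * nK (phi z w) <= C * nK w.
  by rewrite -ler_pdivlMr // -mulrA.
have h5 : cmod (nkernel S z w) * nK (phi z w) * nrm (T (kvec S (phi z w) (l2basis R i))) <=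
    C * nK w * (e / (C1 * (C * nK w))).
  by apply: ler_pM => //; rewrite ?v_norm_ge0 // mulr_ge0 ?cmod_ge0 ?(ltW np).
apply: le_trans (ler_wpM2l (ltW C10) h5) _.
by rewrite le_eqVlt; apply/orP; left; apply/eqP; field; rewrite !gt_eqF.
Qed.

(** The operators T^z are bounded uniformly in z, so the f with T^z f -> 0 form a closed complex
    subspace; it contains the total family of kernels. *)
Lemma conj_translation_infty T : bounded_operator S T ->
  (forall i (e : R), 0 < e -> exists r : R, forall v, Om v -> r < dist S v 0 ->
     nrm (T (kvec S v (l2basis R i))) <= e) ->
  forall f, vB f -> forall e : R, 0 < e -> exists r : R, forall z, Om z -> r < dist S z 0 ->
     nrm (conj_translation S T z f) <= e.
Proof.
move=> bT hT; have [E [Etot hE]] := Kv_total HS.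
have [C1 C10 hU] := translation_bounded HS; have [C2 C20 hU'] := adjoint_translation_bounded HS.
have [M M0 hM] := op_bound bT.
have bC z f : Om z -> vB f -> nrm (conj_translation S T z f) <= C1 * (M * (C2 * nrm f)).
  move=> Oz Bf; have bU := translation_op HS Oz.
  have Bx := adjoint_bergman HS bU Bf; have BTx := opB bT Bx.
  have [_ h1] := hU z _ Oz BTx; apply: le_trans h1 _; rewrite ler_pM2l //.
  by apply: le_trans (hM _ Bx) _; rewrite ler_pM2l //; exact: hU'.
pose P : set vfun := [set f | forall e : R, 0 < e -> exists r : R, forall z, Om z -> r < dist S z 0 ->
     nrm (conj_translation S T z f) <= e].
have Zc (c : R[i]) f : vB f -> P f -> P (c *: f).
  move=> Bf Pf e e0; have q0 : 0 < cmod c + 1 by rewrite ltr_wpDl ?cmod_ge0.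
  have [r hr] := Pf _ (divr_gt0 e0 q0); exists r => z Oz rz.
  have bz := conj_translation_op HS bT Oz.
  rewrite (opZ bz c Bf) (v_normZ Omo _ (BL (opB bz Bf))).
  apply: le_trans (ler_wpM2l (cmod_ge0 c) (hr z Oz rz)) _.
  by rewrite mulrCA ler_piMr ?(ltW e0) // ler_pdivrMr // mul1r lerDl.
suff : vB `<=` P by move=> h f /h.
apply: (total_ind H Etot).
- move=> _ [j _ <-]; have [c [w [k [Ow ->]]]] := hE j.
  apply: (Zc c _ (Kv_bergman HS k Ow)).
  exact: conj_translation_Kv bT Ow (hT k).
- move=> e e0; exists 0 => z Oz _; apply: le_trans (bC z 0 Oz (v_bergman0 S)) _.
  by rewrite (nrm0 H) !mulr0 ltW.
- move=> f g Bf Bg Pf Pg e e0; have e2 : 0 < e / 2 by rewrite divr_gt0.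
  have [r1 h1] := Pf _ e2; have [r2 h2] := Pg _ e2; exists (Num.max r1 r2) => z Oz.
  rewrite gt_max => /andP[z1 z2]; have bz := conj_translation_op HS bT Oz.
  rewrite (opD bz Bf Bg); apply: le_trans (nrmD H (BL (opB bz Bf)) (BL (opB bz Bg))) _.
  by rewrite [e]splitr; apply: lerD; [exact: h1|exact: h2].
- by move=> a f Bf Pf; exact: Zc.
move=> f Bf h e e0; have e2 : 0 < e / 2 by rewrite divr_gt0.
have q0 : 0 < C1 * (M * C2) by rewrite !mulr_gt0.
have [g [Bg Pg fg]] := h _ (divr_gt0 e2 q0).
have [r hr] := Pg _ e2; exists r => z Oz rz.
have bz := conj_translation_op HS bT Oz; have Bfg := v_bergmanB Omo Bf Bg.
have addKB (u v : vfun) : u = (u - v) + v by rewrite subrK.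
rewrite (addKB f g) (opD bz Bfg Bg).
apply: le_trans (nrmD H (BL (opB bz Bfg)) (BL (opB bz Bg))) _.
rewrite [e]splitr; apply: lerD; last exact: hr.
apply: le_trans (bC z _ Oz Bfg) _.
rewrite (_ : C1 * _ = C1 * (M * C2) * nrm (f - g)); last by rewrite !mulrA.
by rewrite -ler_pdivlMl // mulrC ltW.
Qed.

(** Compact operators are closed in norm: on a weakly null sequence u - g, T differs from a compact
    A by at most the norm of T - A times a bound M', and A (u - g) tends to 0. *)
Lemma essnorm0_compact T : bounded_operator S T -> (essnorm S T <= 0)%E -> compact_operator S T.
Proof.
move=> bT h0; split => //; rewrite -vbergmanE -vnormE => u M uM.
have [E [Etot _]] := Kv_total HS.
have [s [g [sS Bg wn]]] := weak_compactness H Etot uM.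
have Bu m : vB (u m) := (uM m).1.
have Bx m : vB (u (s m) - g) := v_bergmanB Omo (Bu _) Bg.
pose M' := M + nrm g.
have xM m : vB (u (s m) - g) /\ nrm (u (s m) - g) <= M'.
  split => //; apply: le_trans (nrmB H (BL (Bu _)) (BL Bg)) _.
  by apply: lerD => //; exact: (uM _).2.
have M'0 : 0 <= M' := le_trans (v_norm_ge0 _ _) (xM 0%N).2.
exists s, (T g); split => //; first exact: opB bT _ Bg.
apply/cvgr0Pnorm_le => e e0.
have e3 : 0 < e / (2 * (M' + 1)) by rewrite divr_gt0 ?mulr_gt0 // ltr_wpDl.
have : (essnorm S T < (e / (2 * (M' + 1)))%:E)%E by apply: le_lt_trans h0 _; rewrite lte_fin.
move=> /ereal_inf_lt[_ [A cA <-] hA].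
have bA := cA.1; have hD := opnorm_ub HS (sub_op HS bT bA) (ltW hA).
have e2 : 0 < e / 2 by rewrite divr_gt0.
have /cvgr0Pnorm_le /(_ _ e2)[N _ hN] := compact_weakly_null cA xM wn.
exists N => // m /= Nm; rewrite ger0_norm ?v_norm_ge0 //.
have := hN m Nm; rewrite ger0_norm ?v_norm_ge0 // => h2.
have BT := opB bT (Bx m); have BA := opB bA (Bx m).
rewrite -(opBB HS bT (Bu _) Bg).
have addKB (x y : vfun) : x = (x - y) + y by rewrite subrK.
rewrite (addKB (T (u (s m) - g)) (A (u (s m) - g))).
apply: le_trans (nrmD H (v_L2B Omo (BL BT) (BL BA)) (BL BA)) _.
rewrite [e]splitr; apply: lerD => //; apply: le_trans (hD _ (Bx m)) _.
apply: le_trans (ler_wpM2l (ltW e3) (xM m).2) _.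
rewrite mulrAC ler_pdivrMr ?mulr_gt0 ?ltr_wpDl //.
rewrite [e / 2 * _]mulrA mulfVK // ler_wpM2l ?(ltW e0) // lerDl //.
Qed.

Lemma limsup_dinfty_lt (g : X -> R) (x : R) : (limsup_dinfty S g < x%:E)%E ->
  exists r : R, forall z, Om z -> r < dist S z 0 -> g z <= x.
Proof.
rewrite /limsup_dinfty gt_max => /andP[_ /ereal_inf_lt[_ [V [r hr] <-] hV]].
exists r => z Oz rz; rewrite -lee_fin; apply: le_trans (ltW hV).
by apply: ereal_sup_ubound; exists z => //; exact: hr.
Qed.

Lemma limsup_dinfty_le (g : X -> R) (x : R) : 0 <= x ->
  (exists r : R, forall z, Om z -> r < dist S z 0 -> g z <= x) -> (limsup_dinfty S g <= x%:E)%E.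
Proof.
move=> x0 [r hr]; rewrite /limsup_dinfty ge_max lee_fin x0 /=.
pose V : set X := [set z | Om z /\ r < dist S z 0].
apply: (@le_trans _ _ (ereal_sup [set (g z)%:E | z in V])).
  by apply: ereal_inf_lbound; exists V => //; exists r => z Oz rz; split.
by apply: ge_ereal_sup => _ [z [Oz rz] <-]; rewrite lee_fin; exact: hr.
Qed.

Lemma limsup_dinfty_ge0 (g : X -> R) : (0 <= limsup_dinfty S g)%E.
Proof. by rewrite /limsup_dinfty le_max lexx. Qed.

Lemma l2basis_unit i : l2finite (l2basis R i) /\ l2norm (l2basis R i) = 1.
Proof.
split.
  by exists i.+1 => k ik; rewrite /l2basis gtn_eqF.
have e : l2basis R i = fun k => 1 * l2basis R i k by apply/funext => k; rewrite mul1r.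
by rewrite /l2norm e l2sqnorm_single cmod1 expr1n /= sqrtr1.
Qed.

End limits_at_infinity.

Theorem theorem4p4 (R : realType) (n : nat) (S : bergman_data R n)
    (HS : bergman_type S) :
  exists c C : R, [/\ 0 < c, 0 < C &
    forall T : (cspace R n -> nat -> R[i]) -> (cspace R n -> nat -> R[i]),
    bounded_operator S T ->
    forall p : R, (4 - kappa S) / (2 - kappa S) < p ->
    kernel_condition S (adjoint S T) p ->
    kernel_condition S T p ->
    limn_esup (fun m : nat => opnorm S (fun f => T (mult_tail m f))) = 0%E ->
    let berezin_sup :=
      ereal_sup [set limsup_dinfty S (fun z => v_norm S (conj_translation S T z f))
                | f in [set f | v_bergman S f /\ v_norm S f <= 1]] in
    ((c%:E * essnorm S T <= berezin_sup)%E /\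
     (berezin_sup <= C%:E * essnorm S T)%E) /\
    ((exists L : (nat -> R[i]) -> R,
        (forall e, l2finite e -> l2norm e = 1 ->
           v_norm S (T (kvec S z e)) @[z --> at_dinfty S] --> L e) /\
        ereal_sup [set (L e)%:E | e in [set e | l2finite e /\ l2norm e = 1]] = 0%E) ->
     compact_operator S T)].
Proof.
have [C1 C10 hlow] := essnorm_le HS; have [C2 C20 hup] := conj_translation_le HS.
exists C1^-1, C2; split; rewrite ?invr_gt0 // => T bT p hp hA hT hlim B.
have m0 : v_bergman S (0 : cspace R n -> nat -> R[i]) /\ v_norm S (0 : cspace R n -> nat -> R[i]) <= 1.
  by rewrite -vbergmanE -vnormE (nrm0 (bergman_hilbert HS)); split; [exact: v_bergman0|exact: ler01].
have B0 : (0 <= B)%E.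
  apply: le_trans (limsup_dinfty_ge0 S (fun z => v_norm S (conj_translation S T z 0))) _.
  by apply: ereal_sup_ubound; eexists; [exact: m0|exact: erefl].
have Bub f : v_bergman S f -> v_norm S f <= 1 ->
    (limsup_dinfty S (fun z => v_norm S (conj_translation S T z f)) <= B)%E.
  by move=> Bf f1; apply: ereal_sup_ubound; exists f.
split; first split.
(* An infinite B is trivial; a finite one serves itself as the bound b. *)
- case: B B0 Bub => [b||//] B0 Bub; last exact: leey.
  rewrite lee_fin in B0; rewrite lee_pdivrMl // -EFinM.
  apply: (hlow T b p bT B0 _ hp hA hT hlim) => f e Bf f1 e0.
  rewrite vbergmanE in Bf; rewrite vnormE in f1.
  have [|r hr] := @limsup_dinfty_lt _ _ S (fun z => v_norm S (conj_translation S T z f)) (b + e).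
    by apply: le_lt_trans (Bub f Bf f1) _; rewrite lte_fin ltrDl.
  by exists r; rewrite vnormE.
(* Dividing by C2 turns the claim into a lower bound of an infimum, hence into one estimate for each
   compact A. *)
- rewrite -lee_pdivrMl //; apply: le_ereal_inf_tmp => _ [A cA <-].
  rewrite lee_pdivrMl //; have := opnorm_ge0 HS (fun f => T f - A f).
  move hq : (opnorm _ _) => [q||//] q0; last by rewrite gt0_muley ?leey // lte_fin.
  rewrite lee_fin in q0; 
  apply: ge_ereal_sup => _ [f [Bf f1] <-]; apply/lee_addgt0Pr => e e0.
  rewrite -EFinM -EFinD; apply: limsup_dinfty_le.
    by rewrite addr_ge0 ?mulr_ge0 // ltW.
  rewrite -vbergmanE in Bf; rewrite -vnormE in f1 *.
  by apply: (hup T A f e q bT cA Bf f1 e0); rewrite hq.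
move=> [L [hL supL]]; apply: (essnorm0_compact HS bT).
(* Compactness follows from the lower bound with b = 0. *)
have -> : 0%E = (C1 * 0)%:E :> \bar R by rewrite mulr0.
(* The basis vectors are finite unit vectors, and L is at most 0 at each of them because its
   supremum is 0. *)
have Tk i (e : R) : 0 < e -> exists r : R, forall v, Omega S v -> r < dist S v 0 ->
    vnorm S (T (kvec S v (l2basis R i))) <= e.
  move=> e0; have [fi ni] := l2basis_unit R i.
  have L0 : L (l2basis R i) <= 0.
    have : ((L (l2basis R i))%:E <= 0)%E.
      by rewrite -supL; apply: ereal_sup_ubound; exists (l2basis R i).
    by rewrite lee_fin.
  have Le : L (l2basis R i) < e by exact: le_lt_trans L0 e0.
  have [r hr] := hL _ fi ni _ (lt_nbhsl Le).
  by exists r => v Ov rv; rewrite vnormE; exact: ltW (hr v Ov rv).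
apply: (hlow T 0 p bT (lexx 0) _ hp hA hT hlim) => f e Bf _ e0.
by rewrite add0r; exact: (conj_translation_infty HS bT Tk Bf e0).
Qed.
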